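(* Assume that $\Omega$ is convex, that $u^\dagger$ and $u_0$ are images on $\Omega$ with $\int_\Omega u^\dagger\,dx=\int_\Omega u_0\,dx$, that $v$ satisfies $\|\,|v-\nabla u^\dagger|\,\|_1\le\varepsilon$, and that, with $\delta_1=\|u^\dagger-u_0\|_2$, there exists a solution $\tilde u$ of $$\min_u\ \|\,|\nabla u-v|\,\|_1\quad\text{subject to}\quad \|u-u_0\|_2\le\delta_1 \qquad (\ast)$$ for which the constraint is active, i.e. $\|\tilde u-u_0\|_2=\delta_1$. Then there exists a solution $\bar u$ of $(\ast)$ (with the same $\delta_1$) that fulfills $\int_\Omega\bar u\,dx=\int_\Omega u^\dagger\,dx$, and moreover $$\|\bar u-u^\dagger\|_1\le\operatorname{diam}(\Omega)\,\varepsilon .$$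
   Context: $\Omega\subset\mathbb{R}^2$ is a bounded domain (open and connected) and $\operatorname{diam}(\Omega)$ is its diameter. The noisy image $u_0$ is a real-valued function in $L^2(\Omega)$. The ground truth $u^\dagger$ and the competitors $u$ in the minimization range over $L^2(\Omega)\cap BV(\Omega)$. $\nabla u$ is the distributional gradient, a finite $\mathbb{R}^2$-valued Radon measure on $\Omega$. $v$ denotes a finite $\mathbb{R}^2$-valued Radon measure on $\Omega$; $L^1$ vector fields are identified with the corresponding measures. $\|w\|_1$ and $\|w\|_2$ are the $L^1(\Omega)$ and $L^2(\Omega)$ norms of a function. $\|\,|w|\,\|_1$ is the $L^1(\Omega)$ norm of the pointwise Euclidean norm of the vector field $w$, i.e. $\int_\Omega|w|\,dx$, understood as the total variation $|w|(\Omega)$ when $w$ is a measure. *)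

(* Defs.v *)
From HB Require Import structures.
From mathcomp Require Import all_boot all_order all_algebra.
From mathcomp Require Import all_classical all_reals all_analysis.

Set Implicit Arguments.
Unset Strict Implicit.
Unset Printing Implicit Defensive.
Import Order.TTheory GRing.Theory Num.Theory.
Import numFieldNormedType.Exports.
Local Open Scope classical_set_scope.
Local Open Scope ring_scope.

(* The plane is R * R with its product topology (its library norm is the
   max norm, so the Euclidean norm is defined below).  [mplane R] is the same
   type, equipped with its Borel sigma-algebra through [measurableTypeR], the
   measurable space on which the library's [lebesgue_measure] lives. *)
Notation mplane R := (measurableTypeR R * measurableTypeR R)%type.

Section Plane.
Context {R : realType}.
Implicit Types (Omega : set (R * R)) (u w f phi : R * R -> R).

Definition lebesgue2 : {measure set (mplane R) -> \bar R} :=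
  (@lebesgue_measure R \x @lebesgue_measure R)%E.

Definition enorm (x : R * R) : R := Num.sqrt (x.1 ^+ 2 + x.2 ^+ 2).

Definition diam Omega : R :=
  sup [set r | exists x y, [/\ Omega x, Omega y & r = enorm (x - y)]].

Definition bounded_domain Omega :=
  [/\ open Omega, connected Omega & bounded_set Omega].

(* Functions on Omega are total functions on the plane whose values outside
   Omega are irrelevant: they are replaced by 0 via [u \_ Omega]. *)
Definition LpOn Omega (p : \bar R) u : Prop := u \_ Omega \in Lfun lebesgue2 p.

Definition normOn Omega (p : \bar R) u : \bar R :=
  'N[lebesgue2]_p[EFin \o (u \_ Omega)]%E.

Fixpoint Ck (k : nat) f : Prop :=
  continuous f /\
  (if k is k'.+1 then
     [/\ forall x, derivable f x ((1, 0) : R * R),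
         forall x, derivable f x ((0, 1) : R * R),
         Ck k' ('D_((1, 0) : R * R) f)
       & Ck k' ('D_((0, 1) : R * R) f)]
   else True).

(* C_c^infty(Omega), extended by 0 to the plane *)
Definition test_function Omega phi :=
  [/\ forall k, Ck k phi,
      compact (closure [set x | phi x != 0])
    & closure [set x | phi x != 0] `<=` Omega].

(* Finite R^2-valued Borel measures, by components; on an open subset of the
   plane every finite Borel measure is Radon. *)
Definition vmeasure := ({charge set (mplane R) -> \bar R} *
                        {charge set (mplane R) -> \bar R})%type.

(* A measure on Omega is identified with its extension by 0 to the plane. *)
Definition measure_on Omega (mu : vmeasure) :=
  forall A : set (mplane R), measurable A -> A `&` Omega = set0 ->
    mu.1 A = 0%E /\ mu.2 A = 0%E.

Definition vmeasure_sub (mu nu : vmeasure) : vmeasure :=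
  (cadd mu.1 (copp nu.1) : {charge set (mplane R) -> \bar R},
   cadd mu.2 (copp nu.2) : {charge set (mplane R) -> \bar R}).

Definition vmeasure0 : vmeasure :=
  (czero : {charge set (mplane R) -> \bar R},
   czero : {charge set (mplane R) -> \bar R}).

(* |mu|(Omega): supremum over countable Borel partitions *)
Definition vmeasure_variation Omega (mu : vmeasure) : \bar R :=
  ereal_sup [set (\sum_(0 <= k <oo)
                    (enorm (fine (mu.1 (E k)), fine (mu.2 (E k))))%:E)%E
            | E in [set E : nat -> set (mplane R) |
                     [/\ forall k, measurable (E k),
                         trivIset [set: nat] E
                       & \bigcup_k E k = Omega]]].

(* Integral against the Jordan decomposition of nu; the choice of the Hahn
   decomposition does not matter. *)
Definition charge_integral (nu : {charge set (mplane R) -> \bar R})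
    (D : set (mplane R)) (f : mplane R -> R) : R :=
  let: exist P exN := cid (Hahn_decomposition nu) in
  let: exist N nuPN := cid exN in
  \int[jordan_pos nuPN]_(x in D) f x - \int[jordan_neg nuPN]_(x in D) f x.

Definition is_gradient Omega u (g : vmeasure) :=
  measure_on Omega g /\
  forall phi, test_function Omega phi ->
    \int[lebesgue2]_(x in Omega) (u x * 'D_((1, 0) : R * R) phi x) =
      - charge_integral g.1 Omega phi /\
    \int[lebesgue2]_(x in Omega) (u x * 'D_((0, 1) : R * R) phi x) =
      - charge_integral g.2 Omega phi.

Definition BVOn Omega u := LpOn Omega 1%E u /\ exists g, is_gradient Omega u g.

(* The distributional gradient, which is unique on Borel sets for u in
   BV(Omega); the value is junk (0) when the distributional gradient of u is
   not a finite measure. *)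
Definition grad Omega u : vmeasure :=
  match pselect (exists g, is_gradient Omega u g) with
  | left exg => sval (cid exg)
  | right _ => vmeasure0
  end.

Definition feasible Omega u0 (delta : R) u :=
  [/\ LpOn Omega 2%:E u, BVOn Omega u
    & (normOn Omega 2%:E (u \- u0)%R <= delta%:E)%E].

Definition is_solution Omega u0 (v : vmeasure) (delta : R) u :=
  feasible Omega u0 delta u /\
  forall w, feasible Omega u0 delta w ->
    (vmeasure_variation Omega (vmeasure_sub (grad Omega u) v) <=
     vmeasure_variation Omega (vmeasure_sub (grad Omega w) v))%E.

End Plane.

Arguments vmeasure : clear implicits.

(* Main.v *)
Require Import Defs.
From HB Require Import structures.
From mathcomp Require Import all_boot all_order all_algebra.
From mathcomp Require Import all_classical all_reals all_analysis.
From mathcomp Require Import measurable_realfun.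
From mathcomp Require Import ring lra.
Import Order.TTheory GRing.Theory Num.Theory.
Import numFieldNormedType.Exports.
Set Implicit Arguments.
Unset Strict Implicit.
Unset Printing Implicit Defensive.
Local Open Scope classical_set_scope.
Local Open Scope ring_scope.

(** Let ubar = utilde + c, where the constant c gives ubar the mean of udag,
    which is also the mean of u0. Adding a constant does not change the
    distributional gradient ([grad_addc]), so the objective is the same; and
    ubar - u0 is utilde - u0 with its mean removed, so its norm in L^2 has not
    increased. Hence ubar is a solution with the right mean. Since udag is itself
    feasible, the gradient of ubar is within eps of v in total variation, as that
    of udag is. So f = ubar - udag has mean 0 and total variation at most 2 eps,
    and the estimate is the Poincare inequality
      int_Omega |f| <= diam / 2 * |Df|(Omega)
    on a convex domain ([bv_poincare]), with the constant of Acosta and Duran.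

    For a smooth function F with gradient h ([smooth_poincare]), the inequality is
    proved by the localization method of Payne, Weinberger, Lovasz and Simonovits.
    Through any point there is a line that cuts the domain into two convex parts
    over each of which F has integral 0: rotate the line by a half turn and use
    the intermediate value theorem ([cut_exists]). If the inequality fails on the
    domain then it fails on one of the parts by the same fraction of the area.
    Cutting through all the points of a fine grid leaves a convex set K that
    contains no grid point, and such a set lies in a thin strip
    ([convex_strip]). On a thin set F is nearly a function P of the abscissa, and
    the area becomes a measure on an interval whose density rho, the length of the
    slices, is concave. Writing |P s - P t| as at most the integral of |P'| between
    s and t, and exchanging integrals ([crossing]), one is left with the
    inequality 4 A B <= l M rho(r), where A and B are the masses on both sides of
    r, M = A + B and l is the length of the interval ([concave_weight_ineq]). It
    follows from concavity, and l is at most the diameter up to the slope of the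
    strip, which is compensated by the derivative along the strip
    ([thin_poincare]).

    For f of bounded variation, let F be the mollification of f at scale e, on the
    points of the domain farther than e from the boundary. Its gradient there is
    the mollification of the measure Df, whose L^1 norm is at most the total
    variation of Df by duality ([tv_bound]). As e tends to 0 the L^1 norm of f is
    recovered from F by testing against Lipschitz functions close to the sign of f
    ([sign_approx], [mollify_weak]). *)

(** * Open sets, Borel sets and the Euclidean norm in the plane *)
Section plane_base.
Context {R : realType}.
Implicit Types (A B K : set (R * R)) (f : R * R -> R) (x y : R * R).

Local Notation leb2 := (@lebesgue2 R).

Definition box x (r : R) : set (R * R) :=
  [set y | `|y.1 - x.1| < r /\ `|y.2 - x.2| < r].

(** Openness through squares: all geometric constructions below (intersections,
    slices, erosions) exhibit such a square directly. *)
Definition opn A := forall x, A x -> exists2 r, 0 < r & box x r `<=` A.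

Lemma open_opn A : open A -> opn A.
Proof.
move=> oA x Ax; have /nbhs_ballP[e/= e0 eA] : nbhs x A by exact: open_nbhs_nbhs.
by exists e => // y [y1 y2]; apply: eA; split; rewrite /ball/= distrC.
Qed.

Lemma measurable_box x r : measurable (box x r : set (mplane R)).
Proof.
rewrite (_ : box x r = `]x.1 - r, x.1 + r[%classic `*` `]x.2 - r, x.2 + r[%classic).
  by apply: measurableX; exact: measurable_itv.
by apply/seteqP; split => -[y1 y2]; rewrite /box/= !in_itv/= !ltr_distl.
Qed.

(** The Borel sets of [mplane R] are generated by measurable rectangles, not by
    open sets; an open set is nevertheless Borel because it is the union of the
    squares with rational centre and half-side that it contains. *)
Lemma opn_measurable A : opn A -> measurable (A : set (mplane R)).
Proof.
move=> oA.
pose B (p q r : rat) : set (R * R) := if `[< box (ratr p, ratr q) (ratr r) `<=` A >]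
  then box (ratr p, ratr q) (ratr r) else set0.
have -> : A = \bigcup_p \bigcup_q \bigcup_r (B p q r).
  apply/seteqP; split => [x Ax|x [p _ [q _ [r _]]]]; last first.
    by rewrite /B; case: ifPn => // /asboolP; exact.
  have [e e0 eA] := oA x Ax.
  have e4 : 0 < e / 4 by rewrite divr_gt0.
  have /rat_in_itvoo[p] : x.1 - e / 4 < x.1 + e / 4 by lra.
  have /rat_in_itvoo[q] : x.2 - e / 4 < x.2 + e / 4 by lra.
  have /rat_in_itvoo[r] : e / 4 < e / 2 by lra.
  rewrite !in_itv/= => /andP[r1 r2] /andP[q1 q2] /andP[p1 p2].
  exists p => //; exists q => //; exists r => //; rewrite /B.
  case: ifPn => [_|/asboolP[]].
    by rewrite /box/= !ltr_distl; split; apply/andP; split; lra.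
  move=> y; rewrite /box/= !ltr_distl => -[/andP[? ?] /andP[? ?]].
  by apply: eA; rewrite /box/= !ltr_distl; split; apply/andP; split; lra.
apply: bigcupT_measurable_rat => p; apply: bigcupT_measurable_rat => q.
apply: bigcupT_measurable_rat => r; rewrite /B; case: ifPn => _ //.
exact: measurable_box.
Qed.

Lemma open_measurable2 A : open A -> measurable (A : set (mplane R)).
Proof. by move/open_opn; exact: opn_measurable. Qed.

Lemma continuous_measurable2 f : continuous f ->
  measurable_fun setT (f : mplane R -> R).
Proof.
move=> /continuousP cf; apply: (measurability _ (measurable_realfun.RGenOpens.measurableE R)).
move=> _ [_ [a [b ->] <-]]; rewrite setTI; apply: open_measurable2.
exact/cf/interval_open.
Qed.

Lemma derive_continuous (g g' : R -> R) : (forall x : R, is_derive x 1 g (g' x)) -> continuous g.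
Proof.
by move=> dg x; apply/differentiable_continuous/derivable1_diffP; case: (dg x).
Qed.

Lemma enorm_ge0 x : 0 <= enorm x. Proof. exact: sqrtr_ge0. Qed.

Lemma enormE2 x : enorm x ^+ 2 = x.1 ^+ 2 + x.2 ^+ 2.
Proof. by rewrite sqr_sqrtr// addr_ge0 ?sqr_ge0. Qed.

Lemma ler_enorm x c : 0 <= c -> x.1 ^+ 2 + x.2 ^+ 2 <= c ^+ 2 -> enorm x <= c.
Proof. by move=> c0 xc; rewrite -(ler_pXn2r (n := 2))// ?nnegrE ?enorm_ge0// enormE2. Qed.

(** Cauchy-Schwarz: the difference of the squares is the square of a
    determinant. *)
Lemma dot_enorm x y : x.1 * y.1 + x.2 * y.2 <= enorm x * enorm y.
Proof.
apply: le_trans (ler_norm _) _.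
rewrite -(ler_pXn2r (n := 2))// ?nnegrE ?mulr_ge0 ?enorm_ge0//.
rewrite real_normK ?num_real// exprMn !enormE2 -subr_ge0.
by rewrite [leRHS](_ : _ = (x.1 * y.2 - x.2 * y.1) ^+ 2) ?sqr_ge0//; ring.
Qed.

Lemma enormD x y : enorm (x + y) <= enorm x + enorm y.
Proof.
apply: ler_enorm; first by rewrite addr_ge0 ?enorm_ge0.
rewrite [leRHS]sqrrD !enormE2 /=; have := dot_enorm x y; nra.
Qed.

Lemma enormN x : enorm (- x) = enorm x.
Proof. by rewrite /enorm/= !sqrrN. Qed.

Lemma enorm_le x : enorm x <= `|x.1| + `|x.2|.
Proof.
apply: ler_enorm; first by rewrite addr_ge0.
rewrite sqrrD !real_normK ?num_real//.
by rewrite addrAC lerDl mulrn_wge0// mulr_ge0.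
Qed.

Lemma enorm_ge1 x : `|x.1| <= enorm x.
Proof.
by rewrite -(ler_pXn2r (n := 2))// ?nnegrE ?enorm_ge0// enormE2 real_normK ?num_real// lerDl sqr_ge0.
Qed.

Lemma enorm_ge2 x : `|x.2| <= enorm x.
Proof.
by rewrite -(ler_pXn2r (n := 2))// ?nnegrE ?enorm_ge0// enormE2 real_normK ?num_real// lerDr sqr_ge0.
Qed.

Lemma enorm0 : enorm (0 : R * R) = 0.
Proof. by rewrite /enorm/= expr0n addr0 sqrtr0. Qed.

Lemma enormZ (c : R) x : enorm (c * x.1, c * x.2) = `|c| * enorm x.
Proof.
rewrite /enorm/= !exprMn -mulrDr sqrtrM ?sqr_ge0// sqrtr_sqr//.
Qed.

Lemma enorm_dist x y : `|enorm x - enorm y| <= `|x.1 - y.1| + `|x.2 - y.2|.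
Proof.
have h (a b : R * R) : enorm a - enorm b <= `|a.1 - b.1| + `|a.2 - b.2|.
  rewrite lerBlDl; have {1}-> : a = b + (a - b) by rewrite addrC subrK.
  by apply: (le_trans (enormD _ _)); rewrite lerD2l; exact: enorm_le.
rewrite ler_norml h andbT lerNl opprB (le_trans (h _ _))//.
by rewrite distrC [X in _ + X]distrC.
Qed.

End plane_base.

(** * Pairs of points separated by a third point *)
Section crossing.
Context {R : realType}.
Local Notation mu := (@lebesgue_measure R).
Variables (rho g : R -> R).
Hypothesis mrho : measurable_fun setT rho.
Hypothesis mg : measurable_fun setT g.
Hypothesis rho0 : forall s, 0 <= rho s.
Hypothesis g0 : forall s, 0 <= g s.

Definition lmass (r : R) : \bar R := (\int[mu]_(s in `]-oo, r[) (rho s)%:E)%E.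
Definition rmass (r : R) : \bar R := (\int[mu]_(s in `]r, +oo[) (rho s)%:E)%E.

Definition ltrel : set (R * R) := [set p | p.1 < p.2].

Lemma opn_ltrel : opn ltrel.
Proof.
move=> x xl; exists ((x.2 - x.1) / 2); first by rewrite divr_gt0// subr_gt0.
by move=> y; rewrite /box /ltrel/= !ltr_distl => -[/andP[? ?] /andP[? ?]]; lra.
Qed.

Lemma measurable_ltrel : measurable (ltrel : set (mplane R)).
Proof. exact: opn_measurable opn_ltrel. Qed.

Lemma measurable_fun_lt12 : measurable_fun setT (fun p : mplane R => \1_ltrel p : R).
Proof. exact: measurable_indic measurable_ltrel. Qed.

Lemma lmassE r : lmass r = (\int[mu]_s (\1_ltrel (s, r) * rho s)%:E)%E.
Proof.
rewrite /lmass integral_mkcond; apply: eq_integral => s _.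
rewrite patchE indicE; case: ifPn; rewrite ?(inE,notin_setE)/= in_itv/= => sr.
  by rewrite mem_set ?mul1r.
by rewrite memNset ?mul0r.
Qed.

Lemma rmassE r : rmass r = (\int[mu]_s (\1_ltrel (r, s) * rho s)%:E)%E.
Proof.
rewrite /rmass integral_mkcond; apply: eq_integral => s _.
rewrite patchE indicE; case: ifPn; rewrite ?(inE,notin_setE)/= in_itv/= andbT => sr.
  by rewrite mem_set ?mul1r.
by rewrite memNset ?mul0r.
Qed.

Lemma measurable_lmass : measurable_fun setT lmass.
Proof.
rewrite (_ : lmass = fubini_F mu (fun p : mplane R => (\1_ltrel (p.2, p.1) * rho p.2)%:E)); last first.
  by apply/funext => r; rewrite lmassE.
apply: measurable_fun_fubini_tonelli_F => [|p]; last first.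
  by rewrite lee_fin mulr_ge0.
apply/measurable_EFinP; apply: measurable_funM.
  apply: (measurableT_comp measurable_fun_lt12).
  by apply: measurable_fun_pair.
exact: measurableT_comp.
Qed.

Lemma measurable_rmass : measurable_fun setT rmass.
Proof.
rewrite (_ : rmass = fubini_F mu (fun p : mplane R => (\1_ltrel (p.1, p.2) * rho p.2)%:E)); last first.
  by apply/funext => r; rewrite rmassE.
apply: measurable_fun_fubini_tonelli_F => [|p]; last first.
  by rewrite lee_fin mulr_ge0.
apply/measurable_EFinP; apply: measurable_funM.
  apply: (measurableT_comp measurable_fun_lt12).
  by apply: measurable_fun_pair.
exact: measurableT_comp.
Qed.

(** A sum of two indicators rather than the indicator of a disjunction: each
    term is a product of a function of (s, r) and a function of (r, t), which
    lets the integrals over s and t separate in [crossing]. *)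
Definition btw (s t r : R) : R := \1_ltrel (s, r) * \1_ltrel (r, t) + \1_ltrel (t, r) * \1_ltrel (r, s).

Lemma lmass_ge0 r : (0 <= lmass r)%E.
Proof. by apply: integral_ge0 => s _; rewrite lee_fin. Qed.
Lemma rmass_ge0 r : (0 <= rmass r)%E.
Proof. by apply: integral_ge0 => s _; rewrite lee_fin. Qed.

Lemma measurable_indl (a : R) : measurable_fun setT (fun x : R => \1_ltrel (a, x) : R).
Proof. by apply: (measurableT_comp measurable_fun_lt12); exact: measurable_fun_pair. Qed.
Lemma measurable_indr (a : R) : measurable_fun setT (fun x : R => \1_ltrel (x, a) : R).
Proof. by apply: (measurableT_comp measurable_fun_lt12); exact: measurable_fun_pair. Qed.

Lemma crossing_inner s r :
  (\int[mu]_t (btw s t r * g r * rho t)%:E =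
   (g r)%:E * ((\1_ltrel (s, r))%:E * rmass r + (\1_ltrel (r, s))%:E * lmass r))%E.
Proof.
rewrite lmassE rmassE.
have mt : measurable_fun setT (fun t => (\1_ltrel (t, r) * rho t)%:E).
  by apply/measurable_EFinP; apply: measurable_funM => //; exact: measurable_indr.
have mt' : measurable_fun setT (fun t => (\1_ltrel (r, t) * rho t)%:E).
  by apply/measurable_EFinP; apply: measurable_funM => //; exact: measurable_indl.
rewrite -ge0_integralZl//; last by move=> t _; rewrite lee_fin mulr_ge0.
rewrite -ge0_integralZl//; last by move=> t _; rewrite lee_fin mulr_ge0.
rewrite -ge0_integralD//; first last.
- by apply: measurable_funeM.
- by move=> t _; rewrite -EFinM lee_fin !mulr_ge0.
- by apply: measurable_funeM.
- by move=> t _; rewrite -EFinM lee_fin !mulr_ge0.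
rewrite -ge0_integralZl//; first last.
- by rewrite lee_fin.
- by move=> t _; rewrite -!EFinM -EFinD lee_fin addr_ge0// !mulr_ge0.
- by apply: emeasurable_funD; apply: measurable_funeM.
apply: eq_integral => t _; rewrite /btw. rewrite -!EFinM; congr EFin; ring.
Qed.

(** Tonelli: for fixed r the pairs (s, t) separated by r have total weight
    2 * lmass r * rmass r. An average of |P s - P t| over pairs, bounded by the
    integral of |P'| between s and t, thus becomes a single weighted integral of
    |P'|. *)
Lemma crossing :
  (\int[mu]_s ((rho s)%:E * \int[mu]_t ((rho t)%:E * \int[mu]_r (btw s t r * g r)%:E)) =
   \int[mu]_r ((2 * g r)%:E * (lmass r * rmass r)))%E.
Proof.
have mb3 (T : measurableType _) (a b c : T -> R) : measurable_fun setT a ->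
    measurable_fun setT b -> measurable_fun setT c -> measurable_fun setT (fun x => btw (a x) (b x) (c x)).
  by move=> ma mb mc; apply: measurable_funD; apply: measurable_funM;
    apply: (measurableT_comp measurable_fun_lt12); exact: measurable_fun_pair.
have b0 s t r : 0 <= btw s t r by rewrite addr_ge0// mulr_ge0.
have k0 s r : (0 <= (\1_ltrel (s, r))%:E * rmass r + (\1_ltrel (r, s))%:E * lmass r)%E.
  have h1 (x : R * R) : (0 <= (\1_ltrel x : R)%:E)%E by rewrite lee_fin.
  exact: adde_ge0 (mule_ge0 (h1 _) (rmass_ge0 _)) (mule_ge0 (h1 _) (lmass_ge0 _)).
transitivity (\int[mu]_s \int[mu]_r ((rho s * g r)%:E * ((\1_ltrel (s, r))%:E * rmass r + (\1_ltrel (r, s))%:E * lmass r)))%E.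
  apply: eq_integral => s _.
  transitivity ((rho s)%:E * \int[mu]_r ((g r)%:E * ((\1_ltrel (s, r))%:E * rmass r + (\1_ltrel (r, s))%:E * lmass r)))%E; last first.
    rewrite -ge0_integralZl//; first last.
    - by rewrite lee_fin.
    - by move=> t _; apply: mule_ge0 => //; rewrite lee_fin.
    - apply: emeasurable_funM; first exact/measurable_EFinP.
      apply: emeasurable_funD; apply: emeasurable_funM; try exact: measurable_lmass; try exact: measurable_rmass;
        apply/measurable_EFinP; [exact: measurable_indl|exact: measurable_indr].
    - by apply: eq_integral => r _; rewrite muleA -EFinM.
  congr (_ * _)%E.
  under [RHS]eq_integral do rewrite -crossing_inner.
  rewrite -(fubini_tonelli (fun p : mplane R => (btw s p.1 p.2 * g p.2 * rho p.1)%:E))/=; first last.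
  - by move=> p; rewrite lee_fin !mulr_ge0.
  - apply/measurable_EFinP; apply: measurable_funM; last exact: measurableT_comp.
    by apply: measurable_funM; [exact: mb3|exact: measurableT_comp].
  apply: eq_integral => t _; rewrite -ge0_integralZl//; first last.
  - by rewrite lee_fin.
  - by move=> r _; rewrite lee_fin mulr_ge0.
  - by apply/measurable_EFinP/measurable_funM => //; exact: mb3.
  by apply: eq_integral => r _; rewrite -EFinM mulrC.
rewrite (fubini_tonelli (fun p : mplane R => ((rho p.1 * g p.2)%:E * ((\1_ltrel (p.1, p.2))%:E * rmass p.2 + (\1_ltrel (p.2, p.1))%:E * lmass p.2))%E))/=; first last.
- by move=> p; apply: mule_ge0 => //; rewrite lee_fin mulr_ge0.
- apply: emeasurable_funM.
    by apply/measurable_EFinP; apply: measurable_funM; exact: measurableT_comp.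
  apply: emeasurable_funD; apply: emeasurable_funM.
  + by apply/measurable_EFinP; apply: (measurableT_comp measurable_fun_lt12); exact: measurable_fun_pair.
  + by apply: (measurableT_comp measurable_rmass).
  + by apply/measurable_EFinP; apply: (measurableT_comp measurable_fun_lt12); exact: measurable_fun_pair.
  + by apply: (measurableT_comp measurable_lmass).
apply: eq_integral => r _.
have l0 := lmass_ge0 r; have r0 := rmass_ge0 r.
have m1 : measurable_fun setT (fun s => (\1_ltrel (s, r) * rho s)%:E).
  by apply/measurable_EFinP; apply: measurable_funM => //; exact: measurable_indr.
have m2 : measurable_fun setT (fun s => (\1_ltrel (r, s) * rho s)%:E).
  by apply/measurable_EFinP; apply: measurable_funM => //; exact: measurable_indl.
transitivity (\int[mu]_s ((g r)%:E * (rmass r * (\1_ltrel (s, r) * rho s)%:E + lmass r * (\1_ltrel (r, s) * rho s)%:E)))%E.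
  apply: eq_integral => s _; rewrite mulrC EFinM -muleA; congr (_ * _)%E.
  rewrite ge0_muleDr ?mule_ge0 ?lee_fin//; congr (_ + _)%E;
  by rewrite muleA -EFinM muleC [rho s * _]mulrC.
rewrite ge0_integralZl//; first last.
- by rewrite lee_fin.
- by move=> s _; rewrite adde_ge0// mule_ge0// lee_fin mulr_ge0.
- by apply: emeasurable_funD; apply: measurable_funeM.
rewrite ge0_integralD//; first last.
- exact: measurable_funeM.
- by move=> s _; rewrite mule_ge0// lee_fin mulr_ge0.
- exact: measurable_funeM.
- by move=> s _; rewrite mule_ge0// lee_fin mulr_ge0.
rewrite ge0_integralZl//; last by move=> s _; rewrite lee_fin mulr_ge0.
rewrite ge0_integralZl//; last by move=> s _; rewrite lee_fin mulr_ge0.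
rewrite -lmassE -rmassE [in X in (X + _)%E]muleC EFinM -muleA muleCA; congr (_ * _)%E.
by rewrite mule_natl mule2n.
Qed.
End crossing.

(** * Masses on both sides of a point, for a concave weight *)
Section concave_weight.
Context {R : realType}.
Local Notation mu := (@lebesgue_measure R).

Lemma integral_affine (a b c k r : R) : a < b ->
  (\int[mu]_(s in `[a, b]) (c + k * (s - r))%:E =
   (c * (b - a) + k / 2 * ((b - r) ^+ 2 - (a - r) ^+ 2))%:E)%E.
Proof.
move=> ab; pose F (s : R) : R := c * s + k / 2 * (s - r) ^+ 2.
have dF (s : R) : is_derive s 1 F (c + k * (s - r)).
  rewrite /F; apply: is_derive_eq; rewrite /GRing.scale/=.
  by rewrite !(mulr0, addr0, mulr1, add0r, subr0); field.
have cF : continuous F := derive_continuous dF.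
rewrite (@continuous_FTC2 _ _ F)//.
- by rewrite /F -EFinB; congr EFin; field.
- apply: continuous_subspaceT => s; apply: cvgD; first exact: cvg_cst.
  apply: cvgM; first exact: cvg_cst.
  by apply: cvgB; [exact: cvg_id|exact: cvg_cst].
- split; [by move=> s _; case: (dF s)| |].
  + exact/cvg_at_right_filter/cF.
  + exact/cvg_at_left_filter/cF.
- by move=> s _; rewrite derive1E; apply: derive_val.
Qed.

(** The two brackets are the masses of the affine function rho + k (s - r) over
    the lengths p to the left and q to the right of r. The last hypothesis says
    that this function is nonnegative at the midpoint; given that, the defect is
    a sum of two nonnegative terms. *)
Lemma split_ineq (p q rho k : R) : 0 < p -> 0 < q -> 0 <= rho ->
  0 <= rho + k * ((q - p) / 2) ->
  4 * (p * rho - k / 2 * p ^+ 2) * (q * rho + k / 2 * q ^+ 2) <=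
  (p + q) * rho * ((p * rho - k / 2 * p ^+ 2) + (q * rho + k / 2 * q ^+ 2)).
Proof.
move=> p0 q0 r0 h; rewrite -subr_ge0.
rewrite (_ : _ - _ = rho * (q - p) ^+ 2 * (rho + k * ((q - p) / 2)) + (k * p * q) ^+ 2); last by field.
by apply: addr_ge0; [do 2 (apply: mulr_ge0 => //); exact: sqr_ge0|exact: sqr_ge0].
Qed.

(** 4 A B <= S (A + B) bounds the harmonic mean of A and B by S / 2, and the
    harmonic mean is monotone. *)
Lemma harmonic_mono (A B A' B' S : R) : 0 <= A -> A <= A' -> 0 <= B -> B <= B' ->
  4 * A' * B' <= S * (A' + B') -> 4 * (A * B) <= S * (A + B).
Proof.
move=> A0 AA B0 BB h.
have [s0|s0] := ltP 0 (A' + B'); last first.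
  have A'0 : A' = 0 by lra.
  have B'0 : B' = 0 by lra.
  have -> : A = 0 by lra.
  have -> : B = 0 by lra.
  by rewrite mulr0 addr0 !mulr0.
rewrite -(ler_pM2r s0); apply: (@le_trans _ _ ((4 * A' * B') * (A + B))).
  have h1 : 0 <= A * (A' * (B' - B)) by rewrite !mulr_ge0// ?subr_ge0//; lra.
  have h2 : 0 <= B * (B' * (A' - A)) by rewrite !mulr_ge0// ?subr_ge0//; lra.
  lra.
by rewrite [leRHS]mulrAC ler_wpM2r// addr_ge0.
Qed.

Variables (rho : R -> R) (a b M : R).
Hypothesis mrho : measurable_fun setT rho.
Hypothesis rho0 : forall s, 0 <= rho s.
Hypothesis rho_out : forall s, s \notin `]a, b[ -> rho s = 0.
(* Concavity on the support, in the form of affine majorants touching the graph. *)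
Hypothesis rho_sup : forall r, r \in `]a, b[ ->
  exists k, forall t, t \in `]a, b[ -> rho t <= rho r + k * (t - r).
Hypothesis rho_mass : forall r, (lmass rho r + rmass rho r <= M%:E)%E.

(** This is where convexity of the domain gives the sharp constant: the weight
    of [crossing] at r is at most half of (b - a) times the total mass times
    rho r. Replacing rho by an affine majorant at r increases both masses, so
    [harmonic_mono] reduces the claim to [split_ineq]. *)
Lemma concave_weight_ineq r :
  (4%:E * (lmass rho r * rmass rho r) <= ((b - a) * M * rho r)%:E)%E.
Proof.
have M0 : 0 <= M.
  by rewrite -lee_fin; apply: le_trans (rho_mass 0); exact: adde_ge0 (lmass_ge0 rho0 _) (rmass_ge0 rho0 _).
have [rab|rab] := boolP (r \in `]a, b[); last first.
  have := rab; rewrite in_itv/= negb_and -!leNgt => /orP[ra|br].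
    rewrite (_ : lmass rho r = 0%E) ?mul0e ?mule0 ?rho_out ?mulr0//.
    apply: integral0_eq => s; rewrite /= in_itv/= => sr; rewrite rho_out//.
    by rewrite in_itv/= negb_and -!leNgt (le_trans (ltW sr) ra).
  rewrite (_ : rmass rho r = 0%E) ?mule0 ?rho_out ?mulr0//.
  apply: integral0_eq => s; rewrite /= in_itv/= andbT => sr; rewrite rho_out//.
  by rewrite in_itv/= negb_and -!leNgt (le_trans br (ltW sr)) orbT.
have := rab; rewrite in_itv/= => /andP[ar rb].
have [k hk] := rho_sup rab.
have maff (D : set R) : measurable_fun D (fun s => (rho r + k * (s - r))%:E).
  apply/measurable_EFinP; apply: measurable_funS (measurableT) (@subsetT _ _) _.
  apply: continuous_measurable_fun => s; apply: cvgD; first exact: cvg_cst.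
  by apply: cvgM; [exact: cvg_cst|apply: cvgB; [exact: cvg_id|exact: cvg_cst]].
have hl : (lmass rho r <= ((r - a) * rho r - k / 2 * (r - a) ^+ 2)%:E)%E.
  have -> : lmass rho r = (\int[mu]_(s in `]a, r[) (rho s)%:E)%E.
    rewrite /lmass [LHS]integral_mkcond [RHS]integral_mkcond.
    apply: eq_integral => s _; rewrite !patchE !mem_setE !in_itv/=.
    case: (ltP s r) => sr; last by rewrite andbF.
    case: (ltP a s) => //= sa; rewrite rho_out// in_itv/= negb_and -!leNgt sa//.
  apply: (@le_trans _ _ (\int[mu]_(s in `]a, r[) (rho r + k * (s - r))%:E)%E).
    have hle s : s \in `]a, r[ -> rho s <= rho r + k * (s - r).
      by rewrite in_itv/= => /andP[? sr]; apply: hk; rewrite in_itv/=; apply/andP; split => //; exact: lt_trans sr rb.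
    apply: ge0_le_integral => //.
    - by move=> s _; rewrite lee_fin.
    - by apply/measurable_EFinP; exact: measurable_funS mrho.
    - exact: maff.
  rewrite integral_itv_obnd_cbnd; last exact: maff.
  rewrite integral_itv_bndo_bndc; last exact: maff.
  by rewrite integral_affine// lee_fin subrr expr0n/= le_eqVlt; apply/orP; left; apply/eqP; field.
have hr : (rmass rho r <= ((b - r) * rho r + k / 2 * (b - r) ^+ 2)%:E)%E.
  have -> : rmass rho r = (\int[mu]_(s in `]r, b[) (rho s)%:E)%E.
    rewrite /rmass [LHS]integral_mkcond [RHS]integral_mkcond.
    apply: eq_integral => s _; rewrite !patchE !mem_setE !in_itv/= andbT.
    case: (ltP r s) => sr //=; case: (ltP s b) => //= sa.
    by rewrite rho_out// in_itv/= negb_and -!leNgt sa orbT.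
  apply: (@le_trans _ _ (\int[mu]_(s in `]r, b[) (rho r + k * (s - r))%:E)%E).
    have hle s : s \in `]r, b[ -> rho s <= rho r + k * (s - r).
      by rewrite in_itv/= => /andP[sr ?]; apply: hk; rewrite in_itv/=; apply/andP; split => //; exact: lt_trans ar sr.
    apply: ge0_le_integral => //.
    - by move=> s _; rewrite lee_fin.
    - by apply/measurable_EFinP; exact: measurable_funS mrho.
    - exact: maff.
  rewrite integral_itv_obnd_cbnd; last exact: maff.
  rewrite integral_itv_bndo_bndc; last exact: maff.
  by rewrite integral_affine// lee_fin subrr expr0n/= le_eqVlt; apply/orP; left; apply/eqP; field.
have := rho_mass r.
have := lmass_ge0 rho0 r; have := rmass_ge0 rho0 r.
case: (lmass rho r) (rmass rho r) hl hr => [A| |] [B| |] //.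
rewrite !lee_fin => AA BB B0 A0 ABM.
have hmid : 0 <= rho r + k * ((b - r - (r - a)) / 2).
  have := hk ((a + b) / 2); rewrite in_itv/=.
  rewrite (_ : (b - r - (r - a)) / 2 = (a + b) / 2 - r); last by field.
  by move=> h; apply: le_trans (rho0 _) (h _); apply/andP; split; lra.
have := split_ineq (p := r - a) (q := b - r) _ _ (rho0 r) hmid.
rewrite !subr_gt0 => /(_ ar rb) h.
have h4 := harmonic_mono A0 AA B0 BB h.
apply: (le_trans h4).
rewrite (_ : r - a + (b - r) = b - a); last by ring.
rewrite mulrAC ler_wpM2r// ler_wpM2l//; lra.
Qed.

End concave_weight.

(** * Vertical slices of a bounded convex open set *)
Section slices.
Context {R : realType}.
Local Notation mu := (@lebesgue_measure R).
Local Notation leb2 := (@lebesgue2 R).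

(** Convexity with an explicit real parameter, which arithmetic tactics can
    handle; [convex_set_cvx] relates it to [convex_set]. *)
Definition cvx (K : set (R * R)) := forall x y t, K x -> K y -> 0 <= t <= 1 ->
  K (x.1 + t * (y.1 - x.1), x.2 + t * (y.2 - x.2)).

Definition bnd (K : set (R * R)) (B : R) := forall x, K x -> `|x.1| <= B /\ `|x.2| <= B.

Lemma lebesgue_interval (S : set R) (B : R) : is_interval S -> S !=set0 ->
  (forall x, S x -> `|x| <= B) -> mu S = (sup S - inf S)%:E.
Proof.
move=> iS [x0 Sx0] SB.
have us : has_ubound S by exists B => x /SB; rewrite ler_norml => /andP[].
have li : has_lbound S by exists (- B) => x /SB; rewrite ler_norml => /andP[].
rewrite {1}(is_intervalP S).1// lebesgue_measure_itv /Rhull/= (asboolT us) (asboolT li)/=.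
rewrite lte_fin; case: ltP => [//|h].
have h1 : inf S <= sup S by apply: le_trans (ub_le_sup us Sx0); exact: ge_inf.
by congr EFin; apply/eqP; rewrite eq_sym subr_eq0 eq_le h1 h.
Qed.

Variables (K : set (R * R)) (B : R).
Hypotheses (oK : opn K) (cK : cvx K) (bK : bnd K B).

Let mK : measurable (K : set (mplane R)). Proof. exact: opn_measurable. Qed.

Definition slen (s : R) : R := fine (mu (xsection K s)).
Definition shadow : set R := [set s | exists y, K (s, y)].

Lemma xsectionE s : xsection K s = [set y | K (s, y)].
Proof. by apply/seteqP; split => y; rewrite /xsection/= inE. Qed.

Lemma xsection_itv s : is_interval (xsection K s).
Proof.
rewrite xsectionE => x y/= Kx Ky z /andP[xz zy].
have [xy|] := ltP x y; last first.
  by move=> yx; have -> : z = x by lra.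
have := cK Kx Ky (t := (z - x) / (y - x)); rewrite /= subrr mulr0 addr0 divfK ?subr_eq0 ?gt_eqF//.
rewrite (_ : x + (z - x) = z); last by ring.
apply; rewrite divr_ge0 ?subr_ge0 ?ler_pdivrMr ?subr_gt0 ?mul1r ?lerB// ltW//.
Qed.

Lemma xsection_bound s y : xsection K s y -> `|y| <= B.
Proof. by rewrite xsectionE => /bK[]. Qed.

Lemma mu_xsection s : mu (xsection K s) = (slen s)%:E.
Proof.
rewrite /slen; have [/eqP ->|/set0P h] := boolP (xsection K s == set0).
  by rewrite measure0.
by rewrite (lebesgue_interval (@xsection_itv s) h (@xsection_bound s)).
Qed.

Lemma slenE s : shadow s -> slen s = sup (xsection K s) - inf (xsection K s).
Proof.
move=> [y Ky]; rewrite /slen (lebesgue_interval (@xsection_itv s) _ (@xsection_bound s))//.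
by exists y; rewrite xsectionE.
Qed.

Lemma slen_ge0 s : 0 <= slen s.
Proof. by rewrite -lee_fin -mu_xsection measure_ge0. Qed.

Lemma slen_out s : ~ shadow s -> slen s = 0.
Proof.
move=> h; rewrite /slen (_ : xsection K s = set0) ?measure0//.
by apply/seteqP; split => // y; rewrite xsectionE => Ky; apply: h; exists y.
Qed.

Lemma measurable_slen : measurable_fun setT slen.
Proof.
apply: (measurableT_comp (fine_measurable measurableT)).
exact: measurable_fun_xsection.
Qed.

(** Integrals of functions of the abscissa reduce to dimension one, with the
    slice length as weight. *)
Lemma integral_slices (u : R -> R) : measurable_fun setT u -> (forall s, 0 <= u s) ->
  (\int[leb2]_(x in K) (u x.1)%:E = \int[mu]_s (u s * slen s)%:E)%E.
Proof.
move=> mf u0; rewrite integral_mkcond /leb2.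
apply: etrans (fubini_tonelli1 (m1 := mu) (m2 := mu) ((fun x : mplane R => (u x.1)%:E) \_ K) _ _) _; first last.
2: by apply: erestrict_ge0 => x _; rewrite lee_fin.
2: apply/(measurable_restrictT _ mK)/measurable_EFinP;
  by apply: measurable_funS (measurableT) (@subsetT _ _) _; exact: measurableT_comp.
apply: eq_integral => s _; rewrite /fubini_F/= EFinM -mu_xsection.
rewrite -[X in (_ * mu X)%E]setIT -integral_indic//; last exact: measurable_xsection.
rewrite -ge0_integralZl//.
- apply: eq_integral => y _; rewrite patchE -mem_xsection indicE.
  by case: ifPn; rewrite ?mule1 ?mule0.
- by apply/measurable_EFinP; apply: measurable_indic; exact: measurable_xsection.
- by rewrite lee_fin.
Qed.

Lemma mass_slices : (leb2 K = \int[mu]_s (slen s)%:E)%E.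
Proof.
transitivity (\int[leb2]_(x in K) 1)%E; first by rewrite integral_cst// mul1e.
apply: etrans (integral_slices (u := cst 1) _ _) _ => //.
by apply: eq_integral => s _; rewrite /= mul1r.
Qed.

Lemma mass_lr r : (lmass slen r + rmass slen r <= leb2 K)%E.
Proof.
rewrite mass_slices /lmass /rmass.
have ms : measurable_fun setT (EFin \o slen) by apply/measurable_EFinP; exact: measurable_slen.
rewrite -ge0_integral_setU//.
- apply: ge0_subset_integral => //; first exact: measurableU.
  by move=> s _; rewrite lee_fin slen_ge0.
- exact: measurable_funS ms.
- by move=> s _; rewrite lee_fin slen_ge0.
- apply/disj_setPS => s [/=]; rewrite !in_itv/= andbT => h1 h2.
  by have := lt_trans h1 h2; rewrite ltxx.
Qed.

(** The projection of a convex open set is an open interval, hence is given by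
    its endpoints. *)
Lemma shadowE : shadow !=set0 -> forall s, shadow s <-> s \in `]inf shadow, sup shadow[.
Proof.
move=> s0 s.
have us : has_ubound shadow by exists B => x [y /bK[]]; rewrite ler_norml => /andP[].
have li : has_lbound shadow by exists (- B) => x [y /bK[]]; rewrite ler_norml => /andP[].
split; last first.
  rewrite in_itv/= => /andP[h1 h2].
  have [p [yp Kp] ps] := inf_lt s0 h1.
  have [q [yq Kq] sq] := sup_gt s0 h2.
  have pq := lt_trans ps sq.
  have := cK Kp Kq (t := (s - p) / (q - p)); rewrite /= divfK ?subr_eq0 ?gt_eqF//.
  rewrite (_ : p + (s - p) = s); last by ring.
  move=> h; eexists; apply: h.
  rewrite divr_ge0 ?subr_ge0 ?ler_pdivrMr ?subr_gt0 ?mul1r ?lerB// ltW//.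
move=> [y Ky]; have [e e0 eK] := oK Ky.
have h (t : R) : `|t| < e -> shadow (s + t).
  by move=> te; exists y; apply: eK; split => //=; rewrite ?subrr ?normr0// addrC addKr.
rewrite in_itv/=; apply/andP; split.
  apply: (@le_lt_trans _ _ (s - e / 2)); last by rewrite ltrBlDr ltrDl divr_gt0.
  by apply: ge_inf => //; apply: h; rewrite normrN ger0_norm; lra.
apply: (@lt_le_trans _ _ (s + e / 2)); first by rewrite ltrDl divr_gt0.
by apply: ub_le_sup => //; apply: h; rewrite ger0_norm; lra.
Qed.

(** The upper ends of the slices are a concave function of the abscissa and the
    lower ends a convex one, because segments between slices stay in K. *)
Lemma slen_concave s t l : shadow s -> shadow t -> 0 <= l <= 1 ->
  shadow (s + l * (t - s)) /\
  slen s + l * (slen t - slen s) <= slen (s + l * (t - s)).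
Proof.
move=> hs ht hl.
have hm : shadow (s + l * (t - s)).
  by case: hs ht => [y Ky] [z Kz]; eexists; exact: (cK Ky Kz hl).
split => //; rewrite !slenE//.
have has r : shadow r -> has_sup (xsection K r) /\ has_inf (xsection K r).
  move=> [y Ky]; split; split; try by exists y; rewrite xsectionE.
    by exists B => z /xsection_bound; rewrite ler_norml => /andP[].
  by exists (- B) => z /xsection_bound; rewrite ler_norml => /andP[].
have [[s1 s2] [s3 s4]] := has _ hs; have [[t1 t2] [t3 t4]] := has _ ht.
have [[m1 m2] [m3 m4]] := has _ hm.
have hup y z : xsection K s y -> xsection K t z -> y + l * (z - y) <= sup (xsection K (s + l * (t - s))).
  rewrite !xsectionE => Ky Kz; apply: ub_le_sup; first by rewrite -xsectionE.
  exact: (cK Ky Kz hl).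
have hlo y z : xsection K s y -> xsection K t z -> inf (xsection K (s + l * (t - s))) <= y + l * (z - y).
  rewrite !xsectionE => Ky Kz; apply: ge_inf; first by rewrite -xsectionE.
  exact: (cK Ky Kz hl).
move: hl => /andP[l0 l1].
set S := sup (xsection K s); set T := sup (xsection K t).
set S' := inf (xsection K s); set T' := inf (xsection K t).
suff : S + l * (T - S) <= sup (xsection K (s + l * (t - s))) /\
  inf (xsection K (s + l * (t - s))) <= S' + l * (T' - S') by move=> [h1 h2]; lra.
split.
  apply/ler_addgt0Pr => e e0.
  have [y Ky yS] := sup_adherent e0 (conj s1 s2).
  have [z Kz zT] := sup_adherent e0 (conj t1 t2).
  have := hup _ _ Ky Kz; rewrite -/S -/T in yS zT *; nra.
apply/ler_addgt0Pr => e e0.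
have [y Ky yS] := inf_adherent e0 (conj s3 s4).
have [z Kz zT] := inf_adherent e0 (conj t3 t4).
have := hlo _ _ Ky Kz; rewrite -/S' -/T' in yS zT *; nra.
Qed.

(** An affine majorant at r: its slope is the supremum of the difference
    quotients on the right of r, which the quotients on the left dominate by
    concavity. Openness of the shadow provides points on both sides. *)
Lemma slen_support r : shadow r -> exists k, forall t, shadow t ->
  slen t <= slen r + k * (t - r).
Proof.
move=> hr.
pose Q := [set q | exists t, [/\ shadow t, r < t & q = (slen t - slen r) / (t - r)]].
have key s t : shadow s -> shadow t -> s < r -> r < t ->
    (slen t - slen r) / (t - r) <= (slen r - slen s) / (r - s).
  move=> hs ht sr rt; rewrite ler_pdivrMr ?subr_gt0// mulrAC ler_pdivlMr ?subr_gt0//.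
  have l01 : 0 <= (r - s) / (t - s) <= 1.
    rewrite divr_ge0 ?subr_ge0 ?ler_pdivrMr ?subr_gt0 ?mul1r ?lerB ?(ltW (lt_trans sr rt)) ?(lt_trans sr rt)//; exact: ltW.
  have [_] := slen_concave hs ht l01.
  rewrite divfK ?subr_eq0 ?gt_eqF ?(lt_trans sr rt)// addrC [s + _]addrC subrK.
  rewrite -lerBrDr mulrAC ler_pdivrMr ?subr_gt0 ?(lt_trans sr rt)//.
  nra.
have [Q0|Q0] := pselect (Q !=set0); last first.
  have nt t : shadow t -> t <= r.
    by move=> ht; rewrite leNgt; apply/negP => rt; apply: Q0; eexists; exists t; split.
  have [e e0 eK] : exists2 e, 0 < e & shadow (r + e).
    case: hr => y /oK[e e0 eK]; exists (e / 2); first by rewrite divr_gt0.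
    exists y; apply: eK; split; rewrite /= ?subrr ?normr0// addrC addKr ger0_norm; lra.
  by have := nt _ eK; rewrite gerDl leNgt e0.
exists (sup Q) => t ht.
have [tr|rt|->] := ltgtP t r; last by rewrite subrr mulr0 addr0.
- have : sup Q <= (slen r - slen t) / (r - t).
    by apply: ge_sup => // q [u [hu ru ->]]; exact: key.
  by rewrite ler_pdivlMr ?subr_gt0//; lra.
- have : (slen t - slen r) / (t - r) <= sup Q.
    apply: ub_le_sup; last by exists t.
    have [e e0 eK] : exists2 e, 0 < e & shadow (r - e).
      case: hr => y /oK[e e0 eK]; exists (e / 2); first by rewrite divr_gt0.
      exists y; apply: eK; split; rewrite /= ?subrr ?normr0// addrC addKr normrN ger0_norm; lra.
    exists ((slen r - slen (r - e)) / (r - (r - e))) => q [u [hu ru ->]].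
    by apply: key => //; rewrite ltrBlDr ltrDl.
  by rewrite ler_pdivrMr ?subr_gt0//; lra.
Qed.

End slices.

(** * Integrability on bounded sets *)
Section bounded_integrable.
Context {R : realType}.
Local Notation leb2 := (@lebesgue2 R).

Lemma bnd_fin (K : set (R * R)) B : measurable (K : set (mplane R)) -> bnd K B ->
  (leb2 K < +oo)%E.
Proof.
move=> mK bK.
pose I : set (measurableTypeR R) := `[- B, B]%classic.
have mI : measurable I by exact: measurable_itv.
pose Q : set (mplane R) := I `*` I.
have mQ : measurable Q by exact: measurableX.
apply: (@le_lt_trans _ _ (leb2 Q)).
  apply: le_measure; rewrite ?inE// => x /bK[h1 h2]; by split; rewrite /I/= in_itv/= -ler_norml.
have -> : leb2 Q = (@lebesgue_measure R I * @lebesgue_measure R I)%E.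
  by apply: (product_measure1E (@lebesgue_measure R) (@lebesgue_measure R)).
by rewrite /I /= lebesgue_measure_itv/=; case: ifP => _; rewrite -?EFinB -?EFinM ?mule0 ?ltry.
Qed.

Lemma continuous_bnd (f : R * R -> R) (B : R) : continuous f ->
  exists C, forall x, `|x.1| <= B -> `|x.2| <= B -> `|f x| <= C.
Proof.
move=> cf.
have cB : compact (`[- B, B]%classic `*` `[- B, B]%classic : set (R * R)).
  by apply: compact_setX; exact: segment_compact.
have : compact (f @` (`[- B, B]%classic `*` `[- B, B]%classic)).
  by apply: continuous_compact => //; exact: continuous_subspaceT.
move=> /compact_bounded[C [_ /(_ (C + 1))]]; rewrite ltrDl ltr01 => /(_ isT) h.
exists (C + 1) => x x1 x2; apply: h; exists x => //.
by split => /=; rewrite in_itv/= -ler_norml.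
Qed.

Lemma bnd_integrable (K : set (R * R)) B (f : R * R -> R) (C : R) :
  measurable (K : set (mplane R)) -> bnd K B ->
  measurable_fun setT (f : mplane R -> R) -> (forall x, K x -> `|f x| <= C) ->
  leb2.-integrable K (EFin \o f).
Proof.
move=> mK bK mf fC; apply: measurable_bounded_integrable => //.
- exact: bnd_fin bK.
- exact: measurable_funS mf.
- exists C; split => [|y Cy]; first exact: num_real.
  by move=> x /fC h; apply: le_trans h (ltW Cy).
Qed.

Lemma continuous_integrable (K : set (R * R)) B (f : R * R -> R) :
  measurable (K : set (mplane R)) -> bnd K B -> continuous f ->
  leb2.-integrable K (EFin \o f).
Proof.
move=> mK bK cf; have [C hC] := continuous_bnd B cf.
apply: (bnd_integrable mK bK (continuous_measurable2 cf) (C := C)).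
by move=> x /bK[h1 h2]; exact: hC.
Qed.

(** Over a set of measure 0 the quotient is 0 by convention, and so is the integral. *)
Lemma mean_mul (K : set (R * R)) B (f : R * R -> R) : measurable (K : set (mplane R)) -> bnd K B ->
  leb2.-integrable K (EFin \o f) ->
  (\int[leb2]_(x in K) f x) / fine (leb2 K) * fine (leb2 K) = \int[leb2]_(x in K) f x.
Proof.
move=> mK bK iu; have [m0|m0] := eqVneq (fine (leb2 K)) 0; last by rewrite divfK.
rewrite m0 mulr0 /Rintegral null_set_integral//; first exact: measurable_int iu.
have h : leb2 K \is a fin_num by rewrite ge0_fin_numE//; exact: bnd_fin bK.
by rewrite -(fineK h) m0.
Qed.

Definition lip (f : R * R -> R) (L : R) :=
  forall x y, `|f x - f y| <= L * (`|x.1 - y.1| + `|x.2 - y.2|).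

Lemma lip_continuous (f : R * R -> R) (L : R) : lip f L -> continuous f.
Proof.
move=> fL x; apply/cvgrPdist_le => /= e e0.
pose d := e / (2 * (`|L| + 1)).
have L0 : 0 < 2 * (`|L| + 1) by rewrite mulr_gt0// ltr_wpDl.
have d0 : 0 < d by rewrite divr_gt0.
suff : nbhs (x : R * R) [set y | `|f x - f y| <= e] by [].
apply/nbhs_ballP; exists d => //= y [y1 y2]; rewrite /ball/= in y1 y2.
apply: (le_trans (fL x y)).
apply: (@le_trans _ _ ((`|L| + 1) * (d + d))).
  apply: (@le_trans _ _ ((`|L| + 1) * (`|x.1 - y.1| + `|x.2 - y.2|))).
    by rewrite ler_wpM2r ?addr_ge0// (le_trans (ler_norm _))// lerDl.
  by rewrite ler_wpM2l ?addr_ge0// lerD// ltW.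
rewrite /d le_eqVlt; apply/orP; left; apply/eqP; field.
by rewrite gt_eqF// ltr_wpDl.
Qed.

Lemma measurable_lip (f : R * R -> R) (L : R) : lip f L ->
  measurable_fun setT (f : mplane R -> R).
Proof. by move=> lf; apply: continuous_measurable2; exact: lip_continuous lf. Qed.

End bounded_integrable.

(** * The inequality for functions of the abscissa *)
Section slice_poincare.
Context {R : realType}.
Local Notation mu := (@lebesgue_measure R).
Local Notation leb2 := (@lebesgue2 R).

Lemma indltE (a b : R) : \1_ltrel (a, b) = (a < b)%R%:R :> R.
Proof. by rewrite indicE; have -> : ((a, b) \in ltrel) = (a < b)%R by apply/idP/idP; rewrite inE. Qed.

Lemma ftc_btw (P p : R -> R) : (forall s : R, is_derive s 1 P (p s)) -> continuous p ->
  forall s t, (`|P s - P t|%:E <= \int[mu]_r (btw s t r * `|p r|)%:E)%E.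
Proof.
move=> dP cp.
have cP : continuous P := derive_continuous dP.
have cnp : continuous (fun r => `|p r|).
  by move=> r; apply: cvg_norm; exact: cp.
have main s t : s < t -> (`|P t - P s|%:E <= \int[mu]_r (\1_ltrel (s, r) * \1_ltrel (r, t) * `|p r|)%:E)%E.
  move=> st.
  have ftc : (\int[mu]_(x in `[s, t]) (p x)%:E = (P t)%:E - (P s)%:E)%E.
    apply: continuous_FTC2 => //.
    - exact: continuous_subspaceT.
    - split; [by move=> r _; case: (dP r)| |].
      + exact/cvg_at_right_filter/cP.
      + exact/cvg_at_left_filter/cP.
    - by move=> r _; rewrite derive1E; apply: derive_val.
  have mp D : measurable_fun D (EFin \o p).
    by apply/measurable_EFinP; apply: measurable_funS (measurableT) (@subsetT _ _) (continuous_measurable_fun cp).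
  have mnp D : measurable_fun D (fun x => (`|p x|)%:E).
    by apply/measurable_EFinP; apply: measurable_funS (measurableT) (@subsetT _ _) (continuous_measurable_fun cnp).
  rewrite -abse_EFin EFinB -ftc.
  apply: (le_trans (le_abse_integral _ _ _)) => //; first exact: mp.
  rewrite -[leLHS]/(\int[mu]_(x in `[s, t]) (`|p x|)%:E)%E.
  rewrite -integral_itv_bndo_bndc; last exact: mnp.
  rewrite -integral_itv_obnd_cbnd; last exact: mnp.
  rewrite integral_mkcond le_eqVlt; apply/orP; left; apply/eqP.
  apply: eq_integral => r _; rewrite patchE mem_setE in_itv/= !indltE.
  by case: (s < r); case: (r < t); rewrite /= ?mulr1 ?mul1r ?mul0r ?mulr0.
move=> s t.
have ind0 (a c : R) : a <= c -> \1_ltrel (c, a) = 0 :> R.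
  by rewrite indltE leNgt => /negbTE ->.
have indm (a c e : R) : e <= a -> forall r, \1_ltrel (a, r) * \1_ltrel (r, e) = 0 :> R.
  move=> ea r; case: (leP r a) => ra; first by rewrite ind0 ?mul0r.
  by rewrite (@ind0 e r) ?mulr0// (le_trans ea)// ltW.
have [st|ts|->] := ltgtP s t.
- rewrite distrC; apply: (le_trans (main _ _ st)).
  rewrite le_eqVlt; apply/orP; left; apply/eqP; apply: eq_integral => r _.
  by rewrite /btw (indm t 0 s (ltW st)) addr0.
- apply: (le_trans (main _ _ ts)).
  rewrite le_eqVlt; apply/orP; left; apply/eqP; apply: eq_integral => r _.
  by rewrite /btw (indm s 0 t (ltW ts)) add0r.
- by rewrite subrr normr0; apply: integral_ge0 => r _; rewrite lee_fin !mulr_ge0// addr_ge0// mulr_ge0.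
Qed.

Variables (K : set (R * R)) (B : R).
Hypotheses (oK : opn K) (cK : cvx K) (bK : bnd K B).

(** Bound |P s - P t| by the integral of |p| between s and t, exchange the order
    of integration with [crossing], and estimate the resulting weight by
    [concave_weight_ineq]. The factor (sup - inf) / 2 becomes diam / 2. *)
Lemma slice_poincare (P p : R -> R) : (forall s : R, is_derive s 1 P (p s)) -> continuous p ->
  (\int[mu]_s ((slen K s)%:E * \int[mu]_t ((slen K t)%:E * `|P s - P t|%:E)) <=
   ((sup (shadow K) - inf (shadow K)) * fine (leb2 K) / 2)%:E *
     \int[mu]_s (`|p s| * slen K s)%:E)%E.
Proof.
move=> dP cp.
have mK : measurable (K : set (mplane R)) by exact: opn_measurable.
have Kfin : (leb2 K \is a fin_num) by rewrite ge0_fin_numE//; exact: bnd_fin bK.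
have cP : continuous P := derive_continuous dP.
have mP := continuous_measurable_fun cP.
have cnp : continuous (fun r => `|p r|).
  by move=> r; apply: cvg_norm; exact: cp.
have mp := continuous_measurable_fun cnp.
have ms := measurable_slen oK.
have s0 := slen_ge0 cK bK.
have [sh0|sh0] := pselect (shadow K !=set0); last first.
  have z s : slen K s = 0 by apply: slen_out => hs; apply: sh0; exists s.
  rewrite integral0_eq; last by move=> s _; rewrite z mul0e.
  rewrite [X in (_ * X)%E]integral0_eq ?mule0//; last by move=> s _; rewrite z mulr0.
apply: (@le_trans _ _ (\int[mu]_s ((slen K s)%:E * \int[mu]_t ((slen K t)%:E * \int[mu]_r (btw s t r * `|p r|)%:E))))%E.
  have mb3 d (T : measurableType d) (a b c : T -> R) : measurable_fun setT a ->
    measurable_fun setT b -> measurable_fun setT c -> measurable_fun setT (fun x => btw (a x) (b x) (c x)).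
    by move=> ma mb mc; apply: measurable_funD; apply: measurable_funM;
    apply: (measurableT_comp measurable_fun_lt12); exact: measurable_fun_pair.
  have b0 s t r : 0 <= btw s t r * `|p r| by rewrite !mulr_ge0// addr_ge0// mulr_ge0.
  have i0 s t : (0 <= \int[mu]_r (btw s t r * `|p r|)%:E)%E by apply: integral_ge0 => r _; rewrite lee_fin b0.
  have mI2 : measurable_fun setT (fun z : mplane R => \int[mu]_r (btw z.1 z.2 r * `|p r|)%:E)%E.
    have := @measurable_fun_fubini_tonelli_F _ _ (mplane R) (measurableTypeR R) R mu (fun z => (btw z.1.1 z.1.2 z.2 * `|p z.2|)%:E).
    apply; last by move=> z; rewrite lee_fin.
    apply/measurable_EFinP; apply: measurable_funM; last exact: (measurableT_comp mp).
    by apply: mb3; [exact: measurableT_comp|exact: measurableT_comp|].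
  have mI1 s : measurable_fun setT (fun t => \int[mu]_r (btw s t r * `|p r|)%:E)%E.
    by apply: (measurableT_comp mI2 (g := fun t => (s, t))); exact: measurable_fun_pair.
  apply: ge0_le_integral => //.
  - move=> s _; apply: mule_ge0; first by rewrite lee_fin.
    by apply: integral_ge0 => t _; apply: mule_ge0; rewrite lee_fin.
  - apply: emeasurable_funM; first exact/measurable_EFinP.
    apply: (@measurable_fun_fubini_tonelli_F _ _ (measurableTypeR R) (measurableTypeR R) R mu (fun z => ((slen K z.2)%:E * `|P z.1 - P z.2|%:E)%E)).
      apply: emeasurable_funM; apply/measurable_EFinP; first exact: (measurableT_comp ms).
      apply: (measurableT_comp (@normr_measurable _ _)).
      by apply: measurable_funB; exact: (measurableT_comp mP).
    by move=> z; apply: mule_ge0; rewrite lee_fin.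
  - apply: emeasurable_funM; first exact/measurable_EFinP.
    apply: (@measurable_fun_fubini_tonelli_F _ _ (measurableTypeR R) (measurableTypeR R) R mu (fun z => ((slen K z.2)%:E * \int[mu]_r (btw z.1 z.2 r * `|p r|)%:E)%E)).
      by apply: emeasurable_funM => //; apply/measurable_EFinP; exact: (measurableT_comp ms).
    by move=> z; apply: mule_ge0 => //; rewrite lee_fin.
  - move=> s _; apply: lee_pmul => //; rewrite ?lee_fin//.
      by apply: integral_ge0 => t _; apply: mule_ge0; rewrite lee_fin.
    apply: ge0_le_integral => //.
    + by move=> t _; apply: mule_ge0; rewrite lee_fin.
    + apply: emeasurable_funM; apply/measurable_EFinP => //.
      apply: (measurableT_comp (@normr_measurable _ _)).
      by apply: measurable_funB.
    + by apply: emeasurable_funM; [exact/measurable_EFinP|exact: mI1].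
    + by move=> t _; apply: lee_pmul => //; rewrite ?lee_fin//; exact: ftc_btw.
rewrite (crossing ms mp s0) //.
set a := inf (shadow K); set b := sup (shadow K); set M := fine (leb2 K).
have hw := @concave_weight_ineq R (slen K) a b M ms s0.
have {}hw r : (4%:E * (lmass (slen K) r * rmass (slen K) r) <= ((b - a) * M * slen K r)%:E)%E.
  apply: hw.
  - move=> s sab; apply: slen_out => /(shadowE oK cK bK sh0).
    by rewrite -/a -/b (negbTE sab).
  - move=> s /(shadowE oK cK bK sh0) hs.
    have [k hk] := slen_support oK cK bK hs.
    by exists k => t /(shadowE oK cK bK sh0) ht; exact: hk.
  - by move=> s; rewrite /M fineK//; exact: (mass_lr oK cK bK).
have l0 r := lmass_ge0 s0 r; have r0 r := rmass_ge0 s0 r.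
have ba0 : 0 <= b - a.
  have [s hs] := sh0; have := (shadowE oK cK bK sh0 s).1 hs.
  by rewrite -/a -/b in_itv/= => /andP[? ?]; lra.
have M0 : 0 <= M by rewrite fine_ge0.
rewrite -ge0_integralZl//; first last.
- by rewrite lee_fin divr_ge0// mulr_ge0.
- by move=> s _; rewrite lee_fin mulr_ge0.
- by apply/measurable_EFinP/measurable_funM.
apply: ge0_le_integral => //.
- by move=> s _; apply: mule_ge0; [rewrite lee_fin mulr_ge0|exact: mule_ge0].
- apply: emeasurable_funM; first by apply/measurable_EFinP/measurable_funM.
  by apply: emeasurable_funM; [exact: measurable_lmass|exact: measurable_rmass].
- by apply: measurable_funeM; apply/measurable_EFinP/measurable_funM.
move=> r _; rewrite (_ : 2 * `|p r| = `|p r| / 2 * 4); last by field.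
rewrite EFinM -muleA -EFinM [leRHS](_ : _ = (`|p r| / 2)%:E * ((b - a) * M * slen K r)%:E)%E; last first.
  by rewrite -EFinM; congr EFin; field.
by apply: lee_wpmul2l => //; rewrite lee_fin divr_ge0.
Qed.

End slice_poincare.

(** * The inequality on thin convex sets *)
Section thin.
Context {R : realType}.
Local Notation mu := (@lebesgue_measure R).
Local Notation leb2 := (@lebesgue2 R).

Lemma enorm_continuous (h1 h2 : R * R -> R) (L : R) : lip h1 L -> lip h2 L ->
  continuous (fun x => enorm (h1 x, h2 x)).
Proof.
move=> l1 l2; apply: (@lip_continuous _ _ (L + L)) => x y.
by apply: (le_trans (enorm_dist _ _)) => /=; rewrite mulrDl lerD.
Qed.

(** Along a strip of slope m the horizontal extent is shorter than the length by
    the factor sqrt (1 + m^2). In [thin_poincare] it cancels the factor by which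
    the derivative along the line may exceed the gradient, so that only the
    diameter remains. *)
Lemma slope_width (K : set (R * R)) B (m b W d : R) : opn K -> cvx K -> bnd K B -> shadow K !=set0 ->
  (forall x, K x -> `|x.2 - (m * x.1 + b)| <= W) ->
  (forall x y, K x -> K y -> enorm (x - y) <= d) ->
  (sup (shadow K) - inf (shadow K)) * Num.sqrt (1 + m ^+ 2) <= d + 2 * W.
Proof.
move=> oK cK bK s0 hW hd.
have us : has_ubound (shadow K) by exists B => x [y /bK[]]; rewrite ler_norml => /andP[].
have li : has_lbound (shadow K) by exists (- B) => x [y /bK[]]; rewrite ler_norml => /andP[].
set q := Num.sqrt _.
have q0 : 0 < q by rewrite sqrtr_gt0 ltr_pwDl// sqr_ge0.
have main s t : shadow K s -> shadow K t -> (t - s) * q <= d + 2 * W.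
  move=> [y Ky] [z Kz]; have [ts|st] := leP t s.
    have /hd : K (s, y) by []. move=> /(_ _ Ky); rewrite subrr enorm0 => d0.
    have := hW _ Ky => /(le_trans (normr_ge0 _)) W0.
    by apply: (@le_trans _ _ 0); [rewrite mulr_le0_ge0 ?subr_le0// ltW|lra].
  have -> : (t - s) * q = enorm ((t - s) * 1, (t - s) * m).
    by rewrite (enormZ (t - s) (1, m)) gtr0_norm ?subr_gt0// /enorm/= expr1n.
  have -> : ((t - s) * 1, (t - s) * m) = ((t, z) - (s, y)) + (0, (m * t + b - z) + (y - (m * s + b))).
    by congr (_, _) => /=; ring.
  apply: (le_trans (enormD _ _)); apply: lerD; first exact: hd.
  apply: (le_trans (enorm_le _)); rewrite /= normr0 add0r.
  apply: (le_trans (ler_normD _ _)); rewrite mulr2n mulrDl !mul1r; apply: lerD; last exact: hW Ky.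
  by rewrite distrC; exact: hW Kz.
rewrite -ler_pdivlMr// lerBlDr; apply/ler_addgt0Pr => e e0.
have e2 : 0 < e / 2 by rewrite divr_gt0.
have [t ht tS] := sup_adherent e2 (conj s0 us).
have [s hs sS] := inf_adherent e2 (conj s0 li).
have := main _ _ hs ht; rewrite -ler_pdivlMr//; lra.
Qed.

(** On a thin strip F and its gradient differ from their values on the axis of
    the strip, at the same abscissa, by a multiple of W. Hence the inequality for
    functions of the abscissa transfers with an error of order W times the area,
    which is all that localization can afford. *)
Lemma thin_poincare (K : set (R * R)) B (F h1 h2 : R * R -> R) (L H d m b W : R) :
  opn K -> cvx K -> bnd K B ->
  (forall x, K x -> `|x.2 - (m * x.1 + b)| <= W) -> 0 <= W <= 1 ->
  lip F L -> lip h1 L -> lip h2 L -> 0 <= H -> 0 <= d -> 0 <= L ->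
  (forall x, K x -> `|h1 x| <= H /\ `|h2 x| <= H) ->
  (forall s : R, is_derive s 1 (fun s => F (s, m * s + b)) (h1 (s, m * s + b) + m * h2 (s, m * s + b))) ->
  \int[leb2]_(x in K) F x = 0 ->
  (forall x y, K x -> K y -> enorm (x - y) <= d) ->
  \int[leb2]_(x in K) `|F x| <= d / 2 * \int[leb2]_(x in K) enorm (h1 x, h2 x)
    + (2 * L + 2 * H + (d + 2) * L) * W * fine (leb2 K).
Proof.
move=> oK cK bK hW /andP[W0 W1] lF l1 l2 H0 d0 L0 hH dF F0 hd.
have mK : measurable (K : set (mplane R)) by exact: opn_measurable.
have Kfin : (leb2 K \is a fin_num) by rewrite ge0_fin_numE//; exact: bnd_fin bK.
set M := fine (leb2 K).
have M0 : 0 <= M by rewrite fine_ge0.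
pose P s := F (s, m * s + b).
pose p s := h1 (s, m * s + b) + m * h2 (s, m * s + b).
have cline : continuous (fun s : R => (s, m * s + b) : R * R).
  move=> s; apply: (@cvg_pair _ _ _ (nbhs s) (nbhs s) (nbhs (m * s + b))); first exact: cvg_id.
  by apply: cvgD; [apply: cvgM; [exact: cvg_cst|exact: cvg_id]|exact: cvg_cst].
have cF := lip_continuous lF; have c1 := lip_continuous l1; have c2 := lip_continuous l2.
have cp : continuous p.
  move=> s; apply: cvgD; first by apply: continuous_comp; [exact: cline|exact: c1].
  by apply: cvgM; [exact: cvg_cst|apply: continuous_comp; [exact: cline|exact: c2]].
have cP : continuous P by move=> s; apply: continuous_comp; [exact: cline|exact: cF].
have cP1 : continuous (fun x : R * R => P x.1).
  by move=> x; apply: (continuous_comp (f := fst)); [exact: cvg_fst|exact: cP].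
have cp1 : continuous (fun x : R * R => p x.1).
  by move=> x; apply: (continuous_comp (f := fst)); [exact: cvg_fst|exact: cp].
have cn (f : R * R -> R) : continuous f -> continuous (fun x => `|f x|).
  by move=> cf x; apply: cvg_norm; exact: cf.
have int (f : R * R -> R) : continuous f -> leb2.-integrable K (EFin \o f).
  exact: continuous_integrable bK.
have cen := enorm_continuous l1 l2.
have Icst (c : R) : \int[leb2]_(x in K) c = c * M by rewrite Rintegral_cst.
have icst (c : R) : leb2.-integrable K (EFin \o (fun=> c)).
  by apply: (int (fun=> c)) => x; exact: cvg_cst.
have FP x : K x -> `|F x - P x.1| <= L * W.
  move=> Kx; apply: (le_trans (lF _ _)) => /=.
  by rewrite subrr normr0 add0r ler_wpM2l// hW.
have pH x : K x -> `|p x.1| <= Num.sqrt (1 + m ^+ 2) * (enorm (h1 x, h2 x) + 2 * L * W).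
  move=> Kx; rewrite /p; set z := (x.1, m * x.1 + b).
  have hz : enorm (h1 z, h2 z) <= enorm (h1 x, h2 x) + 2 * L * W.
    have := enorm_dist (h1 z, h2 z) (h1 x, h2 x); rewrite ler_norml /= => /andP[_].
    have := l1 z x; have := l2 z x; rewrite /= subrr normr0 add0r (distrC (m * x.1 + b)).
    have := ler_wpM2l L0 (hW _ Kx); lra.
  apply: (@le_trans _ _ (Num.sqrt (1 + m ^+ 2) * enorm (h1 z, h2 z))); last by rewrite ler_wpM2l.
  have e1 : Num.sqrt (1 + m ^+ 2) = enorm (1, m) by rewrite /enorm/= expr1n.
  rewrite e1 ler_norml; apply/andP; split.
    have := dot_enorm (1, m) (- (h1 z, h2 z)); rewrite enormN /=; lra.
  by have := dot_enorm (1, m) (h1 z, h2 z); rewrite /=; lra.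
set IF := \int[leb2]_(x in K) `|F x|; set Ih := \int[leb2]_(x in K) enorm (h1 x, h2 x).
pose IP := \int[leb2]_(x in K) `|P x.1|.
pose Ip := \int[leb2]_(x in K) `|p x.1|.
have IFP : IF <= IP + L * W * M.
  rewrite /IP -Icst -RintegralD//; last exact: int (cn _ cP1).
  apply: le_Rintegral => //; first exact: int (cn _ cF).
  - by apply: (int (fun x => `|P x.1| + L * W)) => x; apply: cvgD; [exact: (cn _ cP1)|exact: cvg_cst].
  - move=> x Kx; have := FP _ Kx; have := ler_normD (F x - P x.1) (P x.1); rewrite subrK; lra.
have P0 : `|\int[leb2]_(x in K) P x.1| <= L * W * M.
  have -> : \int[leb2]_(x in K) P x.1 = \int[leb2]_(x in K) (P x.1 - F x).
    by rewrite RintegralB ?F0 ?subr0//; exact: int.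
  have cPF : continuous (fun x : R * R => P x.1 - F x).
    by move=> x; apply: cvgB; [exact: cP1|exact: cF].
  apply: (le_trans (le_normr_Rintegral _ _)) => //; first exact: int.
  rewrite -Icst; apply: le_Rintegral => //; first exact: int (cn _ cPF).
  by move=> x Kx; rewrite distrC; exact: FP.
have s0 := slen_ge0 cK bK.
have ms := measurable_slen oK.
have mP := continuous_measurable_fun cP.
have mnP : measurable_fun setT (fun s => `|P s|) by exact: (measurableT_comp (@normr_measurable _ _)).
have mnp : measurable_fun setT (fun s => `|p s|).
  by apply: (measurableT_comp (@normr_measurable _ _)); exact: continuous_measurable_fun.
have mPP (c : R) : measurable_fun setT (fun s => `|c - P s|).
  by apply: (measurableT_comp (@normr_measurable _ _)); apply: measurable_funB.
have EI (f : R * R -> R) : continuous f -> (\int[leb2]_(x in K) (f x)%:E)%E = (\int[leb2]_(x in K) f x)%:E.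
  by move=> cf; rewrite /Rintegral fineK//; apply: integrable_fin_num => //; exact: int.
(* For fixed s, M * P s is the integral of P s - P t over K plus the integral
   of P, and the latter is O(W) since F has integral 0. *)
have key : M * IP <= (sup (shadow K) - inf (shadow K)) * M / 2 * Ip + L * W * M * M.
  have h s : ((M * `|P s|)%:E <= \int[mu]_t ((slen K t)%:E * `|P s - P t|%:E) + (L * W * M)%:E)%E.
    have -> : (\int[mu]_t ((slen K t)%:E * `|P s - P t|%:E))%E = (\int[leb2]_(x in K) `|P s - P x.1|)%:E.
      have cc : continuous (fun x : R * R => P s - P x.1).
        by move=> x; apply: cvgB; [exact: cvg_cst|exact: cP1].
      rewrite -EI; last exact: cn.
      rewrite (integral_slices oK cK bK (u := fun t => `|P s - P t|))//.
      by apply: eq_integral => t _; rewrite -EFinM mulrC.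
    rewrite -EFinD lee_fin.
    have -> : M * `|P s| = `|\int[leb2]_(x in K) (P s - P x.1) + \int[leb2]_(x in K) P x.1|.
      by rewrite RintegralB// ?Icst ?subrK ?normrM ?(ger0_norm M0) 1?mulrC//; exact: int.
    apply: (le_trans (ler_normD _ _)); apply: lerD => //.
    apply: le_normr_Rintegral => //.
    by apply: (int (fun x => P s - P x.1)) => x; apply: cvgB; [exact: cvg_cst|exact: cP1].
  rewrite -lee_fin EFinD [in leRHS]EFinM.
  have EP : IP%:E = (\int[mu]_s (`|P s| * slen K s)%:E)%E.
    by rewrite -(integral_slices oK cK bK (u := fun s => `|P s|))// EI//; exact: cn.
  have Ep : Ip%:E = (\int[mu]_s (`|p s| * slen K s)%:E)%E.
    by rewrite -(integral_slices oK cK bK (u := fun s => `|p s|))// EI//; exact: cn.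
  rewrite Ep; apply: le_trans; last exact: leeD (slice_poincare oK cK bK (P := P) (p := p) dF cp) (lexx _).
  have -> : (L * W * M * M)%:E = (\int[mu]_s ((slen K s)%:E * (L * W * M)%:E))%E.
    rewrite ge0_integralZr//.
    - by rewrite -(mass_slices oK cK bK) -/M -(fineK Kfin) -/M -EFinM mulrC.
    - exact/measurable_EFinP.
    - by move=> s _; rewrite lee_fin.
    - by rewrite lee_fin !mulr_ge0.
  have mI : measurable_fun setT (fun s => \int[mu]_t ((slen K t)%:E * `|P s - P t|%:E))%E.
    apply: (@measurable_fun_fubini_tonelli_F _ _ (measurableTypeR R) (measurableTypeR R) R mu (fun z => ((slen K z.2)%:E * `|P z.1 - P z.2|%:E)%E)).
      apply: emeasurable_funM; apply/measurable_EFinP; first exact: (measurableT_comp ms).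
      apply: (measurableT_comp (@normr_measurable _ _)).
      by apply: measurable_funB; exact: (measurableT_comp mP).
    by move=> z; apply: mule_ge0; rewrite lee_fin.
  have I0 s : (0 <= \int[mu]_t ((slen K t)%:E * `|P s - P t|%:E))%E.
    by apply: integral_ge0 => t _; apply: mule_ge0; rewrite lee_fin.
  rewrite -ge0_integralD//; first last.
  - by apply: emeasurable_funM => //; apply/measurable_EFinP.
  - by move=> s _; apply: mule_ge0; rewrite lee_fin// !mulr_ge0.
  - by apply: emeasurable_funM; [exact/measurable_EFinP|exact: mI].
  - by move=> s _; apply: mule_ge0; rewrite ?lee_fin.
  rewrite EFinM EP -ge0_integralZl//; first last.
  - by move=> s _; rewrite lee_fin mulr_ge0.
  - by apply/measurable_EFinP; exact: measurable_funM.
  apply: ge0_le_integral => //.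
  - by move=> s _; rewrite -EFinM lee_fin !mulr_ge0.
  - by apply: measurable_funeM; apply/measurable_EFinP; exact: measurable_funM.
  - apply: emeasurable_funD; apply: emeasurable_funM; try exact: mI; try exact/measurable_EFinP.
  - move=> s _; rewrite -ge0_muleDr//; last by rewrite lee_fin !mulr_ge0.
    rewrite -EFinM mulrA [M * _ * _]mulrC EFinM; apply: lee_wpmul2l; first by rewrite lee_fin.
    exact: h.
have [M00|Mp] := leP M 0.
  have MM : M = 0 by apply/eqP; rewrite eq_le M00 M0.
  have Kn : leb2 K = 0%E by rewrite -(fineK Kfin) -/M MM.
  have I0 (f : R * R -> R) : continuous f -> \int[leb2]_(x in K) f x = 0.
    move=> cf; rewrite /Rintegral null_set_integral//.
    by apply: (measurable_int leb2); exact: int cf.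
  by rewrite /IF /Ih !I0//; [rewrite MM !mulr0 addr0|exact: cn].
have sh0 : shadow K !=set0.
  apply: contrapT => h.
  have K0 : K = set0 by apply/seteqP; split => // -[s y] Ky; apply: h; exists s, y.
  by move: Mp; rewrite /M K0 measure0 ltxx.
have key2 : IP <= (sup (shadow K) - inf (shadow K)) / 2 * Ip + L * W * M.
  by rewrite -(ler_pM2l Mp) (le_trans key)// le_eqVlt; apply/orP; left; apply/eqP; field.
have hq := slope_width oK cK bK sh0 hW hd.
set D := sup (shadow K) - inf (shadow K) in key2 hq.
have Dge0 : 0 <= D.
  have [s hs] := sh0; have := (shadowE oK cK bK sh0 s).1 hs.
  by rewrite in_itv/= /D => /andP[? ?]; lra.
have Ip_le : Ip <= Num.sqrt (1 + m ^+ 2) * (Ih + 2 * L * W * M).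
  rewrite /Ih -Icst -RintegralD//; last exact: int.
  have cc : continuous (fun x : R * R => enorm (h1 x, h2 x) + 2 * L * W).
    by move=> x; apply: cvgD; [exact: cen|exact: cvg_cst].
  rewrite -RintegralZl//; last exact: int.
  apply: le_Rintegral => //; first exact: int (cn _ cp1).
  by apply: (int (fun x => Num.sqrt (1 + m ^+ 2) * (enorm (h1 x, h2 x) + 2 * L * W))) => x; apply: cvgM; [exact: cvg_cst|exact: cc].
have Ih0 : 0 <= Ih by apply: Rintegral_ge0 => x _; exact: enorm_ge0.
have Ih_le : Ih <= 2 * H * M.
  rewrite -Icst; apply: le_Rintegral => //; first exact: int.
  move=> x /hH[hx1 hx2]; apply: (le_trans (enorm_le _)) => /=; lra.
have LWM0 : 0 <= 2 * L * W * M by rewrite !mulr_ge0.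
have step : D * Ip <= (d + 2 * W) * (Ih + 2 * L * W * M).
  apply: (le_trans (ler_wpM2l Dge0 Ip_le)); rewrite mulrA; apply: ler_wpM2r => //; lra.
have W2 : W * W <= W by rewrite -[leRHS]mulr1 ler_wpM2l.
have := ler_wpM2l (mulr_ge0 L0 M0) W2.
have := ler_wpM2l W0 Ih_le.
nra.
Qed.
End thin.

(** * Convex sets without large squares lie in strips *)
Section strip.
Context {R : realType}.

Lemma cvx3 (K : set (R * R)) a b c (la lb lc : R) : cvx K -> K a -> K b -> K c ->
  0 <= la -> 0 <= lb -> 0 <= lc -> la + lb + lc = 1 ->
  K (la * a.1 + lb * b.1 + lc * c.1, la * a.2 + lb * b.2 + lc * c.2).
Proof.
move=> cK Ka Kb Kc a0 b0 c0 s1.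
have [ab0|ab0] := eqVneq (la + lb) 0.
  have -> : la = 0 by lra. have -> : lb = 0 by lra. have -> : lc = 1 by lra.
  by rewrite !mul0r !add0r !mul1r; case: c Kc.
have abp : 0 < la + lb by rewrite lt_neqAle eq_sym ab0 addr_ge0.
have t01 : 0 <= lb / (la + lb) <= 1.
  by rewrite divr_ge0 ?(ltW abp)// ler_pdivrMr// mul1r; lra.
have := cK _ _ lc (cK _ _ _ Ka Kb t01) Kc; rewrite /=.
have -> : 0 <= lc <= 1 by apply/andP; split; lra.
move=> /(_ isT); congr K; have -> : lc = 1 - la - lb by lra.
by congr (_, _); field.
Qed.

(** Take two points of K at nearly maximal distance D and the line through them.
    If a third point were more than 30 w above or below it, the triangle would
    be so fat that the square of half-side w around its barycentre lies inside, against the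
    hypothesis. *)
Lemma convex_strip (K : set (R * R)) B (w : R) : opn K -> cvx K -> bnd K B -> K !=set0 -> 0 <= w ->
  (forall z, K z -> exists u, [/\ `|u.1| <= w, `|u.2| <= w & ~ K (z + u)]) ->
  exists m b, `|m| <= 1 /\
    ((forall x, K x -> `|x.2 - (m * x.1 + b)| <= 30 * w) \/
     (forall x, K x -> `|x.1 - (m * x.2 + b)| <= 30 * w)).
Proof.
move=> oK cK bK [x0 Kx0] w0 hsq.
pose S := [set r | exists x y, [/\ K x, K y & r = Num.max `|x.1 - y.1| `|x.2 - y.2|]].
have hS : has_sup S.
  split; first by exists 0, x0, x0; split => //; rewrite !subrr !normr0 maxxx.
  exists (2 * B) => r [x [y [/bK[x1 x2] /bK[y1 y2] ->]]].
  have := ler_normB x.1 y.1; have := ler_normB x.2 y.2.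
  by rewrite ge_max; move=> ? ?; apply/andP; split; lra.
have Sp : 0 < sup S.
  have [r r0 rK] := oK _ Kx0.
  apply: (@lt_le_trans _ _ (r / 2)); first by rewrite divr_gt0.
  apply: (@le_trans _ _ (Num.max `|(x0.1 + r / 2) - x0.1| `|x0.2 - x0.2|)).
    by rewrite addrC addKr le_max ger0_norm ?lexx// ltW ?divr_gt0.
  apply: ub_le_sup; first exact: hS.2.
  exists (x0.1 + r / 2, x0.2), x0; split => //; apply: rK.
  by split; rewrite /= ?subrr ?normr0// addrC addKr ger0_norm; lra.
have [r [x [y [Kx Ky ->]]] hr] := sup_adherent (eps := sup S / 2) ltac:(by rewrite divr_gt0) hS.
set D := Num.max _ _ in hr.
have Dp : 0 < D by lra.
have hD p q : K p -> K q -> `|p.1 - q.1| <= 2 * D /\ `|p.2 - q.2| <= 2 * D.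
  move=> Kp Kq; have : Num.max `|p.1 - q.1| `|p.2 - q.2| <= sup S.
    by apply: ub_le_sup; [exact: hS.2|exists p, q].
  by rewrite ge_max => /andP[? ?]; split; lra.
(* Applied to K or to its mirror image, according to the coordinate that
   realizes D. *)
have main (K' : set (R * R)) a b : cvx K' -> K' a -> K' b ->
    (forall z, K' z -> exists u, [/\ `|u.1| <= w, `|u.2| <= w & ~ K' (z + u)]) ->
    (forall p q, K' p -> K' q -> `|p.1 - q.1| <= 2 * D /\ `|p.2 - q.2| <= 2 * D) ->
    `|b.1 - a.1| = D -> `|b.2 - a.2| <= D ->
    exists m b, `|m| <= 1 /\ (forall x, K' x -> `|x.2 - (m * x.1 + b)| <= 30 * w).
  move=> cK' Ka Kb hsq' hD' abD ab2.
  have ba0 : b.1 - a.1 != 0 by rewrite -normr_gt0 abD.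
  pose m := (b.2 - a.2) / (b.1 - a.1).
  have m1 : `|m| <= 1 by rewrite /m normf_div abD ler_pdivrMr ?mul1r.
  exists m, (a.2 - m * a.1); split => // c Kc; rewrite leNgt; apply/negP.
  set t := c.2 - _ => tw.
  have t0 : 0 < `|t| by apply: le_lt_trans tw; rewrite mulr_ge0.
  have tn0 : t != 0 by rewrite -normr_gt0.
  have [ca1 ca2] := hD' _ _ Kc Ka.
  have tD : `|t| <= 4 * D.
    have -> : t = (c.2 - a.2) - m * (c.1 - a.1) by rewrite /t; ring.
    apply: (le_trans (ler_normB _ _)); rewrite normrM.
    have := ler_wpM2r (normr_ge0 (c.1 - a.1)) m1; lra.
  pose z := (3^-1 * a.1 + 3^-1 * b.1 + 3^-1 * c.1, 3^-1 * a.2 + 3^-1 * b.2 + 3^-1 * c.2).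
  have Kz : K' z by apply: cvx3 => //; lra.
  have [u [u1 u2]] := hsq' _ Kz; apply.
  (* Moving the barycentre z by u changes its barycentric coordinates by dc and db
     at c and b; |dc| + |db| <= 1/3 keeps z + u inside the triangle. *)
  pose dc := (u.2 - m * u.1) / t.
  pose db := (u.1 - dc * (c.1 - a.1)) / (b.1 - a.1).
  have hdc : `|dc| <= 1 / 15.
    rewrite /dc normf_div ler_pdivrMr//; apply: (le_trans (ler_normB _ _)); rewrite normrM.
    have := ler_wpM2r (normr_ge0 u.1) m1; lra.
  have hdb : `|db| <= 4 / 15.
    rewrite /db normf_div abD ler_pdivrMr//; apply: (le_trans (ler_normB _ _)); rewrite normrM.
    have := ler_pM (normr_ge0 _) (normr_ge0 _) hdc ca1; lra.
  move: hdc hdb; rewrite !ler_norml => /andP[dc1 dc2] /andP[db1 db2].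
  have := cvx3 (la := 3^-1 - db - dc) (lb := 3^-1 + db) (lc := 3^-1 + dc) cK' Ka Kb Kc.
  have -> : z + u = ((3^-1 - db - dc) * a.1 + (3^-1 + db) * b.1 + (3^-1 + dc) * c.1,
    (3^-1 - db - dc) * a.2 + (3^-1 + db) * b.2 + (3^-1 + dc) * c.2).
    have e1 : u.1 = db * (b.1 - a.1) + dc * (c.1 - a.1) by rewrite /db divfK// subrK.
    have e2 : u.2 = dc * t + m * u.1 by rewrite /dc divfK// subrK.
    have e3 : b.2 = a.2 + m * (b.1 - a.1) by rewrite /m divfK// addrC subrK.
    congr (_, _) => /=; first by rewrite e1; ring.
    by rewrite e2 e1 e3 /t; ring.
  by apply; lra.
have [h|h] := leP `|x.2 - y.2| `|x.1 - y.1|.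
  have DE : D = `|x.1 - y.1| by rewrite /D; apply/max_idPl.
  have [//||m [b [m1 hm]]] := main K y x cK Ky Kx hsq hD; first by rewrite DE.
  by exists m, b; split => //; left.
have DE : D = `|x.2 - y.2| by rewrite /D; apply/max_idPr/ltW.
have [|||||||m [b [m1 hm]]] := main [set p | K (p.2, p.1)] (y.2, y.1) (x.2, x.1).
- by move=> p q t Kp Kq ht; exact: (cK _ _ _ Kp Kq ht).
- by rewrite /=; case: y Ky {h hr D Dp hD main DE}.
- by rewrite /=; case: x Kx {h hr D Dp hD main DE}.
- move=> z /= /hsq[u [u1 u2 hu]]; exists (u.2, u.1); split => //.
- by move=> p q Kp Kq; have [] := hD _ _ Kp Kq.
- by rewrite DE.
- by rewrite /= DE ltW.
- exists m, b; split => //; right => p Kp; have := hm (p.2, p.1); rewrite /=; apply.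
  by case: p Kp.
Qed.
End strip.

(** * Cutting a convex set by a line *)
Section cut.
Context {R : realType}.
Local Notation mu := (@lebesgue_measure R).
Local Notation leb2 := (@lebesgue2 R).

Definition level (q n : R * R) (x : R * R) : R := (x.1 - q.1) * n.1 + (x.2 - q.2) * n.2.
Definition halfplane (q n : R * R) : set (R * R) := [set x | 0 < level q n x].
Definition zero_line (q n : R * R) : set (R * R) := [set x | level q n x = 0].

Lemma level_lip q n : lip (level q n) (`|n.1| + `|n.2|).
Proof.
move=> x y; rewrite (_ : level q n x - level q n y = (x.1 - y.1) * n.1 + (x.2 - y.2) * n.2); last by rewrite /level; ring.
apply: (le_trans (ler_normD _ _)); rewrite !normrM.
have := mulr_ge0 (normr_ge0 n.1) (normr_ge0 (x.2 - y.2)).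
have := mulr_ge0 (normr_ge0 n.2) (normr_ge0 (x.1 - y.1)); nra.
Qed.

Lemma level_continuous q n : continuous (level q n).
Proof. exact: lip_continuous (level_lip q n). Qed.

Lemma halfplane_open q n : open (halfplane q n).
Proof.
rewrite (_ : halfplane q n = level q n @^-1` [set r | 0 < r]); last by [].
by move/continuousP : (@level_continuous q n); apply; exact: open_gt.
Qed.

Lemma measurable_halfplane q n : measurable (halfplane q n : set (mplane R)).
Proof. exact: open_measurable2 (@halfplane_open q n). Qed.

Lemma halfplane_cvx q n : cvx (halfplane q n).
Proof.
move=> x y t; rewrite /halfplane/= => hx hy /andP[t0 t1].
have -> : level q n (x.1 + t * (y.1 - x.1), x.2 + t * (y.2 - x.2)) = (1 - t) * level q n x + t * level q n y.
  by rewrite /level/=; ring.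
have [->|tn1] := eqVneq t 1; first by rewrite subrr mul0r add0r mul1r.
by rewrite ltr_pwDl ?mulr_ge0 ?(ltW hy)// mulr_gt0// subr_gt0 lt_neqAle tn1.
Qed.

Lemma opnI (A C : set (R * R)) : opn A -> opn C -> opn (A `&` C).
Proof.
move=> oA oC x [/oA[r r0 rA] /oC[s s0 sC]]; exists (Num.min r s); first by rewrite lt_min r0.
by move=> y [y1 y2]; split; [apply: rA|apply: sC]; move: y1 y2; rewrite !lt_min => /andP[? ?] /andP[? ?].
Qed.

Lemma cvxI (A C : set (R * R)) : cvx A -> cvx C -> cvx (A `&` C).
Proof. by move=> cA cC x y t [Ax Cx] [Ay Cy] ht; split; [exact: cA|exact: cC]. Qed.

Lemma measurable_zero_line q n : measurable (zero_line q n : set (mplane R)).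
Proof.
have := continuous_measurable2 (@level_continuous q n) measurableT (measurable_set1 0).
by rewrite setTI.
Qed.

Lemma line_null q n : n != 0 -> leb2 (zero_line q n) = 0%E.
Proof.
move=> n0; have [n20|n20] := eqVneq n.2 0.
  have n10 : n.1 != 0.
    by apply: contraNneq n0 => n10; rewrite (surjective_pairing n) n10 n20.
  pose A : set (measurableTypeR R) := [set q.1].
  have mA : measurable A by exact: measurable_set1.
  apply/eqP; rewrite -measure_le0.
  have -> : (0 = leb2 (A `*` [set: measurableTypeR R]))%E.
    have -> : leb2 (A `*` [set: measurableTypeR R]) = (mu A * mu [set: measurableTypeR R])%E.
      exact: (product_measure1E mu mu mA measurableT).
    by rewrite /A [X in (X * _)%E](_ : _ = 0%E) ?mul0e//; exact: lebesgue_measure_set1.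
  apply: le_measure; rewrite ?inE; [exact: measurable_zero_line|exact: measurableX|].
  move=> x; rewrite /zero_line/= /level n20 mulr0 addr0 => /eqP.
  by rewrite mulf_eq0 (negbTE n10) orbF subr_eq0 => /eqP ->; split.
rewrite /lebesgue2/= /product_measure1; apply: integral0_eq => s _ /=.
have -> : xsection (zero_line q n) s = [set q.2 - (s - q.1) * n.1 / n.2].
  apply/seteqP; split => y; rewrite /xsection/= inE /zero_line/= /level/=.
    move=> h; have -> : (s - q.1) * n.1 = - ((y - q.2) * n.2) by lra.
    by field.
  by move=> ->; field.
exact: lebesgue_measure_set1.
Qed.

Lemma halfplaneN q n x : halfplane q (- n) x <-> level q n x < 0.
Proof. by rewrite /halfplane/= /level/= !mulrN -opprD oppr_gt0. Qed.

Variables (K : set (R * R)) (B : R).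
Hypotheses (oK : opn K) (bK : bnd K B).
Let mK : measurable (K : set (mplane R)). Proof. exact: opn_measurable. Qed.
Let mH q n : measurable (K `&` halfplane q n : set (mplane R)).
Proof. exact: measurableI mK (measurable_halfplane q n). Qed.

Lemma cut_integral (f : R * R -> R) q n : n != 0 -> continuous f ->
  \int[leb2]_(x in K) f x = \int[leb2]_(x in K `&` halfplane q n) f x + \int[leb2]_(x in K `&` halfplane q (- n)) f x.
Proof.
move=> n0 cf; have fi := continuous_integrable mK bK cf.
rewrite -(Rintegral_setU (mH q n) (mH q (- n))); last 2 first.
- apply: integrableS fi => //; first exact: measurableU (mH q n) (mH q (- n)).
  by move=> x [[]|[]].
- apply/disj_setPS => x [[_ h1] [_ /halfplaneN h2]]; move: h1; rewrite /halfplane/= => h1.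
  by have := lt_trans h1 h2; rewrite ltxx.
rewrite /Rintegral (negligible_integral (measurable_zero_line q n) mK)//; last exact: line_null.
congr (fine (integral _ _ _)); apply/seteqP; split => x /=.
  move=> [Kx h]; have [h1|h1|//] := ltgtP (level q n x) 0.
    by right; split => //; exact/halfplaneN.
  by left.
by move=> [[Kx h]|[Kx /halfplaneN h]]; split => // h1; move: h; rewrite /halfplane/= h1 ltxx.
Qed.

(** A path of nonzero directions from (-1, 0) to (1, 0). The endpoints are
    opposite, which is all that the intermediate value argument needs of a half
    turn. *)
Definition rot (s : R) : R * R := (s, 1 - `|s|).

Lemma rot_neq0 s : rot s != 0.
Proof.
apply/eqP => -[s0]; rewrite s0 normr0 subr0 => /eqP.
by rewrite oner_eq0.
Qed.

Lemma level_rot_continuous q x : continuous (fun s => level q (rot s) x).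
Proof.
move=> s; rewrite /level/rot/=; apply: cvgD; first by apply: cvgM; [exact: cvg_cst|exact: cvg_id].
apply: cvgM; first exact: cvg_cst.
by apply: cvgB; [exact: cvg_cst|apply: cvg_norm; exact: cvg_id].
Qed.

(** Dominated convergence: off the cutting line, which is a null set, the
    indicator of the half-plane is locally constant in the direction. *)
Lemma cut_continuous (F : R * R -> R) q : continuous F ->
  continuous (fun s => \int[leb2]_(x in K `&` halfplane q (rot s)) F x).
Proof.
move=> cF a; apply/(@cvg_nbhsP _ R^o) => w wa.
have fi := continuous_integrable mK bK cF.
have mF : measurable_fun K (EFin \o F) := measurable_int _ fi.
have mFi s : measurable_fun K (fun x => (F x * \1_(halfplane q (rot s)) x)%:E).
  apply/measurable_EFinP; apply: measurable_funM; first exact/measurable_EFinP.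
  by apply: measurable_indic; exact: measurable_halfplane.
have E s : \int[leb2]_(x in K `&` halfplane q (rot s)) F x = \int[leb2]_(x in K) (F x * \1_(halfplane q (rot s)) x).
  rewrite Rintegral_mkcondr; apply: eq_Rintegral => x _.
  by rewrite patchE indicE; case: ifPn; rewrite ?mulr1 ?mulr0.
rewrite /comp E; under eq_fun do rewrite E.
apply: fine_cvg.
have [] := @dominated_convergence _ (mplane R) R leb2 K mK
  (fun n x => (F x * \1_(halfplane q (rot (w n))) x)%:E) (fun x => (F x * \1_(halfplane q (rot a)) x)%:E)
  (fun x => `|F x|%:E).
- by move=> n; exact: mFi.
- exact: mFi.
- exists (zero_line q (rot a)); split; [exact: measurable_zero_line|exact/line_null/rot_neq0|].
  move=> x /=; apply: contra_notP => /eqP hx Kx.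
  apply: cvg_EFin; first exact: nearW.
  apply: cvgM; first exact: cvg_cst.
  have cl : level q (rot (w n)) x @[n --> \oo] --> level q (rot a) x.
    by apply: (cvg_comp w (fun s => level q (rot s) x) wa); exact: level_rot_continuous.
  apply: cvg_near_cst.
  have [h|h] := ltP 0 (level q (rot a) x).
    have H : \forall k \near \oo, 0 < level q (rot (w k)) x by exact: (cvgr_gt _ cl).
    near=> k; have hk : 0 < level q (rot (w k)) x by near: k.
    by rewrite !indicE !mem_set.
  have {}h : level q (rot a) x < 0 by rewrite lt_neqAle hx h.
  have H : \forall k \near \oo, level q (rot (w k)) x < 0 by exact: (cvgr_lt _ cl).
  near=> k; have hk : level q (rot (w k)) x < 0 by near: k.
  by rewrite !indicE !memNset// /halfplane/=; apply/negP; rewrite -leNgt ltW.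
- exact: integrable_abse fi.
- apply: aeW => x n Kx; rewrite lee_fin normrM ler_piMr//.
  by rewrite indicE; case: (_ \in _); rewrite ?normr1 ?normr0.
move=> ifa _ cvg; rewrite fineK; last exact: integrable_fin_num.
exact: cvg.
Unshelve. all: end_near. Qed.

(** Reversing the direction exchanges the two sides of the cut, whose integrals
    add up to 0; so the integral over one side changes sign along the half turn
    and vanishes somewhere. *)
Lemma cut_exists (F : R * R -> R) q : continuous F -> \int[leb2]_(x in K) F x = 0 ->
  exists n, [/\ n != 0, \int[leb2]_(x in K `&` halfplane q n) F x = 0
    & \int[leb2]_(x in K `&` halfplane q (- n)) F x = 0].
Proof.
move=> cF F0.
pose J s := \int[leb2]_(x in K `&` halfplane q (rot s)) F x.
have J1 : J (-1) = - J 1.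
  have := cut_integral q (rot_neq0 1) cF; rewrite F0 -/(J 1).
  have -> : - rot 1 = rot (-1) by rewrite /rot normrN normr1 subrr; congr (_, _); rewrite /= oppr0.
  by rewrite -/(J (-1)) => /esym/eqP; rewrite addrC addr_eq0 => /eqP.
have [|||s _ Js] := @IVT R J (-1) 1 0.
- lra.
- by apply: continuous_subspaceT; exact: cut_continuous.
- by rewrite J1; case: (leP (- J 1) (J 1)) => h; apply/andP; split; lra.
exists (rot s); split => //; first exact: rot_neq0.
by have := cut_integral q (rot_neq0 s) cF; rewrite F0 -/(J s) Js add0r => <-.
Qed.

End cut.

(** * Exchanging the coordinates *)
Section coordinate_swap.
Context {R : realType}.
Local Notation mu := (@lebesgue_measure R).
Local Notation leb2 := (@lebesgue2 R).
Definition swap (x : R * R) : R * R := (x.2, x.1).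

Lemma swap_lip f (L : R) : lip f L -> lip (f \o swap) L.
Proof. by move=> lf x y; rewrite [X in _ * X]addrC; exact: (lf (swap x) (swap y)). Qed.

Lemma Rintegral_swap (K : set (R * R)) B (f : R * R -> R) : opn K -> opn (swap @^-1` K) ->
  bnd K B -> continuous f -> continuous (f \o swap) ->
  \int[leb2]_(x in K) f x = \int[leb2]_(x in swap @^-1` K) f (swap x).
Proof.
move=> oK oK' bK cf cf'.
have bK' : bnd (swap @^-1` K) B by move=> x /bK[].
have mK := opn_measurable oK; have mK' := opn_measurable oK'.
have i1 := continuous_integrable mK bK cf.
have i2 := continuous_integrable mK' bK' cf'.
rewrite /Rintegral [in LHS]integral_mkcond [in RHS]integral_mkcond; congr fine.
have j1 := (integrable_mkcond _ mK).1 i1.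
have j2 := (integrable_mkcond _ mK').1 i2.
apply: etrans (esym (integral21_prod_meas1 (m1 := mu) (m2 := mu) j1)) _.
apply: etrans (integral12_prod_meas1 (m1 := mu) (m2 := mu) j2).
apply: eq_integral => s _; apply: eq_integral => t _ /=.
by rewrite !patchE.
Qed.
End coordinate_swap.

(** * Localization and the inequality for smooth functions *)
Section smooth_poincare.
Context {R : realType}.
Local Notation mu := (@lebesgue_measure R).
Local Notation leb2 := (@lebesgue2 R).

(** Lovasz-Simonovits localization. [cut_exists] cuts K through q into two
    parts over which F still has integral 0, and one of them keeps the strict
    inequality by additivity. Neither contains q, which lies on the line. *)
Lemma localize (U : set (R * R)) B (F G : R * R -> R) (e : R) (qs : seq (R * R)) :
  opn U -> cvx U -> bnd U B -> continuous F -> continuous G ->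
  \int[leb2]_(x in U) F x = 0 ->
  e * fine (leb2 U) < \int[leb2]_(x in U) G x ->
  exists K, [/\ opn K, cvx K, K `<=` U, \int[leb2]_(x in K) F x = 0 &
    (e * fine (leb2 K) < \int[leb2]_(x in K) G x /\ forall q, q \in qs -> ~ K q)].
Proof.
move=> oU cU bU cF cG F0 G0; elim: qs => [|q qs [K [oK cK KU KF [KG Kq]]]].
  by exists U; split.
have [Kqq|Kqq] := pselect (K q); last first.
  by exists K; split => //; split => // p; rewrite inE => /predU1P[->//|]; exact: Kq.
have bK : bnd K B by move=> x /KU; exact: bU.
have [n [n0 F1 F2]] := cut_exists oK bK q cF KF.
have h n' : opn (K `&` halfplane q n') /\ cvx (K `&` halfplane q n').
  by split; [apply: opnI => //; exact/open_opn/halfplane_open|apply: cvxI => //; exact: halfplane_cvx].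
have nq n' p : p \in q :: qs -> ~ (K `&` halfplane q n') p.
  rewrite inE => /predU1P[->|/Kq h1]; last by case.
  by case=> _; rewrite /halfplane/= /level !subrr !mul0r addr0 ltxx.
have mass D : opn D -> fine (leb2 D) = \int[leb2]_(x in D) 1.
  by move=> /opn_measurable mD; rewrite Rintegral_cst// mul1r.
have cut f := @cut_integral R K B oK bK f q n n0.
have c1 : continuous (fun _ : R * R => 1 : R) by move=> x; exact: cvg_cst.
have := KG; rewrite mass// (cut _ c1) (cut _ cG) -!mass; [|exact: (h _).1|exact: (h _).1].
rewrite mulrDr => hG.
have [g1|g1] := ltP (e * fine (leb2 (K `&` halfplane q n))) (\int[leb2]_(x in K `&` halfplane q n) G x).
  exists (K `&` halfplane q n); split => //; first exact: (h _).1.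
  - exact: (h _).2.
  - by move=> x [/KU].
  - by split => //; exact: nq.
exists (K `&` halfplane q (- n)); split => //; first exact: (h _).1.
- exact: (h _).2.
- by move=> x [/KU].
- split; [lra|exact: nq].
Qed.

Lemma grid (B w : R) : 0 < w -> exists qs : seq (R * R), forall z : R * R,
  `|z.1| <= B -> `|z.2| <= B -> exists2 q, q \in qs & `|q.1 - z.1| <= w /\ `|q.2 - z.2| <= w.
Proof.
move=> w0.
pose N := (Num.bound (B / w)).+1.
pose g (i : nat) : R := (i%:R - N%:R) * w.
have one z : `|z| <= B -> exists2 i, i \in iota 0 N.*2 & `|g i - z| <= w.
  rewrite ler_norml => /andP[z1 z2].
  have Bw : 0 <= B / w by rewrite divr_ge0//; lra.
  have NB : B / w < N%:R.
    by apply: lt_trans (archi_boundP Bw) _; rewrite ltr_nat.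
  have zw1 : - N%:R < z / w by rewrite ltrNl -mulNr; apply: le_lt_trans NB; rewrite ler_pM2r ?invr_gt0//; lra.
  have zw2 : z / w < N%:R by apply: le_lt_trans NB; rewrite ler_pM2r ?invr_gt0.
  have y0 : 0 <= z / w + N%:R by lra.
  have /andP[t1 t2] := truncn_itv y0.
  exists (Num.truncn (z / w + N%:R)).
    rewrite mem_iota add0n /= -(ltr_nat R) -addnn natrD.
    by apply: le_lt_trans t1 _; lra.
  set i : R := (Num.truncn _)%:R in t1; rewrite -addn1 natrD -/i in t2.
  rewrite /g -/i (_ : _ - z = (i - (z / w + N%:R)) * w); last by field; rewrite gt_eqF.
  rewrite normrM (gtr0_norm w0) ler_piMl ?(ltW w0)//.
  by rewrite ler_norml; apply/andP; split; lra.
exists [seq (g i, g j) | i <- iota 0 N.*2, j <- iota 0 N.*2] => z /one[i hi h1] /one[j hj h2].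
by exists (g i, g j) => //; apply: allpairs_f.
Qed.

(** If the inequality failed, localization at the points of a fine grid would
    give a convex K missing the grid on which it still fails, by a fixed multiple
    e of the area of K. Such a K lies in a strip by [convex_strip], and
    [thin_poincare] bounds the failure by a multiple of the mesh times the area.
    Derivatives along all lines are required since the strip may have any slope. *)
Lemma smooth_poincare (U : set (R * R)) B (F h1 h2 : R * R -> R) (L d : R) :
  opn U -> cvx U -> bnd U B -> lip F L -> lip h1 L -> lip h2 L -> 0 <= L -> 0 <= d ->
  (forall m b s : R, is_derive s 1 (fun s => F (s, m * s + b)) (h1 (s, m * s + b) + m * h2 (s, m * s + b))) ->
  (forall m b s : R, is_derive s 1 (fun s => F (m * s + b, s)) (h2 (m * s + b, s) + m * h1 (m * s + b, s))) ->
  (forall x y, U x -> U y -> enorm (x - y) <= d) ->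
  \int[leb2]_(x in U) F x = 0 ->
  \int[leb2]_(x in U) `|F x| <= d / 2 * \int[leb2]_(x in U) enorm (h1 x, h2 x).
Proof.
move=> oU cU bU lF l1 l2 L0 d0 dF1 dF2 hd F0; rewrite leNgt; apply/negP => gap.
have cF := lip_continuous lF.
have cnF : continuous (fun x => `|F x|) by move=> x; apply: cvg_norm; exact: cF.
have cen := enorm_continuous l1 l2.
pose G x := `|F x| - d / 2 * enorm (h1 x, h2 x).
have cG : continuous G.
  by move=> x; apply: cvgB; [exact: cnF|apply: cvgM; [exact: cvg_cst|exact: cen]].
have GE K : opn K -> bnd K B -> \int[leb2]_(x in K) G x =
    \int[leb2]_(x in K) `|F x| - d / 2 * \int[leb2]_(x in K) enorm (h1 x, h2 x).
  move=> oK bK; have mK := opn_measurable oK.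
  rewrite RintegralB//; last 2 first.
  - exact: (continuous_integrable mK bK cnF).
  - apply: (continuous_integrable mK bK (f := fun x => d / 2 * enorm (h1 x, h2 x))) => x.
    by apply: cvgM; [exact: cvg_cst|exact: cen].
  by rewrite RintegralZl//; exact: (continuous_integrable mK bK cen).
have [H1 hH1] := continuous_bnd B (lip_continuous l1).
have [H2 hH2] := continuous_bnd B (lip_continuous l2).
pose H := `|H1| + `|H2|.
have hH x : `|x.1| <= B -> `|x.2| <= B -> `|h1 x| <= H /\ `|h2 x| <= H.
  move=> x1 x2; have := hH1 _ x1 x2; have := hH2 _ x1 x2.
  have := ler_norm H1; have := ler_norm H2; have := normr_ge0 H1; have := normr_ge0 H2.
  by rewrite /H; split; lra.
have H0 : 0 <= H by rewrite addr_ge0.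
pose C := 2 * L + 2 * H + (d + 2) * L.
have C0 : 0 <= C by rewrite !addr_ge0// !mulr_ge0// addr_ge0.
set g := \int[leb2]_(x in U) `|F x| - d / 2 * \int[leb2]_(x in U) enorm (h1 x, h2 x).
have g0 : 0 < g by rewrite subr_gt0.
have V0 : 0 <= fine (leb2 U) by rewrite fine_ge0.
pose e := g / (fine (leb2 U) + 1).
have e0 : 0 < e by rewrite divr_gt0// ltr_wpDl.
(* The strips have half-width 30 w: it must be at most 1, and its error C * 30 w
   at most e. *)
pose w := Num.min (1 / 30) (e / (30 * (C + 1))).
have w0 : 0 < w by rewrite lt_min; apply/andP; split; rewrite divr_gt0// mulr_gt0// ltr_wpDl.
have W1 : 0 <= 30 * w <= 1.
  have : w <= 1 / 30 by rewrite ge_min lexx.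
  by move=> ?; apply/andP; split; lra.
have CW : C * (30 * w) <= e.
  have hw : w <= e / (30 * (C + 1)) by rewrite ge_min lexx orbT.
  rewrite ler_pdivlMr ?mulr_gt0// ?ltr_wpDl// in hw.
  by apply: le_trans hw; lra.
have [qs hqs] := grid (B + w) w0.
have [|K [oK cK KU KF [KG Kq]]] := localize (e := e) qs oU cU bU cF cG F0.
  rewrite GE// -/g /e -mulrA -[ltRHS]mulr1 ltr_pM2l//.
  by rewrite ltr_pdivrMl ?mulr1 ?ltrDl// ltr_wpDl.
have bK : bnd K B by move=> x /KU; exact: bU.
have [K0|K0] := pselect (K !=set0); last first.
  move: KG; have -> : K = set0 by apply/seteqP; split => // x Kx; apply: K0; exists x.
  by rewrite Rintegral_set0 measure0 mulr0 ltxx.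
have hd' x y : K x -> K y -> enorm (x - y) <= d by move=> /KU Ux /KU; exact: hd.
have [|m [b [m1 hm]]] := convex_strip oK cK bK K0 (ltW w0).
  move=> z Kz; have [z1 z2] := bK _ Kz.
  have [||q qqs [q1 q2]] := hqs z; [lra|lra|].
  exists (q - z); split => //; rewrite addrC subrK; exact: Kq.
suff : \int[leb2]_(x in K) `|F x| <= d / 2 * \int[leb2]_(x in K) enorm (h1 x, h2 x) + C * (30 * w) * fine (leb2 K).
  move: KG; rewrite GE// => KG h.
  have := ler_wpM2r (fine_ge0 (measure_ge0 leb2 K)) CW; lra.
case: hm => hm.
  by apply: (thin_poincare oK cK bK hm W1 lF l1 l2) => // x /bK[]; exact: hH.
pose K' : set (R * R) := swap @^-1` K.
have oK' : opn K'.
  move=> x /oK[r r0 rK]; exists r => // y [y1 y2]; apply: rK; split => //.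
have cK' : cvx K' by move=> x y t Kx Ky ht; exact: (cK _ _ _ Kx Ky ht).
have bK' : bnd K' B by move=> x /bK[].
have lsF := swap_lip lF; have ls1 := swap_lip l1; have ls2 := swap_lip l2.
have csF := lip_continuous lsF.
have cn (f : R * R -> R) : continuous f -> continuous (fun x => `|f x|).
  by move=> cf x; apply: cvg_norm; exact: cf.
have cen' := enorm_continuous ls2 ls1.
have esw x : enorm (h2 (swap x), h1 (swap x)) = enorm (h1 (swap x), h2 (swap x)) by rewrite /enorm/= addrC.
have := @thin_poincare R K' B (F \o swap) (h2 \o swap) (h1 \o swap) L H d m b (30 * w) oK' cK' bK'.
have EF : \int[leb2]_(x in K) `|F x| = \int[leb2]_(x in K') `|(F \o swap) x|.
  by apply: (Rintegral_swap oK oK' bK) => //; exact: cn csF.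
have Eh : \int[leb2]_(x in K) enorm (h1 x, h2 x) = \int[leb2]_(x in K') enorm ((h2 \o swap) x, (h1 \o swap) x).
  rewrite (Rintegral_swap oK oK' bK)//; last first.
    by move=> x; have := cen' x; under eq_fun do rewrite /= esw.
  by apply: eq_Rintegral => x _; rewrite /= esw.
have EM : fine (leb2 K) = fine (leb2 K').
  have mK := opn_measurable oK; have mK' := opn_measurable oK'.
  transitivity (\int[leb2]_(x in K) (fun _ : R * R => 1 : R) x); first by rewrite Rintegral_cst// mul1r.
  rewrite (Rintegral_swap oK oK' bK); try by move=> x; exact: cvg_cst.
  by rewrite Rintegral_cst// mul1r.
rewrite EF Eh EM; apply => //.
- by move=> x /hm.
- by move=> x Kx; have [x1 x2] := bK' _ Kx; have [] := hH (swap x) x2 x1.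
- have := KF; rewrite (Rintegral_swap oK oK' bK)//.
- move=> x y Kx Ky; have := hd' _ _ Kx Ky; rewrite /enorm/= addrC//.
Qed.
End smooth_poincare.

(** * Smooth bump functions *)
Section smooth1.
Context {R : realType}.
Implicit Types (f g a b : R -> R).

(** The derivatives are witnesses, so that closure under products and affine
    changes of variable goes by induction without computing any of them. *)
Fixpoint Sm (k : nat) f : Prop :=
  if k is k'.+1 then exists f', (forall x : R, is_derive x 1 f (f' x)) /\ Sm k' f'
  else continuous f.

Lemma Sm_continuous k f : Sm k f -> continuous f.
Proof. by case: k => [//|k [f' [df _]]]; exact: derive_continuous df. Qed.

Lemma SmS k f : Sm k.+1 f -> Sm k f.
Proof.
elim: k f => [f [f' [df _]]|k IH f [f' [df sf']]]; first exact: derive_continuous df.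
by exists f'; split => //; exact: IH.
Qed.

Lemma SmD k f g : Sm k f -> Sm k g -> Sm k (fun x => f x + g x).
Proof.
elim: k f g => [f g cf cg x|k IH f g [f' [df sf]] [g' [dg sg]]].
  by apply: cvgD; [exact: cf|exact: cg].
exists (fun x => f' x + g' x); split; last exact: IH.
by move=> x; have := df x; have := dg x => *; apply: is_deriveD.
Qed.

Lemma SmM k f g : Sm k f -> Sm k g -> Sm k (fun x => f x * g x).
Proof.
elim: k f g => [f g cf cg x|k IH f g sf sg].
  by apply: cvgM; [exact: cf|exact: cg].
have sf0 := SmS sf; have sg0 := SmS sg.
case: sf sg => [f' [df sf]] [g' [dg sg]].
exists (fun x => f x * g' x + g x * f' x); split; last by apply: SmD; apply: IH.
by move=> x; have := df x; have := dg x => *; apply: is_deriveM.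
Qed.

Lemma Sm_cst k (c : R) : Sm k (fun=> c).
Proof.
elim: k c => [c x|k IH c]; first exact: cvg_cst.
by exists (fun=> 0); split; [move=> x; exact: is_derive_cst|exact: IH].
Qed.

Lemma is_derive_affine (c s x : R) : is_derive x 1 (fun x => c + s * x) s.
Proof.
apply: is_derive_eq; rewrite /GRing.scale/=; ring.
Qed.

Lemma Sm_affine k f (c s : R) : Sm k f -> Sm k (fun x => f (c + s * x)).
Proof.
elim: k f => [f cf x|k IH f [f' [df sf]]].
  apply: (continuous_comp (f := fun x => c + s * x)); last exact: cf.
  apply: (derive_continuous (g' := fun=> s)) => y; exact: is_derive_affine.
exists (fun x => f' (c + s * x) * s); split; last first.
  by apply: SmM; [exact: IH|exact: Sm_cst].
by move=> x; apply: (is_derive1_comp (df _)); exact: is_derive_affine.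
Qed.

(** The functions p(1/x) exp(-1/x), extended by 0. The family is closed under
    differentiation ([is_derive_flat]), hence all its members are smooth. *)
Definition flat (p : {poly R}) (x : R) : R :=
  if 0 < x then p.[x^-1] * expR (- x^-1) else 0.

Lemma poly_expN (p : {poly R}) : exists2 C, 0 <= C & forall y : R, 0 <= y -> `|p.[y]| * expR (- y) <= C.
Proof.
have mono n : exists2 C : R, 0 <= C & forall y : R, 0 <= y -> y ^+ n * expR (- y) <= C.
  case: n => [|n]; first by exists 1 => // y y0; rewrite expr0 mul1r -expR0 ler_expR oppr_le0.
  exists (n.+1`!%:R) => // y y0; rewrite expRN ler_pdivrMr ?expR_gt0//.
  have h : 0 < n.+1`!%:R :> R by rewrite ltr0n fact_gt0.
  have := expR_ge1Dxn n y0; rewrite -(ler_pM2l h) => /(le_trans _); apply.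
  rewrite mulrDr mulr1 mulrCA mulfV ?gt_eqF// mulr1 lerDr//; exact: ltW.
have /choice[C HC] : forall n, exists c : R, 0 <= c /\ forall y : R, 0 <= y -> y ^+ n * expR (- y) <= c.
  by move=> n; have [c c0 h] := mono n; exists c.
exists (\sum_(i < size p) `|p`_i| * C i).
  by apply: sumr_ge0 => i _; rewrite mulr_ge0//; case: (HC i).
move=> y y0; rewrite horner_coef.
apply: (@le_trans _ _ ((\sum_(i < size p) `|p`_i * y ^+ i|) * expR (- y))).
  by rewrite ler_wpM2r ?expR_ge0// ler_norm_sum.
rewrite mulr_suml; apply: ler_sum => i _.
by rewrite normrM (ger0_norm (exprn_ge0 _ y0)) -mulrA ler_wpM2l//; have [_ ] := HC i; exact.
Qed.

(** y^2 p(y) exp(-y) is bounded for y >= 0, so the function is O(x^2) at 0; this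
    is what differentiability at 0 rests on. *)
Lemma flat_small (p : {poly R}) : exists2 C, 0 <= C & forall x : R, `|flat p x| <= C * `|x| * `|x|.
Proof.
have [C C0 hC] := poly_expN (p * 'X^2).
exists C => // x; rewrite /flat; case: ifPn => [x0|_]; last by rewrite normr0 !mulr_ge0.
have xn0 : x != 0 by rewrite gt_eqF.
have := hC x^-1 (ltW _); rewrite invr_gt0 => /(_ x0).
rewrite hornerM hornerXn normrM (ger0_norm (exprn_ge0 _ _)) ?invr_ge0 ?(ltW x0)//.
rewrite normrM (gtr0_norm (expR_gt0 _)) (gtr0_norm x0) => h.
rewrite -[leRHS]mulrA; apply: le_trans (ler_wpM2r (mulr_ge0 (ltW x0) (ltW x0)) h).
rewrite le_eqVlt; apply/orP; left; apply/eqP; by field.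
Qed.

Lemma is_derive_flat (p : {poly R}) (x : R) :
  is_derive x 1 (flat p) (flat ('X^2 * (p - p^`())) x).
Proof.
have [x0|x0|->] := ltgtP x 0.
- have -> : flat ('X^2 * (p - p^`())) x = 0 by rewrite /flat ltNge (ltW x0).
  apply: (@near_eq_is_derive _ _ _ (cst (0 : R))).
  near=> y; rewrite /flat ltNge.
  have : y < 0 by near: y; exact: lt_nbhsl.
  by move/ltW ->.
- have xn0 : x != 0 by rewrite gt_eqF.
  have dV : is_derive x 1 (fun y : R => y^-1) (- x ^- 2).
    have h : is_derive x 1 (fun y : R => (id y)^-1) (- (id x) ^- 2 *: (1 : R)) by apply: is_deriveV.
    by move: h; rewrite /GRing.scale/= mulr1.
  have d1 : is_derive x 1 (fun y => p.[y^-1]) (p^`().[x^-1] * - x ^- 2).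
    by apply: (is_derive1_comp (f := horner p)).
  have d2 : is_derive x 1 (fun y : R => expR (- y^-1)) (expR (- x^-1) * x ^- 2).
    apply: (is_derive1_comp (f := expR) (g := fun y => - y^-1)).
    by rewrite -[x ^- 2]opprK; apply: is_deriveN.
  have d3 : is_derive x 1 (fun y : R => p.[y^-1] * expR (- y^-1)) (flat ('X^2 * (p - p^`())) x).
    apply: is_derive_eq; rewrite /GRing.scale/= /flat x0 !hornerE.
    rewrite -[LHS]/(p.[x^-1] * expR (- x^-1) * x ^- 2 + expR (- x^-1) * p^`().[x^-1] * (- x ^- 2)).
    by field.
  apply: near_eq_is_derive d3; near=> y; rewrite /flat.
  by have -> // : 0 < y by near: y; exact: lt_nbhsr.
rewrite {2}/flat ltxx.
have [C C0 hC] := flat_small p.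
have f0 : flat p 0 = 0 by rewrite /flat ltxx.
have cv : h^-1 *: (flat p (h *: (1 : R) + 0) - flat p 0) @[h --> 0^'] --> (0 : R).
  rewrite f0; apply/cvgrPdist_le => e e0.
  near=> h.
  have hn0 : h != 0 by near: h; exact: nbhs_dnbhs_neq.
  rewrite sub0r normrN subr0 addr0 /GRing.scale/= mulr1 normrM normfV.
  rewrite ler_pdivrMl ?normr_gt0// (le_trans (hC _))// mulrC ler_wpM2l//.
  have : `|h| <= e / (C + 1).
    near: h; apply: dnbhs0_le; rewrite divr_gt0// ltr_wpDl//.
  rewrite ler_pdivlMr ?ltr_wpDl// => h1.
  by apply: le_trans h1; rewrite mulrC ler_wpM2l// lerDl.
apply: DeriveDef; first by apply/cvg_ex; exists 0.
exact: cvg_lim cv.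
Unshelve. all: end_near. Qed.

Lemma Sm_flat k (p : {poly R}) : Sm k (flat p).
Proof.
elim: k p => [p|k IH p].
  by apply: derive_continuous; exact: is_derive_flat.
by exists (flat ('X^2 * (p - p^`()))); split; [exact: is_derive_flat|exact: IH].
Qed.

Lemma bump_exists (e : R) : 0 < e -> exists b : R -> R,
  [/\ forall k, Sm k b, forall x, 0 <= b x, forall x, e <= `|x| -> b x = 0
    & (\int[@lebesgue_measure R]_x (b x)%:E = 1)%E].
Proof.
move=> e0.
pose b0 x := flat 1 (e + 1 * x) * flat 1 (e + (-1) * x).
have sb k : Sm k b0 by apply: SmM; apply: Sm_affine; exact: Sm_flat.
have fl0 x : 0 <= flat 1 x.
  by rewrite /flat; case: ifP => // _; rewrite hornerC mul1r expR_ge0.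
have b00 x : 0 <= b0 x by rewrite mulr_ge0.
have bout x : e <= `|x| -> b0 x = 0.
  rewrite /b0 ler_normr => /orP[h|h]; rewrite /flat.
    by rewrite [X in _ * (if X then _ else _)](_ : _ = false) ?mulr0//; apply/negbTE; rewrite -leNgt; lra.
  by rewrite [X in (if X then _ else _) * _](_ : _ = false) ?mul0r//; apply/negbTE; rewrite -leNgt; lra.
have cb := Sm_continuous (sb 0%N).
have mb := continuous_measurable_fun cb.
have bmax : exists2 M : R, 0 <= M & forall x, b0 x <= M.
  have fl1 x : flat 1 x <= 1.
    rewrite /flat; case: ifP => // h.
    by rewrite hornerC mul1r -expR0 ler_expR oppr_le0 invr_ge0 ltW.
  by exists 1 => // x; rewrite -[leRHS]mul1r; apply: ler_pM.
have [M M0 hM] := bmax.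
pose I : \bar R := (\int[lebesgue_measure]_x (b0 x)%:E)%E.
have I0 : (0 <= I)%E by apply: integral_ge0 => x _; rewrite lee_fin.
have Ifin : (I < +oo)%E.
  apply: (@le_lt_trans _ _ (\int[lebesgue_measure]_(x in `[(- e)%R, e]) (cst M%:E x))%E).
    rewrite /I [leRHS]integral_mkcond; apply: ge0_le_integral => //.
    - by move=> x _; rewrite lee_fin.
    - exact/measurable_EFinP.
    - by apply/(measurable_restrictT _ (measurable_itv `[(- e)%R, e])); exact: measurable_cst.
    move=> x _; rewrite patchE mem_setE in_itv/= -ler_norml.
    by case: (leP `|x| e) => h; [rewrite lee_fin|rewrite bout// ltW].
  rewrite integral_cst//= lebesgue_measure_itv/=; case: ifP => _; rewrite -?EFinB -?EFinM ?mule0 ?ltry//.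
have Ipos : (0 < I)%E.
  rewrite lt_neqAle I0 andbT eq_sym; apply/eqP => I00.
  have hb : forall x : R, `|x| <= e / 2 -> expR (- (e / 2)^-1) * expR (- (e / 2)^-1) <= b0 x.
    move=> x; rewrite ler_norml => /andP[x1 x2]; rewrite /b0 /flat.
    have e20 : 0 < e / 2 by rewrite divr_gt0.
    have -> : 0 < e + 1 * x by lra.
    have -> : 0 < e + -1 * x by lra.
    rewrite !hornerC !mul1r; apply: ler_pM; rewrite ?expR_ge0//; rewrite ler_expR lerN2 lef_pV2 ?posrE//; lra.
  pose c := expR (- (e / 2)^-1) * expR (- (e / 2)^-1); rewrite -/c in hb.
  have c0 : 0 < c by rewrite mulr_gt0 ?expR_gt0.
  have : (\int[lebesgue_measure]_(x in `[(- (e / 2))%R, (e / 2)%R]) (cst c%:E x) <= I)%E.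
    rewrite /I [leLHS]integral_mkcond; apply: ge0_le_integral => //.
    - by move=> x _; apply: erestrict_ge0 => y _; rewrite /cst lee_fin ltW.
    - by apply/(measurable_restrictT _ (measurable_itv `[(- (e / 2))%R, e / 2])); exact: measurable_cst.
    - exact/measurable_EFinP.
    move=> x _; rewrite patchE mem_setE in_itv/= -ler_norml.
    by case: (leP `|x| (e / 2)) => h; rewrite /= lee_fin; [exact: hb|].
  rewrite I00 integral_cst//= lebesgue_measure_itv/= lte_fin.
  have -> : - (e / 2) < e / 2 by lra.
  by rewrite -EFinB -EFinM lee_fin leNgt mulr_gt0//; lra.
have If : I \is a fin_num by rewrite ge0_fin_numE.
have fI : 0 < fine I by rewrite fine_gt0// Ipos.
exists (fun x => (fine I)^-1 * b0 x); split.
- by move=> k; apply: SmM => //; exact: Sm_cst.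
- by move=> x; rewrite mulr_ge0// invr_ge0 ltW.
- by move=> x /bout ->; rewrite mulr0.
- under eq_integral do rewrite EFinM.
  rewrite ge0_integralZl//.
  + by rewrite -/I -(fineK If) -EFinM /= mulVf// gt_eqF.
  + exact/measurable_EFinP.
  + by move=> x _; rewrite lee_fin.
  + by rewrite lee_fin invr_ge0 ltW.
Qed.

Lemma is_derive_fst (f : R * R -> R) (x : R * R) (c : R) :
  is_derive x ((1, 0) : R * R) f c <-> is_derive x.1 1 (fun s => f (s, x.2)) c.
Proof.
have E : (fun h : R => h^-1 *: (f (h *: ((1, 0) : R * R) + x) - f x)) =
    (fun h : R => h^-1 *: (f (h *: (1 : R) + x.1, x.2) - f (x.1, x.2))).
  apply/funext => h; congr (_ *: (f _ - f _)); last by case: x.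
  by case: x => x1 x2; congr (_, _) => /=; rewrite /GRing.scale/= mulr0 add0r.
by split=> -[]; rewrite /derivable /derive ?E => d1 d2; apply: DeriveDef; rewrite /derivable /derive ?E.
Qed.

Lemma is_derive_snd (f : R * R -> R) (x : R * R) (c : R) :
  is_derive x ((0, 1) : R * R) f c <-> is_derive x.2 1 (fun s => f (x.1, s)) c.
Proof.
have E : (fun h : R => h^-1 *: (f (h *: ((0, 1) : R * R) + x) - f x)) =
    (fun h : R => h^-1 *: (f (x.1, h *: (1 : R) + x.2) - f (x.1, x.2))).
  apply/funext => h; congr (_ *: (f _ - f _)); last by case: x.
  by case: x => x1 x2; congr (_, _) => /=; rewrite /GRing.scale/= mulr0 add0r.
by split=> -[]; rewrite /derivable /derive ?E => d1 d2; apply: DeriveDef; rewrite /derivable /derive ?E.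
Qed.

Lemma Ck_prod k a b : Sm k a -> Sm k b -> Ck k (fun x : R * R => a x.1 * b x.2).
Proof.
elim: k a b => [|k IH] a b sa sb.
  split => // x; apply: cvgM.
    by apply: (continuous_comp (f := fst)); [exact: cvg_fst|exact: sa].
  by apply: (continuous_comp (f := snd)); [exact: cvg_snd|exact: sb].
have sa0 := SmS sa; have sb0 := SmS sb.
have ca := Sm_continuous sa; have cb := Sm_continuous sb.
case: sa sb => [a' [da sa]] [b' [db sb]].
have D1 x : is_derive x ((1, 0) : R * R) (fun x : R * R => a x.1 * b x.2) (a' x.1 * b x.2).
  apply/is_derive_fst => /=; have := da x.1 => ?; apply: is_derive_eq.
  by rewrite /GRing.scale/= mulr0 add0r mulrC.
have D2 x : is_derive x ((0, 1) : R * R) (fun x : R * R => a x.1 * b x.2) (a x.1 * b' x.2).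
  apply/is_derive_snd => /=; have := db x.2 => ?; apply: is_derive_eq.
  by [].
split.
  move=> x; apply: cvgM.
    by apply: (continuous_comp (f := fst)); [exact: cvg_fst|exact: ca].
  by apply: (continuous_comp (f := snd)); [exact: cvg_snd|exact: cb].
split.
- by move=> x; case: (D1 x).
- by move=> x; case: (D2 x).
- rewrite (_ : 'D_((1, 0) : R * R) _ = fun x : R * R => a' x.1 * b x.2); first exact: IH.
  by apply/funext => x; case: (D1 x).
- rewrite (_ : 'D_((0, 1) : R * R) _ = fun x : R * R => a x.1 * b' x.2); first exact: IH.
  by apply/funext => x; case: (D2 x).
Qed.

End smooth1.

(** * Mollifiers *)
Section kernel1.
Context {R : realType}.
Local Notation mu := (@lebesgue_measure R).

Lemma supp_bounded (g : R -> R) (e : R) : continuous g -> (forall x, e < `|x| -> g x = 0) ->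
  exists2 C, 0 <= C & forall x, `|g x| <= C.
Proof.
move=> cg gz.
have : compact (g @` `[- e, e]%classic).
  by apply: continuous_compact; [exact: continuous_subspaceT|exact: segment_compact].
move=> /compact_bounded[C [_ /(_ (`|C| + 1))]].
have -> : C < `|C| + 1 by apply: (le_lt_trans (ler_norm _)); rewrite ltrDl.
move=> /(_ isT) h; exists (`|C| + 1) => [|x]; first by rewrite addr_ge0.
have [xe|xe] := leP `|x| e; last by rewrite gz// normr0 addr_ge0.
by apply: h; exists x => //=; rewrite in_itv/= -ler_norml.
Qed.

Lemma deriv_supp (g g' : R -> R) (e : R) : (forall x : R, is_derive x 1 g (g' x)) ->
  (forall x, e < `|x| -> g x = 0) -> forall x, e < `|x| -> g' x = 0.
Proof.
move=> dg gz x ex; have dgx := dg x.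
have h : is_derive x 1 g 0.
  have cn : continuous (fun z : R => `|z|) by move=> z; apply: cvg_norm; exact: cvg_id.
  have hn : \forall y \near x, e < `|y| by exact: (cvgr_gt _ (cn x)).
  apply: (@near_eq_is_derive _ _ _ (cst (0 : R))).
  near=> y; rewrite gz//; by near: y.
by case: dgx => _ <-; case: h.
Unshelve. all: end_near. Qed.

Lemma deriv_lip (g g' : R -> R) (C : R) : (forall x : R, is_derive x 1 g (g' x)) ->
  (forall x, `|g' x| <= C) -> forall x y, `|g x - g y| <= C * `|x - y|.
Proof.
move=> dg gC.
have cg := derive_continuous dg.
have main x y : x < y -> `|g y - g x| <= C * `|y - x|.
  move=> xy; have [|z _ ->] := @MVT R g g' x y xy.
  - exact: continuous_subspaceT.
  - by rewrite normrM ler_wpM2r.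
move=> x y; have [xy|yx|->] := ltgtP x y.
- by rewrite distrC (distrC x); exact: main.
- exact: main.
- by rewrite !subrr !normr0 mulr0.
Qed.

Lemma integral_shift (g : R -> R) (c : R) : continuous g -> (forall x, 0 <= g x) ->
  (\int[mu]_x (g (x - c))%:E = \int[mu]_x (g x)%:E)%E.
Proof.
move=> cg g0; pose F (x : R) : R := x - c.
have dF (x : R) : is_derive x 1 F 1.
  by rewrite /F; apply: is_derive_eq; rewrite subr0.
have F' : F^`()%classic = cst 1.
  by apply/funext => x; rewrite derive1E; case: (dF x).
rewrite [RHS](@increasing_ge0_integration_by_substitutionT R F g) ?F'//.
- by apply: eq_integral => x _ /=; rewrite mulr1.
- by move=> x y xy; rewrite /F ltrD2r.
- by move=> x; exact: cvg_cst.
- exact: is_cvg_cst.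
- exact: is_cvg_cst.
- apply/cvgrNyPle => A; exists (A + c); split; first exact: num_real.
  by move=> x xA; rewrite /F lerBlDr ltW.
- apply/cvgryPge => A; exists (A + c); split; first exact: num_real.
  by move=> x xA; rewrite /F lerBrDr ltW.
Qed.

(** One constant for all the bounds: the estimates below never depend on its
    value, only on e. *)
Record mollifier (e : R) (b b1 : R -> R) (C : R) : Prop := Mollifier {
  moll_Sm : forall k, Sm k b;
  moll_ge0 : forall x, 0 <= b x;
  moll_out : forall x, e < `|x| -> b x = 0;
  moll_int : (\int[mu]_x (b x)%:E = 1)%E;
  moll_der : forall x : R, is_derive x 1 b (b1 x);
  moll_C : 0 <= C;
  moll_b : forall x, `|b x| <= C;
  moll_b1 : forall x, `|b1 x| <= C;
  moll_lip : forall x y, `|b x - b y| <= C * `|x - y|;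
  moll_lip1 : forall x y, `|b1 x - b1 y| <= C * `|x - y| }.

Lemma mollifier_exists (e : R) : 0 < e -> exists b b1 C, mollifier e b b1 C.
Proof.
move=> e0; have [b [sb b0 bout ib]] := bump_exists e0.
have bout' x : e < `|x| -> b x = 0 by move=> ?; apply: bout; exact: ltW.
(* The second derivative serves only to bound the Lipschitz constant of the first. *)
have [b1 [db [b2 [db1 cb2]]]] : Sm 2 b by [].
have b1out := deriv_supp db bout'; have b2out := deriv_supp db1 b1out.
have [C0 C00 hC0] := supp_bounded (derive_continuous db) bout'.
have [C1 C10 hC1] := supp_bounded (derive_continuous db1) b1out.
have [C2 C20 hC2] := supp_bounded cb2 b2out.
exists b, b1, (C0 + C1 + C2); split => //.
- by rewrite !addr_ge0.
- by move=> x; have := hC0 x; lra.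
- by move=> x; have := hC1 x; lra.
- move=> x y; apply: (le_trans (deriv_lip db hC1 x y)); rewrite ler_wpM2r//; lra.
- move=> x y; apply: (le_trans (deriv_lip db1 hC2 x y)); rewrite ler_wpM2r//; lra.
Qed.
End kernel1.

Section kernel2.
Context {R : realType}.
Local Notation mu := (@lebesgue_measure R).
Local Notation leb2 := (@lebesgue2 R).

(** Product kernels reduce smoothness and the unit integral to one variable, and
    their partial derivatives are again product kernels. *)
Definition tens (a c : R -> R) (z : R * R) : R := a z.1 * c z.2.

Lemma tens_lip (a c : R -> R) (C : R) : (forall x, `|a x| <= C) -> (forall x, `|c x| <= C) ->
  (forall x y, `|a x - a y| <= C * `|x - y|) -> (forall x y, `|c x - c y| <= C * `|x - y|) ->
  lip (tens a c) (C * C).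
Proof.
move=> ha hc la lc x y; rewrite /tens.
have -> : a x.1 * c x.2 - a y.1 * c y.2 = a x.1 * (c x.2 - c y.2) + c y.2 * (a x.1 - a y.1) by ring.
apply: (le_trans (ler_normD _ _)); rewrite !normrM mulrDr addrC -!mulrA.
by apply: lerD; apply: ler_pM.
Qed.

Lemma tens_bound (a c : R -> R) (C : R) : (forall x, `|a x| <= C) -> (forall x, `|c x| <= C) ->
  forall z, `|tens a c z| <= C * C.
Proof. by move=> ha hc z; rewrite /tens normrM; apply: ler_pM. Qed.

Lemma lip_rev (k : R * R -> R) (L : R) (x : R * R) : lip k L -> lip (fun y => k (x - y)) L.
Proof.
move=> lk y z; apply: (le_trans (lk _ _)) => /=.
rewrite (_ : x.1 - y.1 - (x.1 - z.1) = z.1 - y.1); last by ring.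
rewrite (_ : x.2 - y.2 - (x.2 - z.2) = z.2 - y.2); last by ring.
by rewrite (distrC z.1) (distrC z.2).
Qed.

Lemma lip_shift (k : R * R -> R) (L : R) (y : R * R) : lip k L -> lip (fun x => k (x - y)) L.
Proof.
move=> lk x z; apply: (le_trans (lk _ _)) => /=.
rewrite (_ : x.1 - y.1 - (z.1 - y.1) = x.1 - z.1); last by ring.
by rewrite (_ : x.2 - y.2 - (z.2 - y.2) = x.2 - z.2); last by ring.
Qed.

Variables (e : R) (b b1 : R -> R) (C : R).
Hypothesis mb : mollifier e b b1 C.

Lemma tens_integral (y : R * R) : (\int[leb2]_x (tens b b (x - y))%:E = 1)%E.
Proof.
case: mb => sb b0 _ ib _ _ _ _ _ _.
have cb := Sm_continuous (sb 0%N).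
have mbb := continuous_measurable_fun cb.
have ms (c : R) : measurable_fun setT (fun s : R => b (s - c)).
  apply: (measurableT_comp mbb); apply: continuous_measurable_fun.
  by move=> s; apply: cvgB; [exact: cvg_id|exact: cvg_cst].
apply: etrans (fubini_tonelli1 (m1 := mu) (m2 := mu) (fun x : mplane R => (tens b b (x - y))%:E) _ _) _.
- apply/measurable_EFinP; apply: measurable_funM.
    by apply: (measurableT_comp (ms y.1)).
  by apply: (measurableT_comp (ms y.2)).
- by move=> x; rewrite lee_fin mulr_ge0.
rewrite /fubini_F/= -[RHS]ib -(integral_shift y.1 cb b0).
apply: eq_integral => s _; rewrite /tens/=.
under eq_integral do rewrite EFinM.
rewrite ge0_integralZl//.
- by rewrite (integral_shift y.2 cb b0) ib mule1.
- by apply/measurable_EFinP; exact: ms.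
- by move=> t _; rewrite lee_fin.
- by rewrite lee_fin.
Qed.

Lemma tens_mass_le1 (A : set (R * R)) B (y : R * R) : measurable (A : set (mplane R)) -> bnd A B ->
  \int[leb2]_(x in A) tens b b (x - y) <= 1.
Proof.
move=> mA bA; case: (mb) => _ b0 _ _ _ _ hb _ lb _.
have lk := lip_shift y (tens_lip hb hb lb lb).
rewrite -lee_fin /Rintegral fineK; last first.
  by apply: integrable_fin_num => //; exact: continuous_integrable mA bA (lip_continuous lk).
rewrite -(tens_integral y); apply: ge0_subset_integral => //.
  by apply/measurable_EFinP; exact: measurable_lip lk.
by move=> x _; rewrite lee_fin mulr_ge0.
Qed.

Lemma tens_out (z : R * R) : e < `|z.1| \/ e < `|z.2| -> tens b b z = 0.
Proof. by rewrite /tens => -[] /(moll_out mb) ->; rewrite ?mul0r ?mulr0. Qed.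

(** As a function of y, the kernel centred at x is an admissible test function
    when x is deep enough inside the domain. This is how the weak gradient becomes
    the gradient of the mollified function. *)
Lemma test_kernel (Om : set (R * R)) (x : R * R) :
  (forall y, `|x.1 - y.1| <= e -> `|x.2 - y.2| <= e -> Om y) ->
  test_function Om (fun y => tens b b (x - y)).
Proof.
move=> h.
pose Q : set (R * R) := `[x.1 - e, x.1 + e]%classic `*` `[x.2 - e, x.2 + e]%classic.
have cQ : compact Q by apply: compact_setX; exact: segment_compact.
have clQ : closed Q by apply: compact_closed => //; exact: norm_hausdorff.
have sQ : closure [set y | tens b b (x - y) != 0] `<=` Q.
  rewrite [X in _ `<=` X]((closure_id Q).1 clQ); apply: closureS => y /= hy.
  have n1 : `|x.1 - y.1| <= e by rewrite leNgt; apply: contraNN hy => ?; apply/eqP/tens_out; left.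
  have n2 : `|x.2 - y.2| <= e by rewrite leNgt; apply: contraNN hy => ?; apply/eqP/tens_out; right.
  move: n1 n2; rewrite !ler_norml => /andP[? ?] /andP[? ?].
  by split; rewrite /= in_itv/=; apply/andP; split; lra.
split.
- move=> k; have := Ck_prod (Sm_affine x.1 (-1) (moll_Sm mb k)) (Sm_affine x.2 (-1) (moll_Sm mb k)).
  rewrite (_ : (fun y : R * R => _) = (fun y => tens b b (x - y)))//.
  by apply/funext => y; rewrite /tens/= !mulN1r.
- exact: subclosed_compact (@closed_closure _ _) cQ sQ.
- move=> y /sQ[]; rewrite /= !in_itv/= => /andP[? ?] /andP[? ?].
  by apply: h; rewrite ler_norml; apply/andP; split; lra.
Qed.

Lemma test_kernel_derive (x y : R * R) :
  'D_((1, 0) : R * R) (fun y => tens b b (x - y)) y = - tens b1 b (x - y) /\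
  'D_((0, 1) : R * R) (fun y => tens b b (x - y)) y = - tens b b1 (x - y).
Proof.
have db (c s : R) : is_derive s 1 (fun t => b (c - t)) (- b1 (c - s)).
  have -> : - b1 (c - s) = b1 (c - s) * (-1) by rewrite mulrN1.
  apply: (is_derive1_comp (g := fun t => c - t) (moll_der mb _)).
  rewrite (_ : (fun t : R => c - t) = (fun t => c + (-1) * t)); first exact: is_derive_affine.
  by apply/funext => t; rewrite mulN1r.
split; apply: derive_val.
  apply/is_derive_fst; rewrite /tens/=; have := db x.1 y.1 => ?; apply: is_derive_eq.
  by rewrite /GRing.scale/= mulr0 add0r mulrC mulNr.
apply/is_derive_snd; rewrite /tens/=; have := db x.2 y.2 => ?; apply: is_derive_eq.
by rewrite /GRing.scale/= mulrN.
Qed.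

End kernel2.

(** * Mollification of integrable functions *)
Section int_mul.
Lemma int_mul d (T : measurableType d) (R : realType) (nu : {measure set T -> \bar R})
  (D : set T) (u g : T -> R) (C : R) : measurable D ->
  nu.-integrable D (EFin \o u) -> measurable_fun D g -> (forall x, D x -> `|g x| <= C) ->
  nu.-integrable D (EFin \o (fun x => u x * g x)).
Proof.
move=> mD iu mg gC.
have mu := measurable_int _ iu.
have iCu : nu.-integrable D (fun x => (`|C|%:E * (EFin \o u) x)%E) by exact: integrableZl.
apply: (le_integrable mD _ _ iCu).
  by apply/measurable_EFinP; apply: measurable_funM => //; exact/measurable_EFinP.
move=> x Dx; rewrite /= lee_fin !normrM normr_id mulrC ler_wpM2r//.
exact: le_trans (gC _ Dx) (ler_norm _).
Qed.

Lemma integral_EFin d (T : measurableType d) (R : realType) (nu : {measure set T -> \bar R})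
  (D : set T) (h : T -> R) : measurable D -> nu.-integrable D (EFin \o h) ->
  (\int[nu]_x ((h \_ D) x)%:E = (\int[nu]_(x in D) h x)%:E)%E.
Proof.
move=> mD ih; rewrite /Rintegral fineK; last exact: integrable_fin_num.
rewrite [RHS]integral_mkcond; apply: eq_integral => x _.
by rewrite !patchE; case: ifP.
Qed.
End int_mul.

Section area.
Context {R : realType}.
(** The planar Lebesgue measure under a name that carries its sigma-finiteness,
    so that it can be a factor of a product measure. *)
Definition leb2s : set (mplane R) -> \bar R := @lebesgue2 R.
HB.instance Definition _ := Measure.copy leb2s (@lebesgue2 R).

Lemma leb2s_sigma_finite : sigma_finite setT leb2s.
Proof.
exists (fun n => box 0 n%:R).
  apply/seteqP; split => // x _; exists (Num.bound (`|x.1| + `|x.2|)) => //.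
  have h : `|x.1| + `|x.2| < (Num.bound (`|x.1| + `|x.2|))%:R by apply: archi_boundP; exact: addr_ge0.
  by split; rewrite /= subr0; apply: le_lt_trans h; rewrite ?lerDl ?lerDr.
move=> n; split; first exact: measurable_box.
apply: (@bnd_fin R _ n%:R); first exact: measurable_box.
by move=> x [h1 h2]; move: h1 h2; rewrite /= !subr0 => /ltW ? /ltW.
Qed.

HB.instance Definition _ := Measure_isSigmaFinite.Build _ _ _ leb2s leb2s_sigma_finite.
End area.

Section mollification.
Context {R : realType}.
Local Notation mu := (@lebesgue_measure R).
Local Notation leb2 := (@lebesgue2 R).


(** Fubini for convolution. One side is Lebesgue measure; the other is Lebesgue
    measure when a function is mollified, and a part of the gradient when a
    measure is. *)
Lemma swap_int (nu : {sigma_finite_measure set (mplane R) -> \bar R}) (A Om : set (R * R))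
    (p u k : R * R -> R) (P L M : R) :
  measurable (A : set (mplane R)) -> measurable (Om : set (mplane R)) ->
  (leb2 A < +oo)%E -> measurable_fun setT (p : mplane R -> R) -> (forall x, A x -> `|p x| <= P) ->
  nu.-integrable Om (EFin \o u) -> lip k L -> (forall z, `|k z| <= M) ->
  \int[leb2]_(x in A) (p x * \int[nu]_(y in Om) (u y * k (x - y))) =
  \int[nu]_(y in Om) (u y * \int[leb2]_(x in A) (p x * k (x - y))).
Proof.
move=> mA mO Afin mp pP iu lk kM.
have mk := measurable_lip lk.
have mkx (x : R * R) : measurable_fun setT (fun y : mplane R => k (x - y)).
  exact: measurable_lip (lip_rev x lk).
have mky (y : R * R) : measurable_fun setT (fun x : mplane R => k (x - y)).
  exact: measurable_lip (lip_shift y lk).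
have ip : leb2.-integrable A (EFin \o p).
  apply: measurable_bounded_integrable => //; first exact: measurable_funS mp.
  by exists P; split => [|z Pz]; [exact: num_real|move=> x /pP h; exact: le_trans h (ltW Pz)].
have iuk x : nu.-integrable Om (EFin \o (fun y => u y * k (x - y))).
  by apply: (int_mul mO iu (C := M)) => //; exact: measurable_funS (mkx x).
have ipk y : leb2.-integrable A (EFin \o (fun x => p x * k (x - y))).
  by apply: (int_mul mA ip (C := M)) => //; exact: measurable_funS (mky y).
pose pA := p \_ A; pose uO := u \_ Om.
have mpA : measurable_fun setT (pA : mplane R -> R).
  by apply/(measurable_restrictT _ mA); exact: measurable_funS mp.
have muO : measurable_fun setT (uO : mplane R -> R).
  apply/(measurable_restrictT _ mO); apply/measurable_EFinP; exact: measurable_int iu.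
pose g (z : mplane R * mplane R) : \bar R := (pA z.1 * (uO z.2 * k (z.1 - z.2)))%:E.
have mg : measurable_fun setT g.
  apply/measurable_EFinP; apply: measurable_funM; first exact: (measurableT_comp mpA).
  apply: measurable_funM; first exact: (measurableT_comp muO).
  apply: (measurableT_comp mk (g := fun z : mplane R * mplane R => (z.1.1 - z.2.1, z.1.2 - z.2.2))).
  apply: measurable_fun_pair; apply: measurable_funB;
    by repeat first [exact: measurable_fst | exact: measurable_snd | apply: measurableT_comp].
have E1 x : (\int[nu]_y g (x, y) = (pA x * \int[nu]_(y in Om) (u y * k (x - y)))%:E)%E.
  rewrite -RintegralZl// -integral_EFin//; last exact: (@integrableZl _ _ _ nu Om mO (pA x) _ (iuk x)).
  apply: eq_integral => y _; rewrite /g /uO !patchE/=; case: ifP => //.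
  by rewrite mul0r mulr0.
have E2 y : (\int[leb2]_x g (x, y) = (uO y * \int[leb2]_(x in A) (p x * k (x - y)))%:E)%E.
  rewrite -RintegralZl// -integral_EFin//; last exact: (@integrableZl _ _ _ leb2 A mA (uO y) _ (ipk y)).
  apply: eq_integral => x _; rewrite /g /pA !patchE/=; case: ifP => //.
    by rewrite mulrCA.
  by rewrite mul0r.
have hfin : (\int[leb2s]_x \int[nu]_y `|g (x, y)| < +oo)%E.
  pose I := \int[nu]_(y in Om) `|u y|.
  have inu : nu.-integrable Om (EFin \o (fun y => `|u y|)) by exact: integrable_abse iu.
  apply: (@le_lt_trans _ _ (\int[leb2]_(x in A) (`|P| * (`|M| * I))%:E)%E); last first.
    by rewrite integral_cst//; apply: lte_mul_pinfty => //; rewrite lee_fin !mulr_ge0// Rintegral_ge0.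
  rewrite [leRHS]integral_mkcond.
  apply: ge0_le_integral => //.
  - by move=> x _; apply: integral_ge0.
  - apply: (@measurable_fun_fubini_tonelli_F _ _ (mplane R) (mplane R) R nu (fun z => `|g z|%E)) => //.
    exact: measurableT_comp.
  - by apply/(measurable_restrictT _ mA); exact: measurable_cst.
  move=> x _; rewrite patchE; case: ifPn => [|xA]; last first.
    rewrite integral0_eq// => y _; rewrite /g /pA patchE (negbTE xA) mul0r abse0//.
  rewrite inE => Ax.
  apply: (@le_trans _ _ (\int[nu]_y (((fun y => `|P| * (`|M| * `|u y|)) \_ Om) y)%:E)%E).
    apply: ge0_le_integral => //.
    - by apply: measurableT_comp => //; apply: (measurableT_comp mg (g := fun y => (x, y))); exact: measurable_fun_pair.
    - apply/measurable_EFinP; apply/(measurable_restrictT _ mO).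
      apply: measurable_funM; first exact: measurable_cst.
      apply: measurable_funM; first exact: measurable_cst.
      apply/measurable_EFinP; exact: measurable_int inu.
    have pAx : pA x = p x by rewrite /pA patchE mem_set.
    move=> y _; rewrite /g /= pAx /uO !patchE; case: ifP => _; last by rewrite mul0r mulr0 normr0.
    rewrite lee_fin !normrM; apply: ler_pM => //; first exact: le_trans (pP _ Ax) (ler_norm _).
    by rewrite mulrC; apply: ler_pM => //; exact: le_trans (kM _) (ler_norm _).
  have iM : nu.-integrable Om (EFin \o (fun y => `|M| * `|u y|)) by exact: (@integrableZl _ _ _ nu Om mO `|M| _ inu).
  rewrite integral_EFin//; last exact: (@integrableZl _ _ _ nu Om mO `|P| _ iM).
  by rewrite RintegralZl// RintegralZl.
have ig := proj2 (integrable12ltyP leb2s nu mg) hfin.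
have HL : \int[leb2]_(x in A) (p x * \int[nu]_(y in Om) (u y * k (x - y))) =
    fine (\int[leb2]_x \int[nu]_y g (x, y))%E.
  rewrite [LHS]Rintegral_mkcond; apply: (congr1 fine); apply: eq_integral => x _.
  rewrite E1 /pA !patchE; case: (x \in A) => //.
  by rewrite mul0r.
have HR : \int[nu]_(y in Om) (u y * \int[leb2]_(x in A) (p x * k (x - y))) =
    fine (\int[nu]_y \int[leb2]_x g (x, y))%E.
  rewrite [LHS]Rintegral_mkcond; apply: (congr1 fine); apply: eq_integral => y _.
  rewrite E2 /uO !patchE; case: (y \in Om) => //.
  by rewrite mul0r.
rewrite HL HR; apply: (congr1 fine).
exact: (Fubini (m1 := leb2s) (m2 := nu) ig).
Qed.

Variables (Om : set (R * R)) (f : R * R -> R).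
Hypothesis mO : measurable (Om : set (mplane R)).
Hypothesis intf : leb2.-integrable Om (EFin \o f).

Definition mollify (k : R * R -> R) (x : R * R) : R := \int[leb2]_(y in Om) (f y * k (x - y)).
Definition L1norm : R := \int[leb2]_(y in Om) `|f y|.

Lemma mollify_int (k : R * R -> R) (L M : R) x : lip k L -> (forall z, `|k z| <= M) ->
  leb2.-integrable Om (EFin \o (fun y => f y * k (x - y))).
Proof.
move=> lk kM; apply: (int_mul mO intf (C := M)) => //.
exact: measurable_funS (measurable_lip (lip_rev x lk)).
Qed.

Lemma L1norm_ge0 : 0 <= L1norm. Proof. exact: Rintegral_ge0. Qed.

Lemma mollify_lip (k : R * R -> R) (L M : R) : lip k L -> (forall z, `|k z| <= M) ->
  lip (mollify k) (L * L1norm).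
Proof.
move=> lk kM x z; rewrite /mollify -RintegralB//; try exact: mollify_int lk kM.
have inf : leb2.-integrable Om (EFin \o (fun y => `|f y|)) by exact: integrable_abse intf.
have i1 : leb2.-integrable Om (EFin \o (fun y => f y * k (x - y) - f y * k (z - y))).
  by have := integrableB mO (mollify_int x lk kM) (mollify_int z lk kM).
apply: (le_trans (le_normr_Rintegral mO i1)).
rewrite -mulrA [_ * (_ + _)]mulrC mulrA -RintegralZl//.
apply: le_Rintegral => //.
- exact: integrable_abse i1.
- exact: (@integrableZl _ _ _ leb2 Om mO (L * (`|x.1 - z.1| + `|x.2 - z.2|)) _ inf).
- by move=> y _; rewrite -mulrBr normrM mulrC ler_wpM2r//; exact: (lip_shift y lk).
Qed.

Variables (e : R) (b b1 : R -> R) (C : R).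
Hypothesis mb : mollifier e b b1 C.

(** Differentiation under the integral along an arbitrary line, the form in
    which [smooth_poincare] takes its gradient. *)
Lemma mollify_derive (p v : R * R) (s : R) :
  is_derive s 1 (fun s => mollify (tens b b) (p.1 + s * v.1, p.2 + s * v.2))
    (v.1 * mollify (tens b1 b) (p.1 + s * v.1, p.2 + s * v.2) +
     v.2 * mollify (tens b b1) (p.1 + s * v.1, p.2 + s * v.2)).
Proof.
case: (mb) => _ _ _ _ db C0 hb hb1 lb lb1.
pose z (s : R) : R * R := (p.1 + s * v.1, p.2 + s * v.2).
have lt := tens_lip hb hb lb lb; have lt1 := tens_lip hb1 hb lb1 lb; have lt2 := tens_lip hb hb1 lb lb1.
have bt := tens_bound hb hb; have bt1 := tens_bound hb1 hb; have bt2 := tens_bound hb hb1.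
pose F (s : R) (y : mplane R) : R := f y * tens b b (z s - y).
have dF (t : R) y : is_derive t 1 (F ^~ y) (f y * (v.1 * tens b1 b (z t - y) + v.2 * tens b b1 (z t - y))).
  have d1 (c w : R) (r : R) : is_derive t 1 (fun t => b (c + t * w - r)) (b1 (c + t * w - r) * w).
    apply: (is_derive1_comp (g := fun t => c + t * w - r) (db _)).
    rewrite (_ : (fun t : R => _) = (fun t => (c - r) + w * t)); first exact: is_derive_affine.
    by apply/funext => t'; ring.
  have h1 := d1 p.1 v.1 y.1; have h2 := d1 p.2 v.2 y.2.
  rewrite /F /tens/=; apply: is_derive_eq; rewrite /GRing.scale/=; ring.
have D1 t y : partial1of2 F t y = f y * (v.1 * tens b1 b (z t - y) + v.2 * tens b b1 (z t - y)).
  by rewrite partial1of2E; case: (dF t y).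
have Isu : `](s - 1), (s + 1)[%classic s by rewrite /= in_itv/=; apply/andP; split; lra.
have i1 t := mollify_int (z t) lt bt.
pose Gb := (`|v.1| + `|v.2|) * (C * C).
have inf : leb2.-integrable Om (EFin \o (fun y => `|f y|)) by exact: integrable_abse intf.
have iG : leb2.-integrable Om (EFin \o (fun y => Gb * `|f y|)).
  exact: (@integrableZl _ _ _ leb2 Om mO Gb _ inf).
have hG (t : R) y : `](s - 1), (s + 1)[%classic t -> Om y -> `|partial1of2 F t y| <= Gb * `|f y|.
  move=> _ _; rewrite D1 normrM mulrC ler_wpM2r// /Gb (le_trans (ler_normD _ _))// mulrDl.
  by rewrite (normrM v.1) (normrM v.2); apply: lerD; apply: ler_wpM2l.
have dvb (t : R) y : `](s - 1), (s + 1)[%classic t -> Om y -> derivable (F ^~ y) t 1.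
  by move=> _ _; case: (dF t y).
have G0 (y : mplane R) : 0 <= Gb * `|f y| by rewrite !mulr_ge0// addr_ge0.
have i1' (t : R) : `](s - 1), (s + 1)[%classic t -> leb2.-integrable Om (EFin \o F t) by move=> _; exact: i1.
have der := @derivable_under_integral R _ (mplane R) leb2 F Om mO s (s - 1) (s + 1) Isu i1' dvb _ G0 iG hG.
have val := @differentiation_under_integral R _ (mplane R) leb2 F Om mO s (s - 1) (s + 1) Isu i1' dvb _ G0 iG hG.
apply: DeriveDef; first exact: der.
rewrite -derive1E; apply: etrans val _.
have ic1 := mollify_int (z s) lt1 bt1; have ic2 := mollify_int (z s) lt2 bt2.
rewrite /mollify -RintegralZl// -RintegralZl// -RintegralD//; first last.
- exact: (@integrableZl _ _ _ leb2 Om mO v.2 _ ic2).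
- exact: (@integrableZl _ _ _ leb2 Om mO v.1 _ ic1).
by apply: eq_Rintegral => y _; rewrite D1 /=; ring.
Qed.

End mollification.

(** * Total variation by duality *)
Section dual.
Context {R : realType}.
Local Notation leb2 := (@lebesgue2 R).
Local Notation fmeas := ({finite_measure set (mplane R) -> \bar R}).

Lemma finite_bounded_integrable (nu : fmeas) (D : set (mplane R)) (q : R * R -> R) (C : R) :
  measurable D -> measurable_fun setT (q : mplane R -> R) -> (forall y, D y -> `|q y| <= C) ->
  nu.-integrable D (EFin \o q).
Proof.
move=> mD mq qC; apply: measurable_bounded_integrable => //.
- by rewrite -ge0_fin_numE//; exact: fin_num_measure.
- exact: measurable_funS mq.
- by exists C; split => [|z Cz]; [exact: num_real|move=> x /qC h; exact: le_trans h (ltW Cz)].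
Qed.

Lemma step_bound (nu : fmeas) (E : nat -> set (mplane R)) (q : R * R -> R) (c : nat -> R) (C d : R) n :
  (forall k, measurable (E k)) -> trivIset setT E -> measurable_fun setT (q : mplane R -> R) ->
  (forall k y, E k y -> `|q y| <= C) -> (forall k y, E k y -> `|q y - c k| <= d) ->
  `|\int[nu]_(y in \big[setU/set0]_(k < n) E k) q y - \sum_(k < n) c k * fine (nu (E k))| <=
   d * fine (nu (\big[setU/set0]_(k < n) E k)).
Proof.
move=> mE tE mq qC qd; elim: n => [|n IH].
  by rewrite !big_ord0 Rintegral_set0 subr0 normr0 measure0 mulr0.
rewrite !big_ord_recr/=.
set U := \big[setU/set0]_(k < n) E k in IH *.
have mU : measurable U by exact: bigsetU_measurable.
have UE y : U y -> exists k, E k y.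
  by rewrite /U -bigcup_mkord => -[k _ Eky]; exists k.
have dis : [disjoint U & E n].
  apply/disj_setPS => y []; rewrite /U -bigcup_mkord => -[k /= kn Eky] Eny.
  have := trivIsetP.1 tE k n I I; rewrite neq_ltn kn => /(_ isT) h.
  by have : (E k `&` E n) y by []; rewrite h.
have int D : measurable D -> D `<=` U `|` E n -> nu.-integrable D (EFin \o q).
  move=> mD DU; apply: (@finite_bounded_integrable nu D q C) => // y /DU[/UE[k]|]; exact: qC.
rewrite Rintegral_setU//; last by apply: int => //; exact: measurableU.
rewrite measureU//; last by apply/seteqP; split => //; exact/disj_setPS.
have finU D : measurable D -> nu D \is a fin_num by exact: fin_num_measure.
rewrite fineD ?finU// mulrDr.
have h : `|\int[nu]_(y in E n) q y - c n * fine (nu (E n))| <= d * fine (nu (E n)).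
  have iq := int _ (mE n) (@subsetUr _ _ _).
  have icst (r : R) : nu.-integrable (E n) (EFin \o (fun=> r)).
    by apply: (@finite_bounded_integrable nu (E n) _ `|r|) => //; exact: measurable_cst.
  rewrite -Rintegral_cst// -RintegralB//.
  have iB : nu.-integrable (E n) (EFin \o (fun y => q y - c n)).
    by have := integrableB (mE n) iq (icst (c n)).
  apply: (le_trans (le_normr_Rintegral (mE n) iB)).
  rewrite -Rintegral_cst//; apply: le_Rintegral => //; first exact: integrable_abse iB.
  by move=> y; exact: qd.
set I1 := Rintegral _ _ _ in IH *; set I2 := Rintegral _ _ _ in h *.
set S := (\sum_(k < n) _) in IH *.
rewrite (_ : I1 + I2 - _ = (I1 - S) + (I2 - c n * fine (nu (E n)))); last by ring.
by apply: (le_trans (ler_normD _ _)); exact: lerD.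
Qed.

Lemma kern_lip (nu : fmeas) (Om : set (R * R)) (k : R * R -> R) (L M : R) :
  measurable (Om : set (mplane R)) -> lip k L -> (forall z, `|k z| <= M) ->
  lip (fun x => \int[nu]_(y in Om) k (x - y)) (L * fine (nu Om)).
Proof.
move=> mO lk kM x z.
have ik w : nu.-integrable Om (EFin \o (fun y => k (w - y))).
  by apply: (@finite_bounded_integrable nu Om _ M) => //; exact: measurable_lip (lip_rev w lk).
rewrite -RintegralB//.
have iB : nu.-integrable Om (EFin \o (fun y => k (x - y) - k (z - y))).
  by have := integrableB mO (ik x) (ik z).
apply: (le_trans (le_normr_Rintegral mO iB)).
rewrite mulrAC -Rintegral_cst//; apply: le_Rintegral => //.
- exact: integrable_abse iB.
- by apply: (@finite_bounded_integrable nu Om _ (`|L * (`|x.1 - z.1| + `|x.2 - z.2|)|)).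
- by move=> y _; exact: (lip_shift y lk).
Qed.

(* The i-th component of the vector measure is the difference of a_i and c_i. *)
Variables (a1 c1 a2 c2 : fmeas) (Om : set (R * R)) (V : R).
Hypothesis mO : measurable (Om : set (mplane R)).
Hypothesis var : forall E : nat -> set (mplane R), (forall k, measurable (E k)) ->
  trivIset setT E -> \bigcup_k E k = Om -> forall n,
  \sum_(k < n) enorm (fine (a1 (E k)) - fine (c1 (E k)), fine (a2 (E k)) - fine (c2 (E k))) <= V.

(** Cut Om into pieces on which (q1, q2) is constant up to d, equal to a vector
    of norm at most 1. On each piece the pairing is, up to d times the masses, a
    scalar product with the vector of masses, so Cauchy-Schwarz and [var] bound
    the sum by V. *)
Lemma dual_bound (q1 q2 : R * R -> R) :
  measurable_fun setT (q1 : mplane R -> R) -> measurable_fun setT (q2 : mplane R -> R) ->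
  (forall y, Om y -> enorm (q1 y, q2 y) <= 1) ->
  (\int[a1]_(y in Om) q1 y - \int[c1]_(y in Om) q1 y) +
  (\int[a2]_(y in Om) q2 y - \int[c2]_(y in Om) q2 y) <= V.
Proof.
move=> m1 m2 q1e; apply/ler_addgt0Pr => e e0.
pose M := fine (a1 Om) + fine (c1 Om) + fine (a2 Om) + fine (c2 Om).
have M0 : 0 <= M by rewrite !addr_ge0// fine_ge0.
pose d := e / (M + 1).
have d0 : 0 < d by rewrite divr_gt0// ltr_wpDl.
have dM : d * M <= e.
  rewrite /d mulrAC ler_pdivrMr ?ltr_wpDl// ler_wpM2l ?ltW//; lra.
have hq1 y : Om y -> `|q1 y| <= 1 by move=> /q1e; apply: le_trans; exact: (@enorm_ge1 _ (_, _)).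
have hq2 y : Om y -> `|q2 y| <= 1 by move=> /q1e; apply: le_trans; exact: (@enorm_ge2 _ (_, _)).
pose T (i : nat) (q : R * R -> R) : set (mplane R) := [set y | i%:R * d <= q y + 2 < i.+1%:R * d].
have mT i q : measurable_fun setT (q : mplane R -> R) -> measurable (T i q).
  move=> mq; have := mq measurableT _ (measurable_itv `[(i%:R * d - 2), (i.+1%:R * d - 2)[).
  rewrite setTI; congr (measurable _); apply/seteqP; split => y; rewrite /T/= in_itv/= lerBlDr ltrBrDr//.
have Tex q y : `|q y| <= 1 -> T (Num.truncn ((q y + 2) / d)) q y.
  rewrite ler_norml => /andP[h1 h2].
  have h0 : 0 <= (q y + 2) / d by rewrite divr_ge0 ?ltW//; lra.
  have /andP[t1 t2] := truncn_itv h0.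
  by rewrite /T/= -ler_pdivlMr// -ltr_pdivrMr// t1 t2.
have Tun i j q y : T i q y -> T j q y -> i = j.
  move=> /= /andP[x1 x2] /andP[y1 y2].
  have := le_lt_trans x1 y2; have := le_lt_trans y1 x2.
  rewrite !ltr_pM2r// !ltr_nat !ltnS => h1 h2; apply/eqP; rewrite eqn_leq h1 h2//.
(* The pieces are indexed by pairs of levels, encoded in nat; integers that do
   not code a pair give the empty set. *)
pose E (k : nat) : set (mplane R) :=
  if unpickle k is Some (i, j) then if pickle (i, j) == k then Om `&` T i q1 `&` T j q2 else set0 else set0.
have EP k y : E k y -> exists i j, [/\ k = pickle (i, j), Om y, T i q1 y & T j q2 y].
  rewrite /E; case: (unpickle k) => [[i j]|//]; case: eqP => // <- [[Oy Ti] Tj].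
  by exists i, j.
have PE i j y : Om y -> T i q1 y -> T j q2 y -> E (pickle (i, j)) y.
  by move=> Oy Ti Tj; rewrite /E pickleK eqxx; split.
have mE k : measurable (E k).
  rewrite /E; case: (unpickle k) => [[i j]|//]; case: eqP => // _.
  by apply: measurableI; [apply: measurableI => //; exact: mT|exact: mT].
have tE : trivIset setT E.
  apply/trivIsetP => k l _ _; apply: contraNeq => /set0P[y [/EP[i [j [-> _ Ti Tj]]] /EP[i' [j' [-> _ Ti' Tj']]]]].
  by rewrite (Tun _ _ _ _ Ti Ti') (Tun _ _ _ _ Tj Tj').
have UE : \bigcup_k E k = Om.
  apply/seteqP; split => [y [k _ /EP[i [j []]]]//|y Oy].
  by eexists; last exact: PE Oy (Tex _ _ (hq1 _ Oy)) (Tex _ _ (hq2 _ Oy)).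
pose J := (Num.bound (3 / d)).+1.
have TJ i q y : `|q y| <= 1 -> T i q y -> (i < J)%N.
  rewrite ler_norml => /andP[h1 h2] /= /andP[h3 _].
  rewrite ltnS -(ler_nat R); apply: (@le_trans _ _ (3 / d)).
    by rewrite ler_pdivlMr//; lra.
  by apply/ltW/archi_boundP; rewrite divr_ge0// ltW.
(* Since q is bounded only finitely many levels occur, so a finite partial sum
   already covers Om. *)
pose n := (\max_(p <- [seq (i, j) | i <- iota 0 J, j <- iota 0 J]) pickle p).+1.
have En k y : E k y -> (k < n)%N.
  move=> /EP[i [j [-> Oy Ti Tj]]]; rewrite ltnS.
  apply: leq_bigmax_seq => //.
  by apply: allpairs_f; rewrite mem_iota add0n /=; [exact: TJ (hq1 _ Oy) Ti|exact: TJ (hq2 _ Oy) Tj].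
have Un : \big[setU/set0]_(k < n) E k = Om.
  rewrite -bigcup_mkord -[RHS]UE; apply/seteqP; split => y [k _ Ek]; exists k => //=.
  exact: En Ek.
have /choice[c hc] : forall k, exists c : R * R, enorm c <= 1 /\
    forall y, E k y -> `|q1 y - c.1| <= d /\ `|q2 y - c.2| <= d.
  move=> k; have [[z Ez]|nz] := pselect (exists z, E k z); last first.
    exists 0; split; first by rewrite enorm0.
    by move=> y Ey; exfalso; apply: nz; exists y.
  have [i [j [kE Oz Ti Tj]]] := EP _ _ Ez.
  exists (q1 z, q2 z); split; first exact: q1e.
  move=> y /EP[i' [j' [kE' Oy Ti' Tj']]].
  have [ei ej] : i = i' /\ j = j'.
    have : Some (i, j) = Some (i', j') by rewrite -(pickleK (i, j)) -kE kE' pickleK.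
    by case.
  move: Ti' Tj' Ti Tj; rewrite -ei -ej /T/= -!natr1 => /andP[? ?] /andP[? ?] /andP[? ?] /andP[? ?].
  by split; rewrite ler_norml; apply/andP; split; lra.
have qE1 k y : E k y -> `|q1 y| <= 1 by move=> /EP[i [j [_ Oy _ _]]]; exact: hq1.
have qE2 k y : E k y -> `|q2 y| <= 1 by move=> /EP[i [j [_ Oy _ _]]]; exact: hq2.
have s1 nu := @step_bound nu E q1 (fun k => (c k).1) 1 d n mE tE m1 qE1 (fun k y Ey => ((hc k).2 y Ey).1).
have s2 nu := @step_bound nu E q2 (fun k => (c k).2) 1 d n mE tE m2 qE2 (fun k y Ey => ((hc k).2 y Ey).2).
have := s1 a1; have := s1 c1; have := s2 a2; have := s2 c2; rewrite !Un !ler_norml.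
move=> /andP[w1 w2] /andP[w3 w4] /andP[w5 w6] /andP[w7 w8].
have hS : (\sum_(k < n) (c k).1 * fine (a1 (E k)) - \sum_(k < n) (c k).1 * fine (c1 (E k))) +
    (\sum_(k < n) (c k).2 * fine (a2 (E k)) - \sum_(k < n) (c k).2 * fine (c2 (E k))) <= V.
  apply: le_trans (var mE tE UE n).
  rewrite -!sumrB -big_split/=; apply: ler_sum => k _.
  rewrite -!mulrBr.
  have := dot_enorm (c k) (fine (a1 (E k)) - fine (c1 (E k)), fine (a2 (E k)) - fine (c2 (E k))).
  rewrite /= => /le_trans; apply.
  by rewrite ler_piMl ?enorm_ge0//; exact: (hc k).1.
rewrite /M in dM; lra.
Qed.

End dual.

Section tv.
Context {R : realType}.
Local Notation leb2 := (@lebesgue2 R).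
Local Notation fmeas := ({finite_measure set (mplane R) -> \bar R}).

(** The field p = h / (|h| + t) has norm at most 1 and its pairing with h is at
    least the integral of |h| up to t times the area. As h is the mollified
    measure, Fubini moves the kernel onto p: the pairing is that of the measure
    with a field q which, being an average of p with total weight at most 1,
    still has norm at most 1. [dual_bound] concludes. *)
Lemma tv_bound (a1 c1 a2 c2 : fmeas) (Om A : set (R * R)) (B V : R)
    (h1 h2 : R * R -> R) (L e : R) (b b1 : R -> R) (C : R) :
  mollifier e b b1 C ->
  measurable (Om : set (mplane R)) -> measurable (A : set (mplane R)) -> bnd A B ->
  (forall E : nat -> set (mplane R), (forall k, measurable (E k)) ->
    trivIset setT E -> \bigcup_k E k = Om -> forall n,
    \sum_(k < n) enorm (fine (a1 (E k)) - fine (c1 (E k)), fine (a2 (E k)) - fine (c2 (E k))) <= V) ->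
  lip h1 L -> lip h2 L ->
  (forall x, A x -> h1 x = \int[a1]_(y in Om) tens b b (x - y) - \int[c1]_(y in Om) tens b b (x - y)) ->
  (forall x, A x -> h2 x = \int[a2]_(y in Om) tens b b (x - y) - \int[c2]_(y in Om) tens b b (x - y)) ->
  \int[leb2]_(x in A) enorm (h1 x, h2 x) <= V.
Proof.
move=> mb mO mA bA var l1 l2 E1 E2.
have [_ b0 _ _ _ C0 hb _ lb _] := mb.
have lk := tens_lip hb hb lb lb; have kM := tens_bound hb hb.
have Afin : (leb2 A < +oo)%E := bnd_fin mA bA.
pose m := fine (leb2 A).
have m0 : 0 <= m by rewrite fine_ge0.
have cen := enorm_continuous l1 l2.
have cth := lip_continuous l1; have cth2 := lip_continuous l2.
apply/ler_addgt0Pr => t' t'0.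
pose t := t' / (m + 1).
have t0 : 0 < t by rewrite divr_gt0// ltr_wpDl.
have tm : t * m <= t'.
  rewrite /t mulrAC ler_pdivrMr ?ltr_wpDl// ler_wpM2l ?ltW//; lra.
pose p (h : R * R -> R) (x : R * R) : R := h x / (enorm (h1 x, h2 x) + t).
have den x : 0 < enorm (h1 x, h2 x) + t by rewrite ltr_wpDl ?enorm_ge0.
have cp h : continuous h -> continuous (p h).
  move=> ch x; apply: cvgM; first exact: ch.
  apply: cvgV; first by rewrite gt_eqF.
  by apply: cvgD; [exact: cen|exact: cvg_cst].
have cp1 := cp _ cth; have cp2 := cp _ cth2.
have pe x : enorm (p h1 x, p h2 x) <= 1.
  rewrite (_ : (p h1 x, p h2 x) = ((enorm (h1 x, h2 x) + t)^-1 * h1 x, (enorm (h1 x, h2 x) + t)^-1 * h2 x)).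
    rewrite (enormZ _ (h1 x, h2 x)) gtr0_norm ?invr_gt0// mulrC ler_pdivrMr// mul1r lerDl ltW//.
  by rewrite /p ![_ / _]mulrC.
have pb1 x : A x -> `|p h1 x| <= 1 by move=> _; apply: le_trans (pe x); exact: (@enorm_ge1 _ (_, _)).
have pb2 x : A x -> `|p h2 x| <= 1 by move=> _; apply: le_trans (pe x); exact: (@enorm_ge2 _ (_, _)).
pose q h y := \int[leb2]_(x in A) (p h x * tens b b (x - y)).
have intA f : continuous f -> leb2.-integrable A (EFin \o f).
  exact: continuous_integrable mA bA.
have iq h y : continuous (p h) -> leb2.-integrable A (EFin \o (fun x => p h x * tens b b (x - y))).
  move=> cph; apply: (int_mul mA (intA _ cph) (C := C * C)) => //.
  exact: measurable_funS (measurable_lip (lip_shift y lk)).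
pose k' (z : R * R) := tens b b (- z).
have lk' : lip k' (C * C).
  move=> x y; apply: (le_trans (lk _ _)); rewrite /= ler_wpM2l ?mulr_ge0//.
  by rewrite -!opprD !normrN.
have mq h : continuous (p h) -> measurable_fun setT (q h : mplane R -> R).
  move=> cph.
  have oA : leb2.-integrable A (EFin \o p h) by exact: intA.
  have -> : q h = mollify A (p h) k'.
    by apply/funext => y; apply: eq_Rintegral => x _; rewrite /k' opprB.
  by apply: measurable_lip; apply: (mollify_lip mA oA lk' (M := C * C)) => z; exact: kM.
have kint y := tens_mass_le1 mb y mA bA.
have qe y : enorm (q h1 y, q h2 y) <= 1.
  (* |q|^2 is the average of the scalar product of q y with p, hence at most |q|. *)
  set w := (q h1 y, q h2 y).
  have [w0|w0] := leP (enorm w) 0; first exact: le_trans w0 ler01.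
  rewrite -(ler_pM2l w0) mulr1 -[X in X <= _]expr2 enormE2 /= !expr2.
  rewrite {2}/q {3}/q -RintegralZl//; last exact: iq.
  rewrite -RintegralZl//; last exact: iq.
  have iz (c : R) h : continuous (p h) -> leb2.-integrable A (EFin \o (fun x => c * (p h x * tens b b (x - y)))).
    by move=> cph; exact: (@integrableZl _ _ _ leb2 A mA c _ (iq h y cph)).
  have ik : leb2.-integrable A (EFin \o (fun x => tens b b (x - y))).
    by apply: intA; exact: lip_continuous (lip_shift y lk).
  rewrite -RintegralD//; try exact: iz.
  apply: (@le_trans _ _ (\int[leb2]_(x in A) (enorm w * tens b b (x - y)))).
    apply: le_Rintegral => //.
    - by have := integrableD mA (iz (q h1 y) _ cp1) (iz (q h2 y) _ cp2).
    - exact: (@integrableZl _ _ _ leb2 A mA (enorm w) _ ik).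
    move=> x _; rewrite (_ : _ + _ = (q h1 y * p h1 x + q h2 y * p h2 x) * tens b b (x - y)); last by ring.
    rewrite ler_wpM2r ?mulr_ge0//.
    have := dot_enorm w (p h1 x, p h2 x); rewrite /= => /le_trans; apply.
    by rewrite ler_piMr ?enorm_ge0.
  by rewrite RintegralZl// ler_piMr ?enorm_ge0.
have dual := @dual_bound R a1 c1 a2 c2 Om V mO var (q h1) (q h2) (mq _ cp1) (mq _ cp2) (fun y _ => qe y).
apply: (@le_trans _ _ (\int[leb2]_(x in A) (p h1 x * h1 x) + \int[leb2]_(x in A) (p h2 x * h2 x) + t * m)).
  have iph h : continuous (p h) -> continuous h -> leb2.-integrable A (EFin \o (fun x => p h x * h x)).
    by move=> cph ch; apply: (intA (fun x => p h x * h x)) => x; apply: cvgM; [exact: cph|exact: ch].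
  have i1 := iph _ cp1 cth; have i2 := iph _ cp2 cth2.
  have i12 : leb2.-integrable A (EFin \o (fun x => p h1 x * h1 x + p h2 x * h2 x)).
    by have := integrableD mA i1 i2.
  have ic : leb2.-integrable A (EFin \o (fun=> t)) by apply: intA => x; exact: cvg_cst.
  rewrite -RintegralD// -Rintegral_cst// -RintegralD//.
  apply: le_Rintegral => //.
  - exact: intA.
  - by have := integrableD mA i12 ic.
  move=> x _; rewrite /p mulrAC [_ / _ * h2 x]mulrAC -mulrDl -!expr2 -(enormE2 (h1 x, h2 x)).
  set w := enorm _; have w0 : 0 <= w by exact: enorm_ge0.
  have wt : 0 < w + t by rewrite ltr_wpDl.
  rewrite -(ler_pM2r wt) mulrDl divfK ?gt_eqF//.
  have := mulr_ge0 (ltW t0) (ltW t0); nra.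
apply: lerD; last exact: tm.
apply: le_trans dual.
have sw (h : R * R -> R) (a c : fmeas) : continuous (p h) -> (forall x, A x -> `|p h x| <= 1) ->
    (forall x, A x -> h x = \int[a]_(y in Om) tens b b (x - y) - \int[c]_(y in Om) tens b b (x - y)) ->
    continuous h ->
    \int[leb2]_(x in A) (p h x * h x) = \int[a]_(y in Om) q h y - \int[c]_(y in Om) q h y.
  move=> cph pbh Eh ch.
  have mph := continuous_measurable2 cph.
  have i1 (nu : fmeas) : nu.-integrable Om (EFin \o (fun _ : R * R => 1 : R)).
    by apply: (@finite_bounded_integrable R nu Om _ 1) => // y _; rewrite normr1.
  have s (nu : fmeas) : \int[leb2]_(x in A) (p h x * \int[nu]_(y in Om) tens b b (x - y)) = \int[nu]_(y in Om) q h y.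
    have := @swap_int R nu A Om (p h) (fun=> 1) (tens b b) 1 (C * C) (C * C) mA mO Afin mph pbh (i1 nu) lk kM.
    under eq_Rintegral do (under eq_Rintegral do rewrite mul1r).
    by under [RHS]eq_Rintegral do rewrite mul1r.
  have is' (nu : fmeas) : leb2.-integrable A (EFin \o (fun x => p h x * \int[nu]_(y in Om) tens b b (x - y))).
    apply: (intA (fun x => p h x * \int[nu]_(y in Om) tens b b (x - y))) => x.
    by apply: cvgM; [exact: cph|exact: (lip_continuous (kern_lip nu mO lk kM))].
  rewrite -!s -RintegralB//.
  by apply: eq_Rintegral => x /set_mem Ax; rewrite -mulrBr -Eh.
by rewrite (sw h1 a1 c1)// (sw h2 a2 c2).
Qed.
End tv.

(** * Approximation of the sign by Lipschitz functions *)
Section sign_approx.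
Context {R : realType}.
Local Notation leb2 := (@lebesgue2 R).
Variables (Om : set (R * R)) (f : R * R -> R).
Hypothesis mO : measurable (Om : set (mplane R)).
Hypothesis intf : leb2.-integrable Om (EFin \o f).

Let inf : leb2.-integrable Om (EFin \o (fun y => `|f y|)).
Proof. exact: integrable_abse intf. Qed.

Lemma weighted_int (g : mplane R -> R) (C : R) : measurable_fun setT g -> (forall y, `|g y| <= C) ->
  leb2.-integrable Om (EFin \o (fun y => `|f y| * g y)).
Proof.
by move=> mg gC; apply: (int_mul mO inf (C := C)) => //; exact: measurable_funS mg.
Qed.

Lemma weighted_cvg0 (g : nat -> mplane R -> R) : (forall n, measurable_fun setT (g n)) ->
  (forall n y, 0 <= g n y <= 1) -> (forall y, Om y -> \forall n \near \oo, g n y = 0) ->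
  forall e : R, 0 < e -> \forall n \near \oo, \int[leb2]_(y in Om) (`|f y| * g n y) <= e.
Proof.
move=> mg g01 g0 e e0.
have gb n y : `|g n y| <= 1 by have /andP[h1 h2] := g01 n y; rewrite ger0_norm.
have ig n := weighted_int (mg n) (gb n).
have [] := @dominated_convergence _ (mplane R) R leb2 Om mO
  (fun n y => (`|f y| * g n y)%:E) (fun=> 0%E) (fun y => `|f y|%:E).
- by move=> n; exact: measurable_int (ig n).
- exact: measurable_cst.
- apply: aeW => y Oy; apply: cvg_near_cst.
  by have := g0 _ Oy; apply: filterS => n ->; rewrite mulr0.
- exact: inf.
- apply: aeW => y n Oy; rewrite /= lee_fin normrM normr_id ler_piMr//.
move=> _ _; rewrite integral0 => /fine_cvgP[_ cv].
exact: (cvgr_le _ cv _ e0).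
Qed.

(** The sets whose indicator is a limit of Lipschitz functions with values in
    [0, 1] for the measure |f| dx. They form a sigma-algebra containing the open
    half-planes bounded by vertical or horizontal lines, hence all Borel sets. *)
Definition lip_approx (E : set (mplane R)) := measurable E /\ forall e : R, 0 < e ->
  exists chi L, [/\ lip chi L, forall x, 0 <= chi x <= 1 &
    \int[leb2]_(y in Om) (`|f y| * `|\1_E y - chi y|) <= e].

Lemma max_dist (a b c d : R) : `|Num.max a b - Num.max c d| <= `|a - c| + `|b - d|.
Proof.
have h (x y z w : R) : Num.max x y - Num.max z w <= `|x - z| + `|y - w|.
  have h1 : x <= Num.max z w + `|x - z|.
    have : z <= Num.max z w by rewrite le_max lexx.
    by have := ler_norm (x - z); lra.
  have h2 : y <= Num.max z w + `|y - w|.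
    have : w <= Num.max z w by rewrite le_max lexx orbT.
    by have := ler_norm (y - w); lra.
  have := normr_ge0 (x - z); have := normr_ge0 (y - w).
  by case: (leP x y); lra.
rewrite ler_norml; apply/andP; split; last exact: h.
by have := h c d a b; rewrite (distrC c) (distrC d); lra.
Qed.

Let dist_meas (E : set (mplane R)) (chi : R * R -> R) L : measurable E -> lip chi L ->
  measurable_fun setT (fun y : mplane R => `|\1_E y - chi y| : R).
Proof.
move=> mE lc; apply: measurableT_comp => //; apply: measurable_funB; first exact: measurable_indic.
exact: measurable_lip lc.
Qed.

Let ind01 (E : set (mplane R)) y : 0 <= (\1_E y : R) <= 1.
Proof. by rewrite indicE; case: (_ \in _); rewrite ?lexx ?ler01. Qed.

Let dist01 (E : set (mplane R)) (chi : R * R -> R) : (forall x, 0 <= chi x <= 1) ->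
  forall y, `| `|\1_E y - chi y| | <= 1.
Proof.
move=> c01 y; rewrite normr_id ler_norml.
have /andP[? ?] := ind01 E y; have /andP[? ?] := c01 y; apply/andP; split; lra.
Qed.

Lemma lip_approx0 : lip_approx set0.
Proof.
split => // e e0; exists (fun=> 0), 0; split.
- by move=> x y; rewrite subrr normr0 mul0r.
- by move=> _; rewrite lexx ler01.
- have -> : \int[leb2]_(y in Om) (`|f y| * `|\1_set0 y - 0|) = \int[leb2]_(y in Om) (cst 0 y).
    by apply: eq_Rintegral => y _; rewrite indic0 subrr normr0 mulr0.
  by rewrite Rintegral_cst// mul0r ltW.
Qed.

Lemma lip_approxC E : lip_approx E -> lip_approx (~` E).
Proof.
move=> [mE hE]; split => [|e e0]; first exact: measurableC.
have [chi [L [lc c01 ce]]] := hE _ e0; exists (fun x => 1 - chi x), L; split.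
- move=> x y; have -> : 1 - chi x - (1 - chi y) = - (chi x - chi y) by ring.
  rewrite normrN; exact: lc.
- by move=> x; have /andP[? ?] := c01 x; apply/andP; split; lra.
apply: le_trans ce; rewrite le_eqVlt; apply/orP; left; apply/eqP.
apply: eq_Rintegral => y _; congr (_ * _).
rewrite [in LHS]indicE in_setC indicE; case: (y \in E) => /=.
  by rewrite distrC; congr (`|_|); ring.
by rewrite distrC; congr (`|_|); ring.
Qed.

Lemma lip_approxU E1 E2 : lip_approx E1 -> lip_approx E2 -> lip_approx (E1 `|` E2).
Proof.
move=> [m1 h1] [m2 h2]; split => [|e e0]; first exact: measurableU.
have e2 : 0 < e / 2 by rewrite divr_gt0.
have [x1 [L1 [l1 c1 i1]]] := h1 _ e2; have [x2 [L2 [l2 c2 i2]]] := h2 _ e2.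
have lm : lip (fun x => Num.max (x1 x) (x2 x)) (L1 + L2).
  move=> x y; apply: (le_trans (max_dist _ _ _ _)).
  by rewrite mulrDl; apply: lerD; [exact: l1|exact: l2].
have cm x : 0 <= Num.max (x1 x) (x2 x) <= 1.
  by have /andP[p1 p2] := c1 x; have /andP[p3 p4] := c2 x; rewrite le_max p1 ge_max p2 p4.
exists (fun x => Num.max (x1 x) (x2 x)), (L1 + L2); split => //.
have I1 := weighted_int (dist_meas m1 l1) (dist01 E1 c1).
have I2 := weighted_int (dist_meas m2 l2) (dist01 E2 c2).
have mU := measurableU _ _ m1 m2.
apply: (@le_trans _ _ (\int[leb2]_(y in Om) (`|f y| * `|\1_E1 y - x1 y| + `|f y| * `|\1_E2 y - x2 y|))).
  apply: le_Rintegral => //.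
  - exact: weighted_int (dist_meas mU lm) (dist01 _ cm).
  - by have := integrableD mO I1 I2.
  move=> y _; rewrite -mulrDr ler_wpM2l//.
  rewrite (_ : \1_(E1 `|` E2) y = Num.max (\1_E1 y) (\1_E2 y)); first exact: max_dist.
  rewrite !indicE in_setU; case: (y \in E1); case: (y \in E2) => //=; rewrite ?maxxx//.
    by rewrite max_l ?ler01.
  by rewrite max_r ?ler01.
by rewrite RintegralD//; lra.
Qed.

Lemma lip_approx_bigU (E : nat -> set (mplane R)) n : (forall k, lip_approx (E k)) -> lip_approx (\big[setU/set0]_(k < n) E k).
Proof.
move=> aE; elim: n => [|n IH]; first by rewrite big_ord0; exact: lip_approx0.
by rewrite big_ord_recr/=; exact: lip_approxU.
Qed.

Lemma lip_approx_lim (E : set (mplane R)) (En : nat -> set (mplane R)) : measurable E ->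
  (forall n, lip_approx (En n)) -> (forall y, \forall n \near \oo, \1_(En n) y = \1_E y :> R) -> lip_approx E.
Proof.
move=> mE aE cv; split => // e e0.
have e2 : 0 < e / 2 by rewrite divr_gt0.
have mEn n : measurable (En n) by case: (aE n).
pose g n (y : mplane R) : R := `|\1_E y - \1_(En n) y|.
have mg n : measurable_fun setT (g n).
  by apply: measurableT_comp => //; apply: measurable_funB; exact: measurable_indic.
have g01 n y : 0 <= g n y <= 1.
  rewrite /g normr_ge0/= ler_norml.
  by have /andP[? ?] := ind01 E y; have /andP[? ?] := ind01 (En n) y; apply/andP; split; lra.
have [n _ /(_ n (leqnn n)) hn] := weighted_cvg0 mg g01 (fun y _ => ltac:(by have := cv y; apply: filterS => n h; rewrite /g h subrr normr0)) e2.
have [chi [L [lc c01 ce]]] := (aE n).2 _ e2.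
exists chi, L; split => //.
have I1 := weighted_int (dist_meas (mEn n) lc) (dist01 _ c01).
have I2 : leb2.-integrable Om (EFin \o (fun y => `|f y| * g n y)).
  by apply: (weighted_int (C := 1)) => // y; have /andP[? ?] := g01 n y; rewrite ger0_norm.
apply: (@le_trans _ _ (\int[leb2]_(y in Om) (`|f y| * g n y + `|f y| * `|\1_(En n) y - chi y|))).
  apply: le_Rintegral => //.
  - exact: weighted_int (dist_meas mE lc) (dist01 _ c01).
  - by have := integrableD mO I2 I1.
  move=> y _; rewrite -mulrDr ler_wpM2l// /g.
  have := ler_normD (\1_E y - \1_(En n) y) (\1_(En n) y - chi y).
  by rewrite addrA subrK.
by rewrite RintegralD//; lra.
Qed.

Lemma lip_approx_bigcup (E : nat -> set (mplane R)) : (forall k, lip_approx (E k)) -> lip_approx (\bigcup_k E k).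
Proof.
move=> aE; apply: (lip_approx_lim (En := fun n => \big[setU/set0]_(k < n) E k)).
- by apply: bigcupT_measurable => k; case: (aE k).
- by move=> n; exact: lip_approx_bigU.
move=> y; have [[k _ Eky]|nE] := pselect ((\bigcup_k E k) y).
  exists k.+1 => // n /= kn; rewrite !indicE !mem_set//; first by exists k.
  by rewrite -bigcup_mkord; exists k.
exists 0%N => // n _; rewrite !indicE !memNset//.
by rewrite -bigcup_mkord => -[k _ Eky]; apply: nE; exists k.
Qed.

(** The ramps min (1, max (0, n (pr - a))) increase to the indicator. *)
Lemma lip_approx_ray (pr : R * R -> R) (a : R) : lip pr 1 -> lip_approx [set y | a < pr y].
Proof.
move=> lp.
have mE : measurable ([set y | a < pr y] : set (mplane R)).
  have := measurable_lip lp measurableT (measurable_itv `]a, +oo[); rewrite setTI.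
  by congr (measurable _); apply/seteqP; split => y; rewrite /= in_itv/= andbT.
split => // e e0.
pose chi n (y : R * R) : R := Num.min 1 (Num.max 0 (n%:R * (pr y - a))).
have lchi n : lip (chi n) n%:R.
  have min_dist (x y : R) : `|Num.min 1 x - Num.min 1 y| <= `|x - y|.
    rewrite !minEle; case: (leP 1 x) => hx; case: (leP 1 y) => hy //.
    - by rewrite subrr normr0.
    - by rewrite !ger0_norm ?subr_ge0 ?(ltW hy)//; lra.
    - by rewrite distrC (distrC x) !ger0_norm ?subr_ge0 ?(ltW hx)//; lra.
  move=> x y; apply: (le_trans (min_dist _ _)); apply: (le_trans (max_dist _ _ _ _)).
  rewrite subrr normr0 add0r -mulrBr normrM normr_nat ler_wpM2l//.
  have := lp x y; rewrite mul1r; apply: le_trans; rewrite le_eqVlt; apply/orP; left; apply/eqP.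
  by congr (`|_|); ring.
have c01 n x : 0 <= chi n x <= 1.
  by rewrite /chi le_min ler01 le_max lexx /= ge_min lexx.
pose g n (y : mplane R) : R := `|\1_[set y | a < pr y] y - chi n y|.
have gz y : Om y -> \forall n \near \oo, g n y = 0.
  move=> _; rewrite /g /chi; have [h|h] := leP (pr y) a.
    exists 0%N => // n _; rewrite indicE memNset; last by rewrite /= ltNge h.
    by rewrite max_l ?min_r ?ler01 ?subrr ?normr0// mulr_ge0_le0// subr_le0.
  have pa : 0 < pr y - a by rewrite subr_gt0.
  exists (Num.bound ((pr y - a)^-1)) => // n /= hn.
  have h1 : 1 <= n%:R * (pr y - a).
    rewrite -ler_pdivrMr// div1r; apply: (@le_trans _ _ (Num.bound ((pr y - a)^-1))%:R).
      by apply/ltW/archi_boundP; rewrite invr_ge0 ltW.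
    by rewrite ler_nat.
  rewrite indicE mem_set// max_r ?min_l//; first by rewrite subrr normr0.
  exact: le_trans ler01 h1.
have g01 n y : 0 <= g n y <= 1.
  by rewrite normr_ge0/= -[X in X <= _]normr_id; exact: dist01.
have [n _ /(_ n (leqnn n)) hn] := weighted_cvg0 (fun n => dist_meas mE (lchi n)) g01 gz e0.
by exists (chi n), n%:R; split.
Qed.

Lemma lip_approx_measurable (E : set (mplane R)) : measurable E -> lip_approx E.
Proof.
have pre (pr : mplane R -> measurableTypeR R) : measurable_fun setT pr -> lip pr 1 ->
    forall A : set (measurableTypeR R), measurable A -> lip_approx (pr @^-1` A).
  move=> mpr lpr A; rewrite (measurable_realfun.RGenOInfty.measurableE R).
  move: A; apply: smallest_sub.
  - split.
    + by rewrite preimage_set0; exact: lip_approx0.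
    + by move=> A hA; rewrite setTD preimage_setC; exact: lip_approxC.
    + by move=> A hA; rewrite preimage_bigcup; exact: lip_approx_bigcup.
  - move=> A [x ->]; rewrite (_ : _ @^-1` _ = [set y | x < pr y]); first exact: lip_approx_ray.
    by apply/seteqP; split => y; rewrite /= in_itv/= andbT.
rewrite measurable_prod_measurableType; move: E; apply: smallest_sub.
- split.
  + exact: lip_approx0.
  + by move=> A hA; rewrite setTD; exact: lip_approxC.
  + by move=> A hA; exact: lip_approx_bigcup.
move=> _ [A mA [C mC <-]].
have -> : A `*` C = ~` (~` (fst @^-1` A) `|` ~` (snd @^-1` C)).
  by rewrite setCU !setCK.
apply: lip_approxC; apply: lip_approxU; apply: lip_approxC; apply: pre => //.
- by move=> x y; rewrite mul1r lerDl.
- by move=> x y; rewrite mul1r lerDr.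
Qed.

(** With chi close to the indicator of the set where f > 0, the function
    2 chi - 1 is close to the sign of f. *)
Lemma sign_approx e : 0 < e -> exists chi L, [/\ lip chi L, forall x, `|chi x| <= 1 &
  \int[leb2]_(y in Om) `|f y| <= \int[leb2]_(y in Om) (f y * chi y) + e].
Proof.
move=> e0; pose E : set (mplane R) := [set y | 0 < (f \_ Om) y].
have mf : measurable_fun setT (f \_ Om : mplane R -> R).
  by apply/(measurable_restrictT _ mO); apply/measurable_EFinP; exact: measurable_int intf.
have mE : measurable E.
  have := mf measurableT _ (measurable_itv `]0, +oo[); rewrite setTI.
  by congr (measurable _); apply/seteqP; split => y; rewrite /= in_itv/= andbT.
have e2 : 0 < e / 2 by rewrite divr_gt0.
have [chi [L [lc c01 ce]]] := (lip_approx_measurable mE).2 _ e2.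
have lx : lip (fun x => 2 * chi x - 1) (2 * L).
  move=> x y; rewrite (_ : _ - _ = 2 * (chi x - chi y)); last by ring.
  by rewrite normrM ger0_norm// -mulrA ler_wpM2l.
have xb x : `|2 * chi x - 1| <= 1.
  by have /andP[? ?] := c01 x; rewrite ler_norml; apply/andP; split; lra.
exists (fun x => 2 * chi x - 1), (2 * L); split => //.
have I1 := weighted_int (dist_meas mE lc) (dist01 _ c01).
have I2 : leb2.-integrable Om (EFin \o (fun y => 2 * (`|f y| * `|\1_E y - chi y|))).
  exact: (@integrableZl _ _ _ leb2 Om mO 2 _ I1).
have I3 : leb2.-integrable Om (EFin \o (fun y => f y * (2 * chi y - 1))).
  by apply: (int_mul mO intf (C := 1)) => //; exact: measurable_funS (measurable_lip lx).
apply: (@le_trans _ _ (\int[leb2]_(y in Om) (f y * (2 * chi y - 1) + 2 * (`|f y| * `|\1_E y - chi y|)))).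
  apply: le_Rintegral => //.
    by have := integrableD mO I3 I2.
  move=> y Oy; have fO : (f \_ Om) y = f y by rewrite patchE mem_set.
  have /andP[c0 c1] := c01 y.
  have [h|h] := ltP 0 (f y).
    have -> : \1_E y = 1 :> R by rewrite indicE mem_set// /E/= fO.
    rewrite (gtr0_norm h) ger0_norm ?subr_ge0//; lra.
  have -> : \1_E y = 0 :> R by rewrite indicE memNset// /E/= fO; apply/negP; rewrite -leNgt.
  rewrite (ler0_norm h) sub0r normrN ger0_norm//; lra.
by rewrite RintegralD// RintegralZl//; lra.
Qed.
End sign_approx.

(** * Erosion of the domain *)
Section erosion.
Context {R : realType}.
Local Notation leb2 := (@lebesgue2 R).
Implicit Types (Om : set (R * R)) (x y z : R * R).

(** The strict inequality makes the eroded set open, and puts closed squares of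
    half-side r inside Om ([erosion_mem]). *)
Definition erosion Om (r : R) : set (R * R) := [set x | exists2 s, r < s & box x s `<=` Om].

Lemma box_shift x y (s r : R) : `|x.1 - y.1| <= r -> `|x.2 - y.2| <= r ->
  box x (s - r) `<=` box y s.
Proof.
move=> h1 h2 w [w1 w2]; split.
  by have := ler_normD (w.1 - x.1) (x.1 - y.1); rewrite addrA subrK; lra.
by have := ler_normD (w.2 - x.2) (x.2 - y.2); rewrite addrA subrK; lra.
Qed.

Lemma erosion_shift Om x y (r t : R) : erosion Om (t + r) y -> `|x.1 - y.1| <= r -> `|x.2 - y.2| <= r ->
  erosion Om t x.
Proof.
move=> [s ts sO] h1 h2; exists (s - r); first by rewrite ltrBrDr.
by apply: subset_trans sO; exact: box_shift.
Qed.

Lemma erosion_mem Om x y (r : R) : erosion Om r y -> `|x.1 - y.1| <= r -> `|x.2 - y.2| <= r -> Om x.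
Proof. by move=> [s ts sO] h1 h2; apply: sO; split; exact: le_lt_trans ts. Qed.

Lemma erosion_sub Om (r : R) : 0 <= r -> erosion Om r `<=` Om.
Proof. by move=> r0 x /erosion_mem; apply; rewrite subrr normr0. Qed.

Lemma opn_erosion Om (r : R) : opn (erosion Om r).
Proof.
move=> x [s rs sO]; exists ((s - r) / 2); first by rewrite divr_gt0// subr_gt0.
move=> y [y1 y2]; exists (s - (s - r) / 2); first by lra.
by apply: subset_trans sO; apply: box_shift; exact: ltW.
Qed.

Lemma cvx_erosion Om (r : R) : cvx Om -> cvx (erosion Om r).
Proof.
move=> cO x y t [s1 r1 h1] [s2 r2 h2] t01; exists (Num.min s1 s2); first by rewrite lt_min r1.
move=> w [/=]; set z1 := x.1 + _; set z2 := x.2 + _.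
rewrite !lt_min => /andP[w1 w2] /andP[w3 w4].
have X : Om (x.1 + (w.1 - z1), x.2 + (w.2 - z2)) by apply: h1; split; rewrite /= addrAC subrr add0r.
have Y : Om (y.1 + (w.1 - z1), y.2 + (w.2 - z2)) by apply: h2; split; rewrite /= addrAC subrr add0r.
have := cO _ _ _ X Y t01; congr (Om _); rewrite [RHS]surjective_pairing/= /z1 /z2.
by congr pair; ring.
Qed.

Lemma erosion_exhaust Om y : opn Om -> Om y -> \forall n \near \oo, erosion Om (n.+1%:R^-1 + n.+1%:R^-1) y.
Proof.
move=> oO /oO[r r0 rO]; have r2 : 0 < r / 2 by rewrite divr_gt0.
by apply: filterS (near_infty_natSinv_lt (PosNum r2)) => n /= hn; exists r => //; rewrite (splitr r) ltrD.
Qed.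
End erosion.

(** * Weak convergence of mollifications *)
Section weak.
Context {R : realType}.
Local Notation leb2 := (@lebesgue2 R).
Variables (Om : set (R * R)) (f : R * R -> R) (BO : R).
Hypothesis oO : opn Om.
Hypothesis bO : bnd Om BO.
Hypothesis intf : leb2.-integrable Om (EFin \o f).
Variables (e : R) (b b1 : R -> R) (C : R).
Hypothesis mb : mollifier e b b1 C.
Hypothesis e0 : 0 < e.

Let mO : measurable (Om : set (mplane R)) := opn_measurable oO.
Let A := erosion Om e.
Let mA : measurable (A : set (mplane R)). Proof. exact: opn_measurable (@opn_erosion _ _ _). Qed.
Let bA : bnd A BO. Proof. by move=> x /(erosion_sub (ltW e0))/bO. Qed.
Let k := tens b b.

Let lk : lip k (C * C).
Proof. by case: mb => _ _ _ _ _ _ hb _ lb _; exact: tens_lip. Qed.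

Let kM z : `|k z| <= C * C.
Proof. by case: mb => _ _ _ _ _ _ hb _ _ _; exact: tens_bound. Qed.

Let k0 z : 0 <= k z.
Proof. by rewrite mulr_ge0// (moll_ge0 mb). Qed.

Let ik y : leb2.-integrable A (EFin \o (fun x => k (x - y))).
Proof. exact: (continuous_integrable mA bA (lip_continuous (lip_shift y lk))). Qed.

Let smear (chi : R * R -> R) y := \int[leb2]_(x in A) (chi x * k (x - y)).

(** Away from the boundary the kernel centred at y is supported in the eroded
    set over which one integrates. *)
Lemma mass_eq1 y : erosion Om (e + e) y -> \int[leb2]_(x in A) k (x - y) = 1.
Proof.
move=> ey; rewrite /Rintegral integral_mkcond (_ : integral _ _ _ = 1%E)//.
rewrite -(tens_integral mb y); apply: eq_integral => x _.
rewrite patchE; case: ifPn => // /negP nA; rewrite (tens_out mb)//.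
have [h1|h1] := leP `|(x - y).1| e; last by left.
have [h2|h2] := leP `|(x - y).2| e; last by right.
by exfalso; apply: nA; apply: mem_set; exact: erosion_shift ey h1 h2.
Qed.

Lemma smear_close chi L y : lip chi L -> 0 <= L -> (forall x, `|chi x| <= 1) ->
  `|smear chi y - chi y| <= L * (e + e) + 2 * \1_(~` erosion Om (e + e)) y.
Proof.
move=> lc L0 c1.
have ic : leb2.-integrable A (EFin \o (fun x => chi x * k (x - y))).
  have ichi := continuous_integrable mA bA (lip_continuous lc).
  by apply: (int_mul mA ichi (C := C * C)) => //; exact: measurable_funS (measurable_lip (lip_shift y lk)).
have icy (r : R) : leb2.-integrable A (EFin \o (fun x => r * k (x - y))).
  exact: (@integrableZl _ _ _ leb2 A mA r _ (ik y)).
have [ey|ey] := pselect (erosion Om (e + e) y); last first.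
  rewrite indicE mem_set// mulr1.
  have h : `|smear chi y| <= 1.
    apply: le_trans (le_normr_Rintegral mA ic) _; apply: le_trans (tens_mass_le1 mb y mA bA).
    apply: le_Rintegral => //; first exact: integrable_abse ic.
    by move=> x _; rewrite normrM (ger0_norm (k0 _)) ler_piMl.
  have := ler_normB (smear chi y) (chi y); have := c1 y.
  have : 0 <= L * (e + e) by rewrite mulr_ge0// addr_ge0 ?ltW.
  lra.
rewrite indicE memNset; last by move=> /(_ ey).
rewrite mulr0 addr0 /smear -[X in _ - X]mulr1 -(mass_eq1 ey) -RintegralZl// -RintegralB//.
have iB : leb2.-integrable A (EFin \o (fun x => chi x * k (x - y) - chi y * k (x - y))).
  by have := integrableB mA ic (icy (chi y)).
apply: le_trans (le_normr_Rintegral mA iB) _.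
rewrite -[leRHS]mulr1 -(mass_eq1 ey) -RintegralZl//; apply: le_Rintegral => //.
  exact: integrable_abse iB.
move=> x _; rewrite -mulrBl normrM (ger0_norm (k0 _)).
have [h1|h1] := leP `|(x - y).1| e; last by rewrite /k (tens_out mb) ?mulr0//; left.
have [h2|h2] := leP `|(x - y).2| e; last by rewrite /k (tens_out mb) ?mulr0//; right.
by rewrite ler_wpM2r// (le_trans (lc _ _))// ler_wpM2l//; exact: lerD.
Qed.

(** By Fubini the mollification can be moved onto chi. The resulting average of
    chi is within 2 e L of chi, except on the part of Om close to the boundary,
    where the kernel is truncated and only boundedness is used; that part
    disappears as e tends to 0. *)
Lemma mollify_weak chi L : lip chi L -> 0 <= L -> (forall x, `|chi x| <= 1) ->
  `|\int[leb2]_(x in A) (chi x * mollify Om f k x) - \int[leb2]_(y in Om) (f y * chi y)| <=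
  L * (e + e) * L1norm Om f + 2 * \int[leb2]_(y in Om) (`|f y| * \1_(~` erosion Om (e + e)) y).
Proof.
move=> lc L0 c1.
have mchi := measurable_lip lc.
have Afin : (leb2 A < +oo)%E := bnd_fin mA bA.
have -> : \int[leb2]_(x in A) (chi x * mollify Om f k x) = \int[leb2]_(y in Om) (f y * smear chi y).
  exact: (@swap_int R leb2s A Om chi f k 1 (C * C) (C * C) mA mO Afin mchi (fun x _ => c1 x) intf lk kM).
have mE : measurable (~` erosion Om (e + e) : set (mplane R)).
  by apply: measurableC; exact: opn_measurable (@opn_erosion _ _ _).
have inf : leb2.-integrable Om (EFin \o (fun y => `|f y|)) by exact: integrable_abse intf.
have i1 : leb2.-integrable Om (EFin \o (fun y => f y * chi y)).
  by apply: (int_mul mO intf (C := 1)) => //; exact: measurable_funS mchi.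
have msm : measurable_fun setT (smear chi : mplane R -> R).
  have ichi := continuous_integrable mA bA (lip_continuous lc).
  pose k' (z : R * R) := k (- z).
  have lk' : lip k' (C * C).
    move=> x y; apply: (le_trans (lk _ _)).
    by rewrite -!opprD !normrN.
  have -> : smear chi = mollify A chi k'.
    by apply/funext => y; apply: eq_Rintegral => x _; rewrite /k' opprB.
  by apply: measurable_lip; apply: (mollify_lip mA ichi lk' (M := C * C)) => z; exact: kM.
have i2 : leb2.-integrable Om (EFin \o (fun y => f y * smear chi y)).
  apply: (int_mul mO intf (C := 1 + (L * (e + e) + 2))); first exact: measurable_funS msm.
  move=> y _; have := smear_close y lc L0 c1; have := c1 y.
  have : 2 * \1_(~` erosion Om (e + e)) y <= 2 :> R.
    by rewrite indicE; case: (_ \in _) => /=; lra.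
  have := ler_normD (smear chi y - chi y) (chi y); rewrite subrK; lra.
rewrite -RintegralB//.
have iB : leb2.-integrable Om (EFin \o (fun y => f y * smear chi y - f y * chi y)).
  by have := integrableB mO i2 i1.
apply: le_trans (le_normr_Rintegral mO iB) _.
have iE : leb2.-integrable Om (EFin \o (fun y => `|f y| * \1_(~` erosion Om (e + e)) y)).
  apply: (int_mul mO inf (C := 1)).
    by apply: measurable_funS (measurable_indic mE); first exact: measurableT.
  by move=> y _; rewrite indicE; case: (_ \in _); rewrite ?normr1 ?normr0.
have iE2 : leb2.-integrable Om (EFin \o (fun y => 2 * (`|f y| * \1_(~` erosion Om (e + e)) y))).
  exact: (@integrableZl _ _ _ leb2 Om mO 2 _ iE).
have iL : leb2.-integrable Om (EFin \o (fun y => L * (e + e) * `|f y|)).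
  exact: (@integrableZl _ _ _ leb2 Om mO (L * (e + e)) _ inf).
rewrite /L1norm -RintegralZl// -RintegralZl// -RintegralD//.
apply: le_Rintegral => //.
- exact: integrable_abse iB.
- by have := integrableD mO iL iE2.
move=> y _; rewrite -mulrBr normrM.
apply: le_trans (ler_wpM2l (normr_ge0 _) (smear_close y lc L0 c1)) _.
by rewrite mulrDr [X in X + _]mulrC [X in _ + X]mulrCA.
Qed.
End weak.

(** * The inequality for functions of bounded variation *)
Section bv_poincare.
Context {R : realType}.
Local Notation leb2 := (@lebesgue2 R).
Local Notation fmeas := ({finite_measure set (mplane R) -> \bar R}).

Lemma is_derive_subc (G : R -> R) (D c s : R) : is_derive s 1 G D ->
  is_derive s 1 (fun s => G s - c) D.
Proof. by move=> h; apply: is_derive_eq; rewrite subr0. Qed.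

Lemma is_derive_lines (F h1 h2 : R * R -> R) :
  (forall (p v : R * R) (s : R), is_derive s 1 (fun s => F (p.1 + s * v.1, p.2 + s * v.2))
     (v.1 * h1 (p.1 + s * v.1, p.2 + s * v.2) + v.2 * h2 (p.1 + s * v.1, p.2 + s * v.2))) ->
  (forall m b s : R, is_derive s 1 (fun s => F (s, m * s + b))
     (h1 (s, m * s + b) + m * h2 (s, m * s + b))) /\
  (forall m b s : R, is_derive s 1 (fun s => F (m * s + b, s))
     (h2 (m * s + b, s) + m * h1 (m * s + b, s))).
Proof.
move=> dF; split => m b s.
  have E t : (t, m * t + b) = (0 + t * 1, b + t * m) :> R * R by congr pair; ring.
  have -> : (fun s => F (s, m * s + b)) = (fun s => F (0 + s * 1, b + s * m)).
    by apply/funext => t; rewrite E.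
  by rewrite E -[h1 _]mul1r; exact: (dF (0, b) (1, m)).
have E t : (m * t + b, t) = (b + t * m, 0 + t * 1) :> R * R by congr pair; ring.
have -> : (fun s => F (m * s + b, s)) = (fun s => F (b + s * m, 0 + s * 1)).
  by apply/funext => t; rewrite E.
by rewrite E addrC -[h2 _]mul1r; exact: (dF (b, 0) (m, 1)).
Qed.

(** On the eroded domain [smooth_poincare] applies to the mollified function
    minus its mean, and [tv_bound] controls the gradient by V. Both the mean and
    the truncation are small because f has mean 0. In the limit the left side is
    recovered by testing against Lipschitz approximations of the sign of f, so
    only the weak convergence of [mollify_weak] is needed. *)
Theorem bv_poincare (Om : set (R * R)) (BO : R) (f : R * R -> R) (a1 c1 a2 c2 : fmeas) (V d : R) :
  opn Om -> cvx Om -> bnd Om BO -> leb2.-integrable Om (EFin \o f) ->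
  \int[leb2]_(x in Om) f x = 0 ->
  (forall phi, test_function Om phi ->
    \int[leb2]_(x in Om) (f x * 'D_((1, 0) : R * R) phi x) =
      - (\int[a1]_(x in Om) phi x - \int[c1]_(x in Om) phi x) /\
    \int[leb2]_(x in Om) (f x * 'D_((0, 1) : R * R) phi x) =
      - (\int[a2]_(x in Om) phi x - \int[c2]_(x in Om) phi x)) ->
  (forall E : nat -> set (mplane R), (forall k, measurable (E k)) ->
    trivIset setT E -> \bigcup_k E k = Om -> forall n,
    \sum_(k < n) enorm (fine (a1 (E k)) - fine (c1 (E k)), fine (a2 (E k)) - fine (c2 (E k))) <= V) ->
  0 <= d -> (forall x y, Om x -> Om y -> enorm (x - y) <= d) ->
  \int[leb2]_(x in Om) `|f x| <= d / 2 * V.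
Proof.
move=> oO cO bO intf f0 weak var d0 hd.
have mO := opn_measurable oO.
pose g n (y : mplane R) : R := \1_(~` erosion Om (n.+1%:R^-1 + n.+1%:R^-1)) y.
pose w n := \int[leb2]_(y in Om) (`|f y| * g n y).
have wcv (t : R) : 0 < t -> \forall n \near \oo, w n <= t.
  apply: (weighted_cvg0 mO intf).
  - by move=> n; apply: measurable_indic; apply: measurableC; exact: opn_measurable (@opn_erosion _ _ _).
  - by move=> n y; rewrite /g indicE; case: (_ \in _); rewrite /= ?lexx ?ler01.
  move=> y Oy; have := erosion_exhaust oO Oy; apply: filterS => n hn.
  by rewrite /g indicE memNset// => /(_ hn).
have I0 := L1norm_ge0 Om f.
have key n chi L : lip chi L -> 0 <= L -> (forall x, `|chi x| <= 1) ->
    \int[leb2]_(y in Om) (f y * chi y) <=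
      d / 2 * V + 4 * w n + L * (n.+1%:R^-1 + n.+1%:R^-1) * L1norm Om f.
  move=> lc L0 chi1; pose e : R := n.+1%:R^-1.
  have e0 : 0 < e by rewrite invr_gt0 ltr0n.
  have [b [b1 [C mb]]] := mollifier_exists e0.
  case: (mb) => _ _ _ _ _ C0 hb hb1 lb lb1.
  have lk := tens_lip hb hb lb lb; have lk1 := tens_lip hb1 hb lb1 lb; have lk2 := tens_lip hb hb1 lb lb1.
  have kM := tens_bound hb hb; have kM1 := tens_bound hb1 hb; have kM2 := tens_bound hb hb1.
  pose A := erosion Om e.
  have oA : opn A by exact: opn_erosion.
  have mA := opn_measurable oA.
  have AO : A `<=` Om := erosion_sub (ltW e0).
  have bA : bnd A BO by move=> x /AO/bO.
  pose F := mollify Om f (tens b b).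
  pose h1 := mollify Om f (tens b1 b); pose h2 := mollify Om f (tens b b1).
  have lF : lip F (C * C * L1norm Om f) := mollify_lip mO intf lk kM.
  have l1 : lip h1 (C * C * L1norm Om f) := mollify_lip mO intf lk1 kM1.
  have l2 : lip h2 (C * C * L1norm Om f) := mollify_lip mO intf lk2 kM2.
  have iA q : continuous q -> leb2.-integrable A (EFin \o q) by exact: continuous_integrable mA bA.
  have icA (r : R) : leb2.-integrable A (EFin \o cst r) by apply: iA; exact: cst_continuous.
  have iF : leb2.-integrable A (EFin \o F) by apply: iA; exact: lip_continuous lF.
  have H x : A x -> h1 x = \int[a1]_(y in Om) tens b b (x - y) - \int[c1]_(y in Om) tens b b (x - y) /\
      h2 x = \int[a2]_(y in Om) tens b b (x - y) - \int[c2]_(y in Om) tens b b (x - y).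
    move=> Ax; have tk : test_function Om (fun y => tens b b (x - y)).
      apply: (test_kernel mb) => y y1 y2.
      by apply: (erosion_mem Ax); rewrite distrC.
    have [w1 w2] := weak _ tk; split.
      rewrite -[RHS]opprK -w1 -mulN1r -RintegralZl//.
        by apply: eq_Rintegral => y _; rewrite (test_kernel_derive mb x y).1; ring.
      rewrite (_ : _ \o _ = EFin \o (fun y => (-1) * (f y * tens b1 b (x - y)))).
        exact: (@integrableZl _ _ _ leb2 Om mO (-1) _ (mollify_int mO intf x lk1 kM1)).
      by apply/funext => y; rewrite /= (test_kernel_derive mb x y).1; congr (_%:E); ring.
    rewrite -[RHS]opprK -w2 -mulN1r -RintegralZl//.
      by apply: eq_Rintegral => y _; rewrite (test_kernel_derive mb x y).2; ring.
    rewrite (_ : _ \o _ = EFin \o (fun y => (-1) * (f y * tens b b1 (x - y)))).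
      exact: (@integrableZl _ _ _ leb2 Om mO (-1) _ (mollify_int mO intf x lk2 kM2)).
    by apply/funext => y; rewrite /= (test_kernel_derive mb x y).2; congr (_%:E); ring.
  have tv : \int[leb2]_(x in A) enorm (h1 x, h2 x) <= V.
    exact: (tv_bound mb mO mA bA var l1 l2 (fun x Ax => (H x Ax).1) (fun x Ax => (H x Ax).2)).
  pose m := fine (leb2 A).
  pose c := (\int[leb2]_(x in A) F x) / m.
  have cm : c * m = \int[leb2]_(x in A) F x := mean_mul mA bA iF.
  pose F' x := F x - c.
  have lF' : lip F' (C * C * L1norm Om f).
    by move=> x y; rewrite /F' (_ : _ - _ = F x - F y); [exact: lF|ring].
  have F'0 : \int[leb2]_(x in A) F' x = 0.
    have -> : \int[leb2]_(x in A) F' x = \int[leb2]_(x in A) F x - \int[leb2]_(x in A) (cst c x).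
      by rewrite -(RintegralB mA iF (icA c)).
    by rewrite Rintegral_cst// cm subrr.
  have dF (p v : R * R) (s : R) : is_derive s 1 (fun s => F' (p.1 + s * v.1, p.2 + s * v.2))
      (v.1 * h1 (p.1 + s * v.1, p.2 + s * v.2) + v.2 * h2 (p.1 + s * v.1, p.2 + s * v.2)).
    exact: (is_derive_subc c (mollify_derive mO intf mb p v s)).
  have Fbd : \int[leb2]_(x in A) `|F' x| <= d / 2 * V.
    apply: (@le_trans _ _ (d / 2 * \int[leb2]_(x in A) enorm (h1 x, h2 x))); last first.
      by rewrite ler_wpM2l// divr_ge0.
    have [dl1 dl2] := @is_derive_lines F' h1 h2 dF.
    have LL : 0 <= C * C * L1norm Om f by rewrite mulr_ge0// mulr_ge0.
    have hdA x y : A x -> A y -> enorm (x - y) <= d by move=> /AO Ox /AO Oy; exact: hd.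
    exact: (smooth_poincare oA (cvx_erosion cO) bA lF' l1 l2 LL d0 dl1 dl2 hdA F'0).
  have wk1 := mollify_weak oO bO intf mb e0 (chi := fun=> 1) (L := 0).
  have wk2 := mollify_weak oO bO intf mb e0 lc L0 chi1.
  have iF' : leb2.-integrable A (EFin \o F') by apply: iA; exact: lip_continuous lF'.
  have inF : leb2.-integrable A (EFin \o (fun x => `|F x|)) by exact: integrable_abse iF.
  have inF' : leb2.-integrable A (EFin \o (fun x => `|F' x|)) by exact: integrable_abse iF'.
  (* [mollify_weak] with the constant function 1 compares the integral of F with
     that of f, which is 0. *)
  have cb : `|c| * m <= 2 * w n.
    have m0 : 0 <= m by rewrite fine_ge0.
    rewrite -(ger0_norm m0) -normrM cm.
    have -> : \int[leb2]_(x in A) F x = \int[leb2]_(x in A) (1 * F x) - \int[leb2]_(y in Om) (f y * 1).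
      rewrite (_ : \int[leb2]_(y in Om) (f y * 1) = 0).
        by rewrite subr0; apply: eq_Rintegral => x _; rewrite mul1r.
      by rewrite -f0; apply: eq_Rintegral => x _; rewrite mulr1.
    apply: le_trans (wk1 _ _ _) _ => //.
    - by move=> x y; rewrite subrr normr0 mul0r.
    - by move=> _; rewrite normr1.
    - by rewrite !mul0r add0r.
  have F1 : \int[leb2]_(x in A) `|F x| <= d / 2 * V + 2 * w n.
    apply: le_trans (lerD Fbd cb); rewrite -Rintegral_cst// -RintegralD//; last exact: icA.
    apply: le_Rintegral => //.
      by have := integrableD mA inF' (icA `|c|).
    by move=> x _; have := ler_normD (F x - c) c; rewrite subrK.
  have F2 : \int[leb2]_(x in A) (chi x * F x) <= \int[leb2]_(x in A) `|F x|.
    apply: le_Rintegral => //.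
      apply: iA => x; apply: cvgM; [exact: lip_continuous lc x|exact: lip_continuous lF x].
    move=> x _; apply: le_trans (ler_norm _) _; rewrite normrM ler_piMl//.
  move: wk2; rewrite ler_norml => /andP[]; rewrite -/F -/A -/e -/(w n) => wa _.
  clear -wa F1 F2; move: wa F1 F2; move: (Rintegral _ _ _) (Rintegral _ _ _) (Rintegral _ _ _) => r1 r2 r3; lra.
suff lim (t : R) : 0 < t -> \int[leb2]_(x in Om) `|f x| <= d / 2 * V + t.
  by apply/ler_addgt0Pr => t t0; exact: lim.
move=> t0; have t4 : 0 < t / 6 by rewrite divr_gt0.
have [chi [L [lc chi1 hs]]] := sign_approx mO intf t4.
have L0 : 0 <= L.
  have := le_trans (normr_ge0 _) (lc (1, 0) (0, 0)).
  by rewrite /= !subr0 normr1 normr0 addr0 mulr1.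
pose q := L * L1norm Om f + 1.
have q0 : 0 < q by rewrite ltr_wpDl// mulr_ge0.
have tq : 0 < t / 12 / q by rewrite !divr_gt0.
have [n hn] : exists n, w n <= t / 6 /\ (n.+1%:R^-1 : R) < t / 12 / q.
  have := filterI (wcv _ t4) (near_infty_natSinv_lt (PosNum tq)).
  by case=> n _ /(_ n (leqnn n)); exists n.
have := key n chi L lc L0 chi1; case: hn => h1 h2.
have : L * (n.+1%:R^-1 + n.+1%:R^-1) * L1norm Om f <= t / 6.
  rewrite (_ : _ * _ * _ = (n.+1%:R^-1 + n.+1%:R^-1) * (q - 1)); last by rewrite /q; ring.
  apply: (@le_trans _ _ ((n.+1%:R^-1 + n.+1%:R^-1) * q)).
    by rewrite ler_wpM2l ?addr_ge0 ?invr_ge0//; lra.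
  clear -h2 q0; move: h2; rewrite ltr_pdivlMr//; move: (n.+1%:R^-1 : R) => r h2; lra.
clear -hs h1; move: hs h1.
move: (L * _ * _) (d / 2 * V) (w n) (Rintegral _ _ _) (Rintegral _ _ _) => x1 x2 x3 x4 x5; lra.
Qed.
End bv_poincare.

(** * Convexity, diameter and test functions *)
Section geometry.
Context {R : realType}.
Local Notation leb2 := (@lebesgue2 R).
Local Notation mu := (@lebesgue_measure R).
Implicit Types (Om : set (R * R)) (phi : R * R -> R).

Lemma convex_set_cvx Om : convex_set Om -> cvx Om.
Proof.
move=> cO x y t Ox Oy /andP[t0 t1].
have := cO x y (Itv01 (unstable.onem_ge0 t1) (unstable.onem_le1 t0)) (mem_set Ox) (mem_set Oy).
move=> /set_mem; congr (Om _).
rewrite /conv/= [LHS]surjective_pairing/= /GRing.scale/= /unstable.onem.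
by congr pair; ring.
Qed.

Lemma bounded_set_bnd Om : bounded_set Om -> exists2 B, 0 <= B & bnd Om B.
Proof.
move=> /ex_strict_bound_gt0[B B0 hB]; exists B; first exact: ltW.
by move=> x /hB/ltW; rewrite prod_normE ge_max => /andP[].
Qed.

Lemma diam_ub Om B : bnd Om B -> forall x y, Om x -> Om y -> enorm (x - y) <= diam Om.
Proof.
move=> bO x y Ox Oy; apply: ub_le_sup; last by exists x, y.
exists (4 * B) => _ [x' [y' [/bO[a1 a2] /bO[a3 a4] ->]]].
apply: le_trans (enorm_le _) _; rewrite /=.
have := ler_normB x'.1 y'.1; have := ler_normB x'.2 y'.2; lra.
Qed.

Lemma diam_ge0 Om B : bnd Om B -> 0 <= diam Om.
Proof.
move=> bO; have [[x Ox]|nO] := pselect (exists x, Om x).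
  by have := diam_ub bO Ox Ox; rewrite subrr enorm0.
rewrite /diam (_ : [set r | _] = set0) ?sup0//.
by apply/seteqP; split => // r [x [y [Ox _ _]]]; apply: nO; exists x.
Qed.

Lemma test_out Om phi z : test_function Om phi -> ~ Om z ->
  \forall y \near z, phi y = 0.
Proof.
move=> [_ _ sO] nOz.
have nS : ~ closure [set x | phi x != 0] z by move=> /sO.
have : nbhs z (~` closure [set x | phi x != 0]).
  by apply: open_nbhs_nbhs; split => //; apply: closed_openC; exact: closed_closure.
apply: filterS => y ny; apply/eqP; apply: contrapT => /negP p0.
by apply: ny; exact: subset_closure.
Qed.

Lemma test_derive_out Om phi z v : test_function Om phi -> ~ Om z -> 'D_v phi z = 0.
Proof.
move=> tf nOz.
have h : \forall y \near z, phi y = cst 0 y by exact: test_out tf nOz.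
by rewrite (near_eq_derive _ h) derive_cst.
Qed.

Lemma integral_derive0 (F G : R -> R) (B : R) : 0 <= B -> continuous G ->
  (forall s : R, is_derive s 1 F (G s)) -> (forall s, B < `|s| -> F s = 0 /\ G s = 0) ->
  (\int[mu]_s (G s)%:E = 0)%E.
Proof.
move=> B0 cG dF out.
have cF : continuous F := derive_continuous dF.
have ab : - (B + 1) < B + 1 by lra.
have -> : (\int[mu]_s (G s)%:E = \int[mu]_(s in `[(- (B + 1))%R, (B + 1)%R]) (G s)%:E)%E.
  rewrite [RHS]integral_mkcond; apply: eq_integral => s _; rewrite patchE; case: ifPn => //.
  move=> /negP sn; have [|_ ->//] := out s.
  rewrite ltNge; apply/negP => h; apply: sn; apply: mem_set; move: h.
  by rewrite ler_norml /= in_itv/= => /andP[? ?]; apply/andP; split; lra.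
rewrite (continuous_FTC2 (F := F) ab).
- have [|-> _] := out (B + 1); first by rewrite ger0_norm; lra.
  have [|-> _] := out (- (B + 1)); first by rewrite normrN ger0_norm; lra.
  by rewrite subee.
- by apply: continuous_subspaceT.
- split => [x _||]; first by case: (dF x).
  + by apply: cvg_at_right_filter; exact: cF.
  + by apply: cvg_at_left_filter; exact: cF.
- by move=> x _; rewrite derive1E; case: (dF x).
Qed.

Lemma test_continuous_derive Om phi : test_function Om phi ->
  [/\ continuous phi, continuous ('D_((1, 0) : R * R) phi), continuous ('D_((0, 1) : R * R) phi),
    (forall z, is_derive z ((1, 0) : R * R) phi ('D_((1, 0) : R * R) phi z)) &
    (forall z, is_derive z ((0, 1) : R * R) phi ('D_((0, 1) : R * R) phi z))].
Proof.
move=> [/(_ 1%N)[cp [d1 d2 [c1 _] [c2 _]]] _ _]; split=> [|||z|z]; [exact: cp|exact: c1|exact: c2|exact/derivableP/d1|exact/derivableP/d2].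
Qed.

Lemma continuous_slices phi : continuous phi ->
  (forall y : R, continuous (fun s : R => phi (s, y))) /\ (forall s : R, continuous (fun y : R => phi (s, y))).
Proof.
move=> cp; split => c t.
  apply: (continuous_comp (f := fun s : R => (s, c) : R * R) (g := phi)); last exact: cp.
  by apply: (@cvg_pair _ _ _ (nbhs t) (nbhs t) (nbhs c)); [exact: cvg_id|exact: cvg_cst].
apply: (continuous_comp (f := fun y : R => (c, y) : R * R) (g := phi)); last exact: cp.
by apply: (@cvg_pair _ _ _ (nbhs t) (nbhs c) (nbhs t)); [exact: cvg_cst|exact: cvg_id].
Qed.

(** Fubini, and the fundamental theorem of calculus on each horizontal or
    vertical line. *)
Lemma test_derive_integral0 Om phi (B : R) : opn Om -> bnd Om B -> 0 <= B -> test_function Om phi ->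
  \int[leb2]_(x in Om) 'D_((1, 0) : R * R) phi x = 0 /\
  \int[leb2]_(x in Om) 'D_((0, 1) : R * R) phi x = 0.
Proof.
move=> oO bO B0 tf; have mO := opn_measurable oO.
have [cp c1 c2 d1 d2] := test_continuous_derive tf.
have out z : B < `|z.1| \/ B < `|z.2| -> ~ Om z.
  by move=> h /bO[h1 h2]; case: h; rewrite ltNge => /negP; apply.
have ext v : continuous ('D_v phi) -> leb2.-integrable setT (EFin \o 'D_v phi) /\
    \int[leb2]_(x in Om) 'D_v phi x = fine (\int[leb2]_x ('D_v phi x)%:E)%E.
  move=> cv; have E : ('D_v phi) \_ Om = 'D_v phi.
    apply/funext => x; rewrite patchE; case: ifPn => // /negP nx.
    by rewrite (test_derive_out v tf)// => Ox; apply: nx; exact: mem_set.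
  split; last by rewrite [LHS]Rintegral_mkcond E.
  have := continuous_integrable mO bO cv.
  by move=> /(integrable_mkcond _ mO); rewrite restrict_EFin E.
have phi0 z : ~ Om z -> phi z = 0 by move=> /(test_out tf)/nbhs_singleton.
have [i1 E1] := ext _ c1; have [i2 E2] := ext _ c2.
split; [rewrite E1|rewrite E2].
  rewrite (_ : (integral _ _ _ = 0)%E)//.
  apply: etrans (esym (integral21_prod_meas1 (m1 := mu) (m2 := mu) i1)) _.
  apply: integral0_eq => y _.
  apply: (integral_derive0 (F := fun s => phi (s, y)) B0).
  - exact: (continuous_slices c1).1.
  - by move=> s; exact: (is_derive_fst phi (s, y) _).1 (d1 _).
  - by move=> s Bs; rewrite phi0 ?(test_derive_out _ tf)//; apply: out; left.
rewrite (_ : (integral _ _ _ = 0)%E)//.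
apply: etrans (esym (integral12_prod_meas1 (m1 := mu) (m2 := mu) i2)) _.
apply: integral0_eq => s _.
apply: (integral_derive0 (F := fun y => phi (s, y)) B0).
- exact: (continuous_slices c2).2.
- by move=> y; exact: (is_derive_snd phi (s, y) _).1 (d2 _).
- by move=> y By; rewrite phi0 ?(test_derive_out _ tf)//; apply: out; right.
Qed.
End geometry.

(** * Charges as differences of finite measures *)
Section finite_measures.
Context d (T : measurableType d) (R : realType).
Variables m1 m2 : {finite_measure set T -> \bar R}.

Definition fadd : set T -> \bar R := measure_add m1 m2.

HB.instance Definition _ := Measure.on fadd.

Lemma fadd_finite : fin_num_fun fadd.
Proof. by move=> A mA; rewrite /fadd measure_addE fin_numD !fin_num_measure. Qed.

HB.instance Definition _ := @Measure_isFinite.Build _ _ _ fadd fadd_finite.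
End finite_measures.

Section charges.
Context {R : realType}.
Local Notation fmeas := ({finite_measure set (mplane R) -> \bar R}).
Implicit Types (nu : {charge set (mplane R) -> \bar R}) (a b : vmeasure R) (Om : set (R * R)).

(** [charge_integral] chooses a Hahn decomposition; what matters afterwards is
    that one pair of finite measures represents both the integrals and the
    masses. *)
Lemma charge_integral_split nu : exists p n : fmeas,
  (forall D f, charge_integral nu D f = \int[p]_(x in D) f x - \int[n]_(x in D) f x) /\
  (forall A, measurable A -> fine (nu A) = fine (p A) - fine (n A)).
Proof.
rewrite /charge_integral; case: cid => P exN; case: cid => N nuPN.
exists (jordan_pos nuPN), (jordan_neg nuPN); split => // A mA.
rewrite (jordan_decomp nuPN mA) /cadd/= cscaleN1 fineD ?fin_numN ?fin_num_measure//.
by rewrite fineN.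
Qed.

Lemma sub_charge nu1 nu2 A : measurable A ->
  fine (cadd nu1 (copp nu2) A) = fine (nu1 A) - fine (nu2 A).
Proof.
by move=> mA; rewrite /cadd/= /copp/= fineD ?fin_numN ?fin_num_measure// fineN.
Qed.

Lemma variation_sym Om a b :
  vmeasure_variation Om (vmeasure_sub a b) = vmeasure_variation Om (vmeasure_sub b a).
Proof.
congr ereal_sup; apply: eq_imagel => E [mE _ _]; apply: eq_eseriesr => k _.
rewrite /vmeasure_sub/= !sub_charge// -enormN; congr (enorm _)%:E.
by congr pair; rewrite opprB.
Qed.

Lemma partial_variation Om a (E : nat -> set (mplane R)) n : (forall k, measurable (E k)) ->
  trivIset setT E -> \bigcup_k E k = Om ->
  ((\sum_(k < n) enorm (fine (a.1 (E k)), fine (a.2 (E k))))%:E <= vmeasure_variation Om a)%E.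
Proof.
move=> mE tE UE; apply: (@le_trans _ _ (\sum_(0 <= k <oo) (enorm (fine (a.1 (E k)), fine (a.2 (E k))))%:E)%E).
  rewrite -sumEFin -(big_mkord xpredT (fun k => (enorm (fine (a.1 (E k)), fine (a.2 (E k))))%:E)).
  by apply: nneseries_lim_ge => k _ _; rewrite lee_fin enorm_ge0.
by apply: ereal_sup_ubound; exists E.
Qed.
End charges.

(** * Lebesgue spaces and gradients on the domain *)
Section spaces.
Context {R : realType}.
Local Notation leb2 := (@lebesgue2 R).
Variables (Om : set (R * R)) (B : R).
Hypothesis oO : opn Om.
Hypothesis bO : bnd Om B.
Hypothesis B0 : 0 <= B.
Implicit Types (u w : R * R -> R) (c : R) (g : vmeasure R).

Let mO : measurable (Om : set (mplane R)) := opn_measurable oO.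

Lemma cst_int c : leb2.-integrable Om (EFin \o cst c).
Proof. by apply: (continuous_integrable mO bO); exact: cst_continuous. Qed.

Lemma LpOn1P u : LpOn Om 1%E u <-> leb2.-integrable Om (EFin \o u).
Proof.
rewrite /LpOn; split.
  by move=> /Lfun1_integrable; rewrite -restrict_EFin => /(integrable_mkcond _ mO).
by move=> /(integrable_mkcond _ mO); rewrite restrict_EFin => /Lfun1_integrable.
Qed.

Lemma normOn2E u : normOn Om 2%:E u = ((\int[leb2]_(x in Om) (u x ^+ 2)%:E) `^ 2^-1)%E.
Proof.
rewrite /normOn unlock [in RHS]integral_mkcond; congr (poweR _ _).
apply: eq_integral => x _; rewrite /= !patchE; case: ifPn => _.
  by rewrite powR_mulrn// real_normK ?num_real.
by rewrite normr0 powR0.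
Qed.

Lemma normOn1E u : leb2.-integrable Om (EFin \o u) ->
  normOn Om 1%E u = (\int[leb2]_(x in Om) `|u x|)%:E.
Proof.
move=> iu; rewrite /normOn Lnorm1.
rewrite /Rintegral fineK; last exact: (integrable_fin_num mO (integrable_abse iu)).
rewrite [RHS]integral_mkcond; apply: eq_integral => x _; rewrite /= !patchE; case: ifPn => _ //.
by rewrite normr0.
Qed.

Lemma LpOn2P u : LpOn Om 2%:E u <->
  measurable_fun (Om : set (mplane R)) u /\ leb2.-integrable Om (EFin \o (fun x => u x ^+ 2)).
Proof.
split.
  move=> h; split.
    move: h; rewrite /LpOn inE => /andP[]; rewrite inE/= => mu _.
    by apply/(measurable_restrictT _ mO).
  move: h => /Lfun2_integrable_sqr h; apply/(integrable_mkcond _ mO).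
  rewrite restrict_EFin; congr (integrable _ _ (EFin \o _)): h; apply/funext => x.
  by rewrite !patchE; case: ifP => //; rewrite expr0n.
move=> [mu iu]; rewrite /LpOn inE; apply/andP; split.
  by rewrite inE/=; apply/(measurable_restrictT _ mO).
rewrite inE/= /finite_norm -/(normOn Om 2%:E u) normOn2E poweR_lty//.
have /integrableP[_] := iu; congr (_ < _)%E; apply: eq_integral => x _.
by rewrite /= ger0_norm// sqr_ge0.
Qed.

(** |u| <= 1 + u^2, and the domain has finite area. *)
Lemma LpOn2_int u : LpOn Om 2%:E u -> leb2.-integrable Om (EFin \o u).
Proof.
move=> /LpOn2P[mu iu].
have i1 : leb2.-integrable Om (EFin \o (fun x => 1 + u x ^+ 2)).
  by have := integrableD mO (cst_int 1) iu.
apply: (le_integrable mO _ _ i1); first exact/measurable_EFinP.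
move=> x _; rewrite /= lee_fin [leRHS]ger0_norm ?addr_ge0 ?sqr_ge0//.
rewrite -[X in _ + X]real_normK ?num_real//.
have := sqr_ge0 (`|u x| - 2^-1); rewrite sqrrB; lra.
Qed.

Lemma LpOn2D u w : LpOn Om 2%:E u -> LpOn Om 2%:E w -> LpOn Om 2%:E (fun x => u x + w x).
Proof.
move=> /LpOn2P[mu iu] /LpOn2P[mw iw]; apply/LpOn2P; split; first exact: measurable_funD.
have i2 : leb2.-integrable Om (EFin \o (fun x => 2 * (u x ^+ 2 + w x ^+ 2))).
  have i1 : leb2.-integrable Om (EFin \o (fun x => u x ^+ 2 + w x ^+ 2)).
    by have := integrableD mO iu iw.
  exact: (@integrableZl _ _ _ leb2 Om mO 2 _ i1).
apply: (le_integrable mO _ _ i2).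
  by apply/measurable_EFinP; apply: measurable_funX; exact: measurable_funD.
move=> x _; rewrite /= lee_fin !ger0_norm ?sqr_ge0 ?mulr_ge0 ?addr_ge0 ?sqr_ge0//.
have := sqr_ge0 (u x - w x); rewrite sqrrB sqrrD; lra.
Qed.

Lemma LpOn2N u : LpOn Om 2%:E u -> LpOn Om 2%:E (fun x => - u x).
Proof.
move=> /LpOn2P[mu iu]; apply/LpOn2P; split; first exact: measurableT_comp.
by congr (integrable _ _ (EFin \o _)): iu; apply/funext => x; rewrite sqrrN.
Qed.

Lemma LpOn2_cst c : LpOn Om 2%:E (fun=> c).
Proof. by apply/LpOn2P; split => //; exact: cst_int. Qed.

Lemma normOn2_le u w : \int[leb2]_(x in Om) (u x ^+ 2) <= \int[leb2]_(x in Om) (w x ^+ 2) ->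
  LpOn Om 2%:E u -> LpOn Om 2%:E w -> (normOn Om 2%:E u <= normOn Om 2%:E w)%E.
Proof.
move=> h /LpOn2P[_ iu] /LpOn2P[_ iw]; rewrite !normOn2E.
apply: gt0_ler_poweR => //; try by rewrite in_itv/= leey integral_ge0// => x _; rewrite lee_fin sqr_ge0.
rewrite -(fineK (integrable_fin_num mO iu)) -(fineK (integrable_fin_num mO iw)) lee_fin.
exact: h.
Qed.

(** Derivatives of test functions integrate to 0. The conclusion is an equality
    of predicates because [grad] chooses an element of the predicate: equal
    predicates, not merely equivalent ones, give equal choices. *)
Lemma addc_is_gradient u c : leb2.-integrable Om (EFin \o u) ->
  is_gradient Om (fun x => u x + c) = is_gradient Om u.
Proof.
move=> iu; apply/funext => g; apply/propext.
have E phi : test_function Om phi ->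
    \int[leb2]_(x in Om) ((u x + c) * 'D_((1, 0) : R * R) phi x) =
      \int[leb2]_(x in Om) (u x * 'D_((1, 0) : R * R) phi x) /\
    \int[leb2]_(x in Om) ((u x + c) * 'D_((0, 1) : R * R) phi x) =
      \int[leb2]_(x in Om) (u x * 'D_((0, 1) : R * R) phi x).
  move=> tf; have [_ c1 c2 _ _] := test_continuous_derive tf.
  have [z1 z2] := test_derive_integral0 oO bO B0 tf.
  have key (D : R * R -> R) : continuous D -> \int[leb2]_(x in Om) D x = 0 ->
      \int[leb2]_(x in Om) ((u x + c) * D x) = \int[leb2]_(x in Om) (u x * D x).
    move=> cD D0; have [C hC] := continuous_bnd B cD.
    have iD := continuous_integrable mO bO cD.
    have iuD : leb2.-integrable Om (EFin \o (fun x => u x * D x)).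
      apply: (int_mul mO iu (C := C)); first exact: measurable_funS (continuous_measurable2 cD).
      by move=> x /bO[? ?]; exact: hC.
    have icD : leb2.-integrable Om (EFin \o (fun x => c * D x)).
      exact: (@integrableZl _ _ _ leb2 Om mO c _ iD).
    rewrite -[RHS]addr0 -[X in _ = _ + X](mulr0 c) -D0 -RintegralZl// -RintegralD//.
    by apply: eq_Rintegral => x _; rewrite mulrDl.
  exact: (conj (key _ c1 z1) (key _ c2 z2)).
rewrite /is_gradient; split => -[mg h]; split => // phi tf; have [<- <-] := h phi tf; have [E1 E2] := E _ tf.
  exact: (conj (esym E1) (esym E2)).
exact: (conj E1 E2).
Qed.

Lemma grad_addc u c : leb2.-integrable Om (EFin \o u) -> grad Om (fun x => u x + c) = grad Om u.
Proof. by move=> iu; rewrite /grad (addc_is_gradient c iu). Qed.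

Lemma BVOn_addc u c : BVOn Om u -> BVOn Om (fun x => u x + c).
Proof.
move=> [/LpOn1P iu hg]; split; last by rewrite addc_is_gradient.
by apply/LpOn1P; have := integrableD mO iu (cst_int c).
Qed.

Lemma grad_spec u : BVOn Om u -> is_gradient Om u (grad Om u).
Proof. by move=> [_ hg]; rewrite /grad; case: pselect => // ex; case: cid. Qed.

End spaces.

(** * Comparison of a minimizer with the ground truth *)
Section bv_difference.
Context {R : realType}.
Local Notation leb2 := (@lebesgue2 R).
Local Notation fmeas := ({finite_measure set (mplane R) -> \bar R}).

Lemma fadd_integral (m1 m2 : fmeas) (D : set (mplane R)) (q : R * R -> R) (C : R) :
  measurable D -> measurable_fun setT (q : mplane R -> R) -> (forall y, D y -> `|q y| <= C) ->
  \int[fadd m1 m2]_(x in D) q x = \int[m1]_(x in D) q x + \int[m2]_(x in D) q x.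
Proof.
move=> mD mq qC.
have i1 := finite_bounded_integrable m1 mD mq qC.
have i2 := finite_bounded_integrable m2 mD mq qC.
have E := integral_measure_add mD i1 i2.
apply: etrans (congr1 fine E) _.
by rewrite fineD//; exact: integrable_fin_num.
Qed.

Lemma fine_fadd (m1 m2 : fmeas) A : measurable A ->
  fine (fadd m1 m2 A) = fine (m1 A) + fine (m2 A).
Proof. by move=> mA; rewrite /fadd measure_addE fineD ?fin_num_measure. Qed.

(** The components of the gradient of u - w are differences of finite measures,
    obtained by adding the positive part of one gradient to the negative part of
    the other. The triangle inequality through v bounds the variation. *)
Theorem bv_difference_poincare (Om : set (R * R)) (B : R) (u w : R * R -> R) (v : vmeasure R) (V1 V2 : R) :
  opn Om -> cvx Om -> bnd Om B -> BVOn Om u -> BVOn Om w ->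
  \int[leb2]_(x in Om) u x = \int[leb2]_(x in Om) w x ->
  (vmeasure_variation Om (vmeasure_sub (grad Om u) v) <= V1%:E)%E ->
  (vmeasure_variation Om (vmeasure_sub v (grad Om w)) <= V2%:E)%E ->
  \int[leb2]_(x in Om) `|u x - w x| <= diam Om / 2 * (V1 + V2).
Proof.
move=> oO cO bO bu bw uw Vu Vw; have mO := opn_measurable oO.
have [_ gu] := grad_spec bu; have [_ gw] := grad_spec bw.
have [/(LpOn1P oO) iu _] := bu; have [/(LpOn1P oO) iw _] := bw.
move: gu gw Vu Vw; set g := grad Om u; set h := grad Om w => gu gw Vu Vw.
have [p1 [n1 [I1 J1]]] := charge_integral_split g.1; have [p2 [n2 [I2 J2]]] := charge_integral_split g.2.
have [p3 [n3 [I3 J3]]] := charge_integral_split h.1; have [p4 [n4 [I4 J4]]] := charge_integral_split h.2.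
have iuw : leb2.-integrable Om (EFin \o (fun x => u x - w x)) by have := integrableB mO iu iw.
apply: (bv_poincare (a1 := fadd p1 n3) (c1 := fadd n1 p3) (a2 := fadd p2 n4) (c2 := fadd n2 p4)
  oO cO bO iuw).
- by rewrite RintegralB// uw subrr.
- move=> phi tf; have [e1 e2] := gu _ tf; have [e3 e4] := gw _ tf.
  have [cp c1 c2 _ _] := test_continuous_derive tf.
  have mp := continuous_measurable2 cp.
  have [C hC] := continuous_bnd B cp.
  have pC y : Om y -> `|phi y| <= C by move=> /bO[? ?]; exact: hC.
  have dif (D : R * R -> R) : continuous D ->
      \int[leb2]_(x in Om) ((u x - w x) * D x) =
      \int[leb2]_(x in Om) (u x * D x) - \int[leb2]_(x in Om) (w x * D x).
    move=> cD; have [K hK] := continuous_bnd B cD.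
    have iD q : leb2.-integrable Om (EFin \o q) -> leb2.-integrable Om (EFin \o (fun x => q x * D x)).
      move=> iq; apply: (int_mul mO iq (C := K)); first exact: measurable_funS (continuous_measurable2 cD).
      by move=> x /bO[? ?]; exact: hK.
    rewrite -(RintegralB mO (iD _ iu) (iD _ iw)).
    by apply: eq_Rintegral => x _; rewrite mulrBl.
  have fa (m1 m2 : fmeas) := @fadd_integral m1 m2 Om phi C mO mp pC.
  have arith (r s t z : R) : - (r - s) - - (t - z) = - ((r + z) - (s + t)) by ring.
  by rewrite (dif _ c1) (dif _ c2) !fa e1 e2 e3 e4 I1 I2 I3 I4 !arith.
- move=> E mE tE UE n.
  have s1 := partial_variation (vmeasure_sub g v) n mE tE UE.
  have s2 := partial_variation (vmeasure_sub v h) n mE tE UE.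
  have := le_trans s1 Vu; have := le_trans s2 Vw; rewrite !lee_fin => {}s2 {}s1.
  apply: le_trans (lerD s1 s2); rewrite -big_split/=; apply: ler_sum => k _.
  apply: le_trans (enormD _ _); rewrite le_eqVlt; apply/orP; left; apply/eqP; congr enorm.
  rewrite !sub_charge// !fine_fadd// J1// J2// J3// J4//.
  by congr pair => /=; ring.
- exact: diam_ge0 bO.
- exact: diam_ub bO.
Qed.
End bv_difference.

Theorem lemma4 (R : realType) (Omega : set (R * R))
    (udag u0 : R * R -> R) (v : vmeasure R) (eps delta1 : R)
    (utilde : R * R -> R) :
  bounded_domain Omega ->
  convex_set Omega ->
  LpOn Omega 2%:E udag -> BVOn Omega udag ->
  LpOn Omega 2%:E u0 ->
  \int[lebesgue2]_(x in Omega) udag x = \int[lebesgue2]_(x in Omega) u0 x ->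
  measure_on Omega v ->
  (vmeasure_variation Omega (vmeasure_sub v (grad Omega udag)) <= eps%:E)%E ->
  delta1%:E = normOn Omega 2%:E (udag \- u0) ->
  is_solution Omega u0 v delta1 utilde ->
  normOn Omega 2%:E (utilde \- u0) = delta1%:E ->
  exists ubar : R * R -> R,
    [/\ is_solution Omega u0 v delta1 ubar,
        \int[lebesgue2]_(x in Omega) ubar x =
          \int[lebesgue2]_(x in Omega) udag x
      & (normOn Omega 1%E (ubar \- udag)%R <= (diam Omega * eps)%:E)%E].
Proof.
move=> [opO _ bdO] cO L2d bd L20 eqI _ Ve dl [[L2t bt nt] mint] _.
have oO := open_opn opO; have [B B0 bO] := bounded_set_bnd bdO.
have cvO := convex_set_cvx cO; have mO := opn_measurable oO.
have id := LpOn2_int oO bO L2d; have i0 := LpOn2_int oO bO L20; have it := LpOn2_int oO bO L2t.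
pose w x := utilde x - u0 x.
have L2w : LpOn Omega 2%:E w by apply: (LpOn2D oO) => //; exact: LpOn2N.
have iw := LpOn2_int oO bO L2w; have [_ iw2] := (LpOn2P oO w).1 L2w.
pose m := fine (lebesgue2 Omega).
(* Adding c removes the mean of w = utilde - u0, which can only decrease its
   norm in L^2, and gives utilde + c the mean of u0, that is the mean of udag. *)
pose c := - (\int[lebesgue2]_(x in Omega) w x / m).
have cm : c * m = - \int[lebesgue2]_(x in Omega) w x by rewrite mulNr (mean_mul mO bO iw).
have Iw : \int[lebesgue2]_(x in Omega) w x =
    \int[lebesgue2]_(x in Omega) utilde x - \int[lebesgue2]_(x in Omega) udag x.
  by rewrite eqI -(RintegralB mO it i0).
have ic r := cst_int oO bO r.
pose ubar x := utilde x + c.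
have L2b : LpOn Omega 2%:E ubar by apply: (LpOn2D oO) => //; exact: LpOn2_cst oO bO _.
have bb : BVOn Omega ubar := BVOn_addc oO bO B0 c bt.
have gb : grad Omega ubar = grad Omega utilde := grad_addc oO bO B0 c it.
have Ib : \int[lebesgue2]_(x in Omega) ubar x = \int[lebesgue2]_(x in Omega) udag x.
  have -> : \int[lebesgue2]_(x in Omega) ubar x =
      \int[lebesgue2]_(x in Omega) utilde x + \int[lebesgue2]_(x in Omega) (cst c x).
    by rewrite -(RintegralD mO it (ic c)).
  by rewrite Rintegral_cst// -/m cm Iw; ring.
have sq : \int[lebesgue2]_(x in Omega) ((ubar x - u0 x) ^+ 2) <= \int[lebesgue2]_(x in Omega) (w x ^+ 2).
  have i2 : lebesgue2.-integrable Omega (EFin \o (fun x => 2 * c * w x)).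
    exact: (@integrableZl _ _ _ lebesgue2 Omega mO (2 * c) _ iw).
  have i3 : lebesgue2.-integrable Omega (EFin \o (fun x => w x ^+ 2 + 2 * c * w x)).
    by have := integrableD mO iw2 i2.
  have -> : \int[lebesgue2]_(x in Omega) ((ubar x - u0 x) ^+ 2) =
      \int[lebesgue2]_(x in Omega) (w x ^+ 2 + 2 * c * w x) + \int[lebesgue2]_(x in Omega) (cst (c ^+ 2) x).
    rewrite -(RintegralD mO i3 (ic _)); apply: eq_Rintegral => x _.
    by rewrite /ubar /w /cst; ring.
  rewrite (RintegralD mO iw2 i2) (RintegralZl _ mO iw) Rintegral_cst// -/m.
  have -> : \int[lebesgue2]_(x in Omega) w x = - (c * m) by rewrite cm opprK.
  have : 0 <= c ^+ 2 * m by rewrite mulr_ge0 ?sqr_ge0// fine_ge0.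
  rewrite expr2; lra.
have L2bu : LpOn Omega 2%:E (fun x => ubar x - u0 x) by apply: (LpOn2D oO) => //; exact: LpOn2N.
have feb : feasible Omega u0 delta1 ubar.
  by split; [exact: L2b|exact: bb|exact: le_trans (normOn2_le oO sq L2bu L2w) nt].
have fed : feasible Omega u0 delta1 udag by split; [exact: L2d|exact: bd|rewrite -dl].
(* Adding a constant changes neither the gradient nor the objective. *)
have slb : is_solution Omega u0 v delta1 ubar.
  by split; [exact: feb|move=> z fz; rewrite gb; exact: mint fz].
exists ubar; split; [exact: slb|exact: Ib|].
have Vb : (vmeasure_variation Omega (vmeasure_sub (grad Omega ubar) v) <= eps%:E)%E.
  by rewrite gb; apply: le_trans (mint _ fed) _; rewrite variation_sym; exact: Ve.
have [/(LpOn1P oO) ib _] := bb.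
have ibd : lebesgue2.-integrable Omega (EFin \o (fun x => ubar x - udag x)).
  by have := integrableB mO ib id.
have -> : normOn Omega 1%E (ubar \- udag)%R = (\int[lebesgue2]_(x in Omega) `|ubar x - udag x|)%:E.
  exact: (normOn1E oO ibd).
rewrite lee_fin; apply: le_trans (bv_difference_poincare oO cvO bO bb bd Ib Vb Ve) _.
by rewrite le_eqVlt; apply/orP; left; apply/eqP; field.
Qed.
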